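(* Let $\mathcal T$ be a family of trajectories of the switched system $\dot x=f(t,x,\sigma)$ which is invariant with respect to a closed covering $\chi=\{\chi_i\}_{i\in\mathcal I}$ of $\mathbb R^n$. Suppose that there exists a function $V:\mathbb R_{\ge0}\times\mathcal X\times\mathcal I\to\mathbb R_{\ge0}$ such that: (1) there exist $\phi_1,\phi_2\in\mathcal K$ such that $\phi_1(|\xi|)\le V(t,\xi,i)\le\phi_2(|\xi|)$ for all $t\ge0$, all $i\in\mathcal I$ and all $\xi\in\chi_i\cap\mathcal X$; (2) for all $i\in\mathcal I$, $V_i(\cdot,\cdot)=V(\cdot,\cdot,i)$ is continuously differentiable and, for all $t\ge0$ and all $\xi\in\chi_i\cap\mathcal X$, $$\frac{\partial V_i}{\partial t}(t,\xi)+\frac{\partial V_i}{\partial\xi}(t,\xi)f_i(t,\xi)\le-\eta_i(t,\xi),$$ where $\eta_i:\mathbb R_{\ge0}\times\mathcal X\to\mathbb R_{\ge0}$ is Lebesgue measurable in $t$ and continuous in $\xi$; (3) for every $(x,\sigma)\in\mathcal T$ and every $t_0(x)\le t<s<t_f(x)$ with $\sigma(t)=\sigma(s)=i$, $V_i(t,x(t))\ge V_i(s,x(s))$. Let $h$ be defined by $h(t,\xi,i)=\eta_i(t,\xi)$ for all $t\ge0$, $\xi\in\mathcal X$, $i\in\mathcal I$, and write $h_i=\eta_i$. Suppose in addition that each $f_i$ is uniformly bounded and that for all $i\in\mathcal I$: (i) $h_i(t,\xi)$ is uniformly bounded, measurable in $t$, continuous in $\xi$ uniformly in $t$, and precompact;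 (ii) $f_i=\hat f_i+\Delta f_i$, where (a) $\hat f_i(t,\xi)$ is uniformly bounded, measurable in $t$, continuous in $\xi$ uniformly in $t$, and precompact, and (b) $(h_i,\Delta f_i)$ is a zeroing pair. Then $\mathcal T$ is uniformly asymptotically stable (UAS) if each reduced limiting control system $\Sigma_\gamma$ ($\gamma\in\Lambda$) for $\mathcal T$ is WZSD. If, in addition, $\mathcal X=\mathbb R^n$ and the functions $\phi_1,\phi_2$ in (1) are of class $\mathcal K_\infty$, then $\mathcal T$ is globally uniformly asymptotically stable (GUAS).
   Context: **Switched system.** $\mathcal I=\{1,\dots,N\}$; $\mathcal X\subset\mathbb R^n$ is an open neighborhood of the origin. A switching signal is a function $\sigma:\mathbb R\to\mathcal I$ that is piecewise constant (finitely many jumps in each compact interval) and right-continuous; $\mathcal S$ is the set of all of them. Given $f:\mathbb R_{\ge0}\times\mathcal X\times\mathcal I\to\mathbb R^n$ write $f_i(t,\xi)=f(t,\xi,i)$. The switched system is $\dot x(t)=f(t,x(t),\sigma(t))$, with output $y(t)=h(t,x(t),\sigma(t))$. Standing assumption: each $f_i$ is measurable in $t$ and continuous in $\xi$ and satisfies the Carathéodory conditions (in addition, on each compact subset of $\mathbb R_{\ge0}\times\mathcal X$, $|f_i(t,\xi)|\le m(t)$ for some integrable $m$). A solution corresponding to $\sigma$ is a locally absolutely continuous $x:[t_0(x),t_f(x))\to\mathcal X$, $0\le t_0(x)<t_f(x)\le\infty$, with $\dot x(t)=f(t,x(t),\sigma(t))$ a.e.; it is maximal if it cannot be extended to a solution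 (for the same $\sigma$) on $[t_0(x),t')$ with $t'>t_f(x)$. A trajectory is a pair $(x,\sigma)$ with $\sigma\in\mathcal S$ and $x$ a maximal solution corresponding to $\sigma$. **Invariance.** $\chi=\{\chi_i\}_{i\in\mathcal I}$ is a closed covering of $\mathbb R^n$ if each $\chi_i$ is closed and $\bigcup_i\chi_i=\mathbb R^n$. $\mathcal T$ is invariant w.r.t. $\chi$ if $x(t)\in\chi_{\sigma(t)}$ for all $(x,\sigma)\in\mathcal T$ and $t\in[t_0(x),t_f(x))$. Put $\mathcal I_\xi=\{i\in\mathcal I:\xi\in\chi_i\}$ and $U_\xi=\mathrm{co}\{e_i:i\in\mathcal I_\xi\}$, where $e_i$ is the $i$-th canonical vector of $\mathbb R^N$ and $\mathrm{co}$ is convex hull. **Stability.** $\alpha\in\mathcal K$ means $\alpha:\mathbb R_{\ge0}\to\mathbb R_{\ge0}$ is continuous, strictly increasing, $\alpha(0)=0$; $\alpha\in\mathcal K_\infty$ if in addition it is unbounded. $\beta\in\mathcal{KL}$ means $\beta:\mathbb R_{\ge0}\times\mathbb R_{\ge0}\to\mathbb R_{\ge0}$, $\beta(\cdot,t)\in\mathcal K_\infty$ for each $t\ge0$, and for each $r\ge0$, $\beta(r,t)$ decreases monotonically to $0$ as $t\to\infty$. $\mathcal T$ is UAS if there are $\beta\in\mathcal{KL}$ and $\delta_0>0$ such that for any $(x,\sigma)\in\mathcal T$ and $s\in[t_0(x),t_f(x))$ with $|x(s)|<\delta_0$, $|x(t)|\le\beta(|x(s)|,t-s)$ for all $s\le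 t<t_f(x)$. $\mathcal T$ is GUAS if $\mathcal X=\mathbb R^n$ and there is $\beta\in\mathcal{KL}$ such that this estimate holds for any $(x,\sigma)\in\mathcal T$ and any $s\in[t_0(x),t_f(x))$. **Regularity notions.** For $g:J\times\mathcal X\to\mathbb R^m$, $J$ an interval: $g$ is uniformly bounded if there is $J'\subset J$ with $|J\setminus J'|=0$ such that $g$ is bounded on $J'\times K$ for each compact $K\subset\mathcal X$; measurable in $t$ if $g(\cdot,\xi)$ is Lebesgue measurable for all $\xi$; continuous in $\xi$ if $g(t,\cdot)$ is continuous for almost all $t$; continuous in $\xi$ uniformly in $t$ if there is $J'\subset J$ with $|J\setminus J'|=0$ such that for every compact $K\subset\mathcal X$ there is $\omega_K\in\mathcal K$ with $|g(t,\xi)-g(t,\zeta)|\le\omega_K(|\xi-\zeta|)$ for all $t\in J'$, $\xi,\zeta\in K$. For $g:\mathbb R_{\ge0}\times\mathcal X\to\mathbb R^m$, a sequence $\gamma=\{t_k\}$ of nonnegative times is admissible for $g$ if $t_k\to\infty$ and there are $g_\gamma:\mathbb R\times\mathcal X\to\mathbb R^m$ and a null set $E_\gamma\subset\mathbb R$ with $\lim_k g(t_k+s,\xi)=g_\gamma(s,\xi)$ for all $\xi\in\mathcal X$, $s\in\mathbb R\setminus E_\gamma$; $g_\gamma$ is the limiting function and $\Lambda(g)$ the set of admissible sequences. $g$ is precompact if every sequence $t_k\to\infty$ in $\mathbb R_{\ge0}$ has a subsequence in $\Lambda(g)$. A pair $(g,\hat g)$ of functions on $\mathbb R_{\ge0}\times\mathcal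 X$ is a zeroing pair if for every sequence $t_k\to\infty$ in $\mathbb R_{\ge0}$, compact $K\subset\mathcal X$, $\varepsilon>0$ and sequence $\{v_k\}$ in $K$ with $|v_k|\ge\varepsilon$ for all $k$: $g(t_k,v_k)\to0$ implies $\hat g(t_k,v_k)\to0$. **Reduced limiting control systems.** $U=\{\mu\in\mathbb R_{\ge0}^N:\sum_i\mu_i=1\}$; $\mathcal U$ is the set of Lebesgue measurable $u:\mathbb R\to U$. A switching signal $\sigma$ is identified with the control $t\mapsto e_{\sigma(t)}$ in $\mathcal U$. For $u_k,u\in\mathcal U$, $u_k\rightharpoonup u$ means $\int_{\mathbb R}\varphi(t)'u_k(t)\,dt\to\int_{\mathbb R}\varphi(t)'u(t)\,dt$ for all $\varphi\in L^1(\mathbb R;\mathbb R^N)$. $\mathcal S_{\mathcal T}=\{\sigma\in\mathcal S:\exists x,\ (x,\sigma)\in\mathcal T\}$; $\mathcal S^*_{\mathcal T}$ is the set of $u\in\mathcal U$ for which there are $t_k\to\infty$ and $\sigma_k\in\mathcal S_{\mathcal T}$ with $\sigma_k(t_k+\cdot)\rightharpoonup u$. With the decomposition $f_i=\hat f_i+\Delta f_i$ fixed, $\Lambda=\bigcap_{i\in\mathcal I}[\Lambda(\hat f_i)\cap\Lambda(h_i)]$. For $\gamma\in\Lambda$ let $\hat F_\gamma=[\hat f_{1,\gamma}\cdots\hat f_{N,\gamma}]$ and $\hat H_\gamma=[|h_{1,\gamma}|\cdots|h_{N,\gamma}|]$. The reduced limiting control system is $$\Sigma_\gamma:\ \dot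 x=\hat F_\gamma(t,x)u,\quad y=\hat H_\gamma(t,x)u=0,\quad u(t)\in U_{x(t)},\ u\in\mathcal S^*_{\mathcal T}.$$ A complete trajectory of $\Sigma_\gamma$ is a pair $(x,u)$ with $x:\mathbb R\to\mathcal X$ locally absolutely continuous, $u\in\mathcal S^*_{\mathcal T}$ and, for almost all $t\in\mathbb R$, $u(t)\in U_{x(t)}$, $\dot x(t)=\hat F_\gamma(t,x(t))u(t)$, $\hat H_\gamma(t,x(t))u(t)=0$; it is bounded if $x(\mathbb R)$ is contained in a compact subset of $\mathcal X$. $\Sigma_\gamma$ is WZSD if $\inf_{t\in\mathbb R}|x(t)|=0$ for every bounded complete trajectory $(x,u)$ of $\Sigma_\gamma$. *)

(* Defs.v *)
From HB Require Import structures.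
From mathcomp Require Import all_boot all_order all_algebra.
From mathcomp Require Import all_classical all_reals all_analysis.

Set Implicit Arguments.
Unset Strict Implicit.
Unset Printing Implicit Defensive.

Import Order.TTheory GRing.Theory Num.Theory.
Import numFieldNormedType.Exports.

Local Open Scope classical_set_scope.
Local Open Scope ring_scope.

(* Functions whose domain is a proper subset of R, R x R^n, etc. are
   represented by total functions; every definition below only refers to their
   values on the intended domain (R_{>=0}, R_{>=0} x X, [t0, tf), ...). *)

(* The norm of 'rV[R]_n provided by the library is the max norm, not
   the Euclidean one; both induce the same topology, so `compact`, `open`,
   limits and continuity are those of the library. *)

Definition dotv (R : realType) (n : nat) (v w : 'rV[R]_n) : R :=
  \sum_(j < n) v 0 j * w 0 j.

Definition enorm (R : realType) (n : nat) (v : 'rV[R]_n) : R :=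
  Num.sqrt (dotv v v).

(* The library's default sigma-algebra on R is the Borel one, so Lebesgue
   measurability is expressed on the Caratheodory type carrying the completed
   Lebesgue measure.  Null sets are the same for `lebesgue_measure` and its
   completion. *)

Definition lebR (R : realType) := caratheodory_type (@wlength R idfun)^*%mu.

Definition lebesgue_measurable (R : realType) (m : nat) (D : set R)
    (g : R -> 'rV[R]_m) : Prop :=
  forall j : 'I_m,
    measurable_fun (D : set (lebR R)) ((fun t => g t 0 j) : lebR R -> R).

Definition lebesgue_integrable (R : realType) (D : set R) (g : R -> R) : Prop :=
  (@completed_lebesgue_measure R).-integrable D (fun t => (g t)%:E).

Definition lebesgue_integralT (R : realType) (g : R -> R) : R :=
  Rintegral (@completed_lebesgue_measure R) setT g.

Definition nullset (R : realType) (E : set R) : Prop :=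
  (@lebesgue_measure R).-negligible E.

Definition nonneg_reals (R : realType) : set R := [set t | 0 <= t].

Definition classK (R : realType) (a : R -> R) : Prop :=
  [/\ {within @nonneg_reals R, continuous a},
      forall r s, 0 <= r -> r < s -> a r < a s & a 0 = 0].

Definition classKinf (R : realType) (a : R -> R) : Prop :=
  classK a /\ forall M : R, exists2 r, 0 <= r & M < a r.

Definition classKL (R : realType) (b : R -> R -> R) : Prop :=
  (forall t, 0 <= t -> classKinf (fun r => b r t)) /\
  (forall r, 0 <= r ->
    (forall s t, 0 <= s -> s <= t -> b r t <= b r s) /\
    b r t @[t --> +oo] --> (0 : R)).

Definition jumps (R : realType) (N : nat) (sigma : R -> 'I_N) : set R :=
  [set t | ~ \forall s \near t, sigma s = sigma t].

Definition switching_signal (R : realType) (N : nat) (sigma : R -> 'I_N) : Prop :=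
  (forall a b : R, finite_set (`[a, b]%classic `&` jumps sigma)) /\
  (forall t, \forall s \near t^'+, sigma s = sigma t).

Definition absolutely_continuous_on (R : realType) (n : nat) (a b : R)
    (x : R -> 'rV[R]_n) : Prop :=
  forall e : R, 0 < e -> exists2 d : R, 0 < d &
    forall (k : nat) (l r : 'I_k -> R),
      (forall i, a <= l i /\ l i <= r i /\ r i <= b) ->
      (forall i j, i != j -> r i <= l j \/ r j <= l i) ->
      \sum_(i < k) (r i - l i) < d ->
      \sum_(i < k) enorm (x (r i) - x (l i)) < e.

Definition locally_absolutely_continuous (R : realType) (n : nat) (J : set R)
    (x : R -> 'rV[R]_n) : Prop :=
  forall a b : R, a <= b -> `[a, b]%classic `<=` J ->
    absolutely_continuous_on a b x.

Definition time_domain (R : realType) (a : R) (b : \bar R) : set R :=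
  [set t | a <= t /\ (t%:E < b)%E].

Definition is_solution (R : realType) (n N : nat) (X : set 'rV[R]_n)
    (f : 'I_N -> R -> 'rV[R]_n -> 'rV[R]_n) (sigma : R -> 'I_N)
    (a : R) (b : \bar R) (x : R -> 'rV[R]_n) : Prop :=
  [/\ 0 <= a, (a%:E < b)%E,
      forall t, time_domain a b t -> X (x t),
      locally_absolutely_continuous (time_domain a b) x &
      {ae @lebesgue_measure R, forall t : R, time_domain a b t ->
        is_derive t (1 : R) x (f (sigma t) t (x t))}].

Record trajectory (R : realType) (n N : nat) := Trajectory {
  t0 : R ;
  tf : \bar R ;
  state : R -> 'rV[R]_n ;
  signal : R -> 'I_N }.

Definition traj_dom (R : realType) (n N : nat) (tau : trajectory R n N) : set R :=
  time_domain (t0 tau) (tf tau).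

Definition is_trajectory (R : realType) (n N : nat) (X : set 'rV[R]_n)
    (f : 'I_N -> R -> 'rV[R]_n -> 'rV[R]_n) (tau : trajectory R n N) : Prop :=
  [/\ switching_signal (signal tau),
      is_solution X f (signal tau) (t0 tau) (tf tau) (state tau) &
      forall (t' : \bar R) (y : R -> 'rV[R]_n), (tf tau < t')%E ->
        (forall t, traj_dom tau t -> y t = state tau t) ->
        ~ is_solution X f (signal tau) (t0 tau) t' y].

Definition closed_covering (R : realType) (n N : nat)
    (chi : 'I_N -> set 'rV[R]_n) : Prop :=
  (forall i, closed (chi i)) /\ \bigcup_i chi i = setT.

Definition invariant_family (R : realType) (n N : nat)
    (T : set (trajectory R n N)) (chi : 'I_N -> set 'rV[R]_n) : Prop :=
  forall tau, T tau -> forall t, traj_dom tau t ->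
    chi (signal tau t) (state tau t).

Definition evec (R : realType) (N : nat) (i : 'I_N) : 'rV[R]_N := delta_mx 0 i.

Definition convex_hull (R : realType) (N : nat) (A : set 'rV[R]_N) : set 'rV[R]_N :=
  smallest (@convex_set R 'rV[R]_N) A.

Definition U_at (R : realType) (n N : nat) (chi : 'I_N -> set 'rV[R]_n)
    (xi : 'rV[R]_n) : set 'rV[R]_N :=
  convex_hull [set @evec R N i | i in [set i | chi i xi]].

Definition UAS (R : realType) (n N : nat) (T : set (trajectory R n N)) : Prop :=
  exists (b : R -> R -> R) (d0 : R), [/\ classKL b, 0 < d0 &
    forall tau, T tau -> forall s, traj_dom tau s -> enorm (state tau s) < d0 ->
      forall t, s <= t -> (t%:E < tf tau)%E ->
        enorm (state tau t) <= b (enorm (state tau s)) (t - s)].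

Definition GUAS (R : realType) (n N : nat) (X : set 'rV[R]_n)
    (T : set (trajectory R n N)) : Prop :=
  X = setT /\ exists2 b : R -> R -> R, classKL b &
    forall tau, T tau -> forall s, traj_dom tau s ->
      forall t, s <= t -> (t%:E < tf tau)%E ->
        enorm (state tau t) <= b (enorm (state tau s)) (t - s).

Definition uniformly_bounded (R : realType) (n m : nat) (J : set R)
    (X : set 'rV[R]_n) (g : R -> 'rV[R]_n -> 'rV[R]_m) : Prop :=
  exists J' : set R, [/\ J' `<=` J, nullset (J `\` J') &
    forall K : set 'rV[R]_n, compact K -> K `<=` X ->
      exists M : R, forall t xi, J' t -> K xi -> enorm (g t xi) <= M].

Definition measurable_in_t (R : realType) (n m : nat) (J : set R)
    (X : set 'rV[R]_n) (g : R -> 'rV[R]_n -> 'rV[R]_m) : Prop :=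
  forall xi, X xi -> lebesgue_measurable J (fun t => g t xi).

Definition continuous_in_xi (R : realType) (n m : nat) (J : set R)
    (X : set 'rV[R]_n) (g : R -> 'rV[R]_n -> 'rV[R]_m) : Prop :=
  {ae @lebesgue_measure R, forall t : R, J t -> {within X, continuous (g t)}}.

Definition continuous_in_xi_uniformly_in_t (R : realType) (n m : nat) (J : set R)
    (X : set 'rV[R]_n) (g : R -> 'rV[R]_n -> 'rV[R]_m) : Prop :=
  exists J' : set R, [/\ J' `<=` J, nullset (J `\` J') &
    forall K : set 'rV[R]_n, compact K -> K `<=` X ->
      exists2 w : R -> R, classK w &
        forall t xi zeta, J' t -> K xi -> K zeta ->
          enorm (g t xi - g t zeta) <= w (enorm (xi - zeta))].

Definition caratheodory_conditions (R : realType) (n m : nat) (X : set 'rV[R]_n)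
    (g : R -> 'rV[R]_n -> 'rV[R]_m) : Prop :=
  [/\ measurable_in_t (@nonneg_reals R) X g,
      continuous_in_xi (@nonneg_reals R) X g &
      forall K : set (R * 'rV[R]_n)%type, compact K -> K `<=` @nonneg_reals R `*` X ->
        exists2 mb : R -> R, lebesgue_integrable (@nonneg_reals R) mb &
          forall t xi, K (t, xi) -> enorm (g t xi) <= mb t].

(* g_gam is determined by g and gam only up to a null set of times *)
Definition limiting_function (R : realType) (n m : nat) (X : set 'rV[R]_n)
    (g : R -> 'rV[R]_n -> 'rV[R]_m) (gam : nat -> R)
    (g_gam : R -> 'rV[R]_n -> 'rV[R]_m) : Prop :=
  exists2 E : set R, nullset E &
    forall xi s, X xi -> ~ E s -> g (gam k + s) xi @[k --> \oo] --> g_gam s xi.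

Definition admissible (R : realType) (n m : nat) (X : set 'rV[R]_n)
    (g : R -> 'rV[R]_n -> 'rV[R]_m) : set (nat -> R) :=
  [set gam | [/\ forall k, 0 <= gam k, gam k @[k --> \oo] --> +oo &
                 exists g_gam, limiting_function X g gam g_gam]].

Definition precompact_fun (R : realType) (n m : nat) (X : set 'rV[R]_n)
    (g : R -> 'rV[R]_n -> 'rV[R]_m) : Prop :=
  forall t_ : nat -> R, (forall k, 0 <= t_ k) -> t_ k @[k --> \oo] --> +oo ->
    exists2 p : nat -> nat, increasing_seq p & admissible X g (t_ \o p).

Definition zeroing_pair (R : realType) (n m m' : nat) (X : set 'rV[R]_n)
    (g : R -> 'rV[R]_n -> 'rV[R]_m) (ghat : R -> 'rV[R]_n -> 'rV[R]_m') : Prop :=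
  forall (t_ : nat -> R) (K : set 'rV[R]_n) (e : R) (v : nat -> 'rV[R]_n),
    (forall k, 0 <= t_ k) -> t_ k @[k --> \oo] --> +oo ->
    compact K -> K `<=` X -> 0 < e ->
    (forall k, K (v k) /\ e <= enorm (v k)) ->
    g (t_ k) (v k) @[k --> \oo] --> (0 : 'rV[R]_m) ->
    ghat (t_ k) (v k) @[k --> \oo] --> (0 : 'rV[R]_m').

(* W is continuously differentiable on R_{>=0} x X, with partial derivatives
   Wt = dW/dt (one-sided at t = 0) and Wx = dW/dxi: the Frechet derivative of W
   relative to R_{>=0} x X, which is unique as X is open, is (Wt, Wx). *)
Definition continuously_differentiable (R : realType) (n : nat) (X : set 'rV[R]_n)
    (W : R -> 'rV[R]_n -> R) (Wt : R -> 'rV[R]_n -> R)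
    (Wx : R -> 'rV[R]_n -> 'rV[R]_n) : Prop :=
  let D : set (R * 'rV[R]_n)%type := @nonneg_reals R `*` X in
  [/\ forall p, D p -> forall e : R, 0 < e ->
        \forall q \near within D (nbhs p),
          `|W q.1 q.2 - W p.1 p.2
            - (Wt p.1 p.2 * (q.1 - p.1) + dotv (Wx p.1 p.2) (q.2 - p.2))|
          <= e * (`|q.1 - p.1| + enorm (q.2 - p.2)),
      {within D, continuous (fun p : R * 'rV[R]_n => Wt p.1 p.2)} &
      {within D, continuous (fun p : R * 'rV[R]_n => Wx p.1 p.2)}].

Definition simplex (R : realType) (N : nat) : set 'rV[R]_N :=
  [set mu | (forall i, 0 <= mu 0 i) /\ \sum_(i < N) mu 0 i = 1].

Definition controls (R : realType) (N : nat) : set (R -> 'rV[R]_N) :=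
  [set u | lebesgue_measurable setT u /\ forall t, @simplex R N (u t)].

Definition L1 (R : realType) (N : nat) : set (R -> 'rV[R]_N) :=
  [set phi | forall j, lebesgue_integrable setT (fun t => phi t 0 j)].

Definition weak_cvg (R : realType) (N : nat) (u_ : nat -> R -> 'rV[R]_N)
    (u : R -> 'rV[R]_N) : Prop :=
  forall phi : R -> 'rV[R]_N, @L1 R N phi ->
    lebesgue_integralT (fun t => dotv (phi t) (u_ k t)) @[k --> \oo]
      --> lebesgue_integralT (fun t => dotv (phi t) (u t)).

Definition signals_of (R : realType) (n N : nat) (T : set (trajectory R n N)) :
    set (R -> 'I_N) :=
  [set signal tau | tau in T].

Definition limiting_controls (R : realType) (n N : nat)
    (T : set (trajectory R n N)) : set (R -> 'rV[R]_N) :=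
  [set u | controls u /\
    exists (t_ : nat -> R) (sigma_ : nat -> R -> 'I_N),
      [/\ t_ k @[k --> \oo] --> +oo, forall k, signals_of T (sigma_ k) &
          weak_cvg (fun k t => @evec R N (sigma_ k (t_ k + t))) u]].

Definition Lambda (R : realType) (n m N : nat) (X : set 'rV[R]_n)
    (fhat : 'I_N -> R -> 'rV[R]_n -> 'rV[R]_n)
    (h : 'I_N -> R -> 'rV[R]_n -> 'rV[R]_m) : set (nat -> R) :=
  [set gam | forall i, admissible X (fhat i) gam /\ admissible X (h i) gam].

Definition complete_trajectory (R : realType) (n m N : nat) (X : set 'rV[R]_n)
    (chi : 'I_N -> set 'rV[R]_n) (T : set (trajectory R n N))
    (f_gam : 'I_N -> R -> 'rV[R]_n -> 'rV[R]_n)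
    (h_gam : 'I_N -> R -> 'rV[R]_n -> 'rV[R]_m)
    (x : R -> 'rV[R]_n) (u : R -> 'rV[R]_N) : Prop :=
  [/\ forall t, X (x t),
      locally_absolutely_continuous setT x,
      limiting_controls T u &
      {ae @lebesgue_measure R, forall t : R,
        [/\ U_at chi (x t) (u t),
            is_derive t (1 : R) x (\sum_(i < N) u t 0 i *: f_gam i t (x t)) &
            \sum_(i < N) enorm (h_gam i t (x t)) * u t 0 i = 0]}].

Definition WZSD (R : realType) (n m N : nat) (X : set 'rV[R]_n)
    (chi : 'I_N -> set 'rV[R]_n) (T : set (trajectory R n N))
    (f_gam : 'I_N -> R -> 'rV[R]_n -> 'rV[R]_n)
    (h_gam : 'I_N -> R -> 'rV[R]_n -> 'rV[R]_m) : Prop :=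
  forall x u, complete_trajectory X chi T f_gam h_gam x u ->
    (exists K : set 'rV[R]_n, [/\ compact K, K `<=` X & forall t, K (x t)]) ->
    inf (range (fun t => enorm (x t))) = 0.

(* Replacing the limiting functions by other ones (equal off a null set of
   times) does not change the complete trajectories, so Sigma_gam is WZSD for
   one choice of limiting functions iff it is WZSD for every choice. *)
Definition limiting_systems_WZSD (R : realType) (n m N : nat) (X : set 'rV[R]_n)
    (chi : 'I_N -> set 'rV[R]_n) (T : set (trajectory R n N))
    (fhat : 'I_N -> R -> 'rV[R]_n -> 'rV[R]_n)
    (h : 'I_N -> R -> 'rV[R]_n -> 'rV[R]_m) : Prop :=
  forall gam, Lambda X fhat h gam -> forall f_gam h_gam,
    (forall i, limiting_function X (fhat i) gam (f_gam i)) ->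
    (forall i, limiting_function X (h i) gam (h_gam i)) ->
    WZSD X chi T f_gam h_gam.

(* Main.v *)
Require Import Defs.
From HB Require Import structures.
From mathcomp Require Import all_boot all_order all_algebra.
From mathcomp Require Import all_classical all_reals all_analysis.
From mathcomp Require Import measurable_realfun.
From mathcomp Require Import ring lra.
Set Implicit Arguments.
Unset Strict Implicit.
Unset Printing Implicit Defensive.
Import Order.TTheory GRing.Theory Num.Theory.
Import numFieldNormedType.Exports.
Local Open Scope classical_set_scope.
Local Open Scope ring_scope.

(** Stability. V does not increase between two times at which the same mode is
    active, so along a trajectory |x| can only leave the range allowed by V when
    a mode is entered for the first time.  There are N modes, hence a chain
    r_0 <= ... <= r_N with phi_2 (r_j) < phi_1 (r_(j+1)) turns |x(s)| <= r_0 into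
    |x(t)| <= r_N.

    Attractivity. Otherwise there are arbitrarily long pieces of trajectories in
    a compact set K on which |x| >= e > 0.  For each mode i the integral of eta_i
    over the times spent in mode i is at most max V, so the integral of the
    output over a piece is bounded, and by the pigeonhole principle there are
    windows [c_k - k, c_k + k] over which it is at most 1/(k+1).  Translate them
    by c_k.  The states are equi-Lipschitz and the primitives of the indicators
    of the modes are 1-Lipschitz, so along a subsequence (c_k) is in Lambda, the
    states converge to some x, and the indicators converge weakly to some control
    U.  The zeroing condition gives |Delta f| <= eps + C eta on the window, so
    Delta f does not contribute to the limit and x' = F U; the limiting output
    vanishes; and U_i = 0 almost everywhere on the open set of times at which x
    is outside chi_i.  Thus (x, U) is a bounded complete trajectory of the
    limiting system with |x| >= e, which WZSD excludes.

    Finally, triples (|x(s)|, t - s, |x(t)|) with uniform bounds, uniform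
    stability and uniform attractivity are dominated by a function of class KL.

    Functions of time are replaced throughout by bounded Borel functions equal to
    them almost everywhere. *)

(** * Absolute continuity *)

(** What shapes the details: V may jump upwards when the mode changes, since values in different
    modes are only related through phi_1 and phi_2. Hence both the stability bound and the integral
    bound are obtained mode by mode, and N enters the constants. The zeroing condition speaks of
    points where the output tends to 0, but along the windows only the integral of the output is
    small. It is therefore turned into a linear bound, with C = M / d, that can be integrated; it
    applies only away from the origin, which is why the pieces stay where |x| >= e. The half-lengths
    k of the windows tend to infinity, so the limit is defined on the whole line; c_k >= k because a
    window starts at a nonnegative time, so (c_k) tends to infinity. A limit of switching signals
    need not be a signal. It is found through the primitives of the mode indicators: their limits
    are nondecreasing and 1-Lipschitz, and U is made of their derivatives, which exist almost
    everywhere because the corresponding Stieltjes measures are dominated by Lebesgue measure. *)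

(** Cousin's lemma, by a supremum argument. It replaces the choice of a finite partition wherever
    local estimates are patched together below. *)
Lemma cousin (R : realType) (a b : R) (Q : R -> R -> Prop) : a <= b ->
  (forall r s t, a <= r -> r <= s -> s <= t -> t <= b ->
    Q r s -> Q s t -> Q r t) ->
  (forall p, a <= p -> p <= b -> exists2 d : R, 0 < d &
    forall r s, a <= r -> r <= p -> p <= s -> s <= b -> s - r < d -> Q r s) ->
  Q a b.
Proof.
move=> ab Qadd Qloc.
pose A : set R := [set x : R | [/\ a <= x, x <= b & Q a x]].
have Aa : A a.
  have [d d0 Qd] := Qloc a (lexx a) ab.
  by split => //; apply: Qd; rewrite ?subrr.
have Aub : ubound A b by move=> x [].
have supA : has_sup A by split; [exists a | exists b].
set c : R := sup A.
have ac : a <= c by apply: ub_le_sup => //; exists b.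
have cb : c <= b by apply: ge_sup => //; exists a.
have [d d0 Qd] := Qloc c ac cb.
have [x [ax xb Qax] cx] : exists2 x : R, A x & c - d / 2 < x.
  by apply: sup_adherent => //; rewrite divr_gt0.
have xc : x <= c by apply: ub_le_sup => //; exists b.
have Ac (x0 : R) : A x0 -> x0 <= c by move=> Ax0; apply: ub_le_sup => //; exists b.
clearbody c.
(* Unless c = b, the point s lies beyond the supremum c; d / 2 + d / 3 < d keeps [x, s] within the
   scale allowed at c. *)
have [s [cs sb sd sE]] : exists s : R,
    [/\ c <= s, s <= b, s <= c + d / 3 & s = b \/ s = c + d / 3].
  exists (Num.min b (c + d / 3)).
  have d3 : 0 < d / 3 by rewrite divr_gt0.
  by case: (leP b (c + d / 3)) => h; split; lra.
have Qxs : Q x s by apply: Qd => //; lra.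
have As : A s.
  by split => //; [lra | apply: (Qadd a x s) => //; lra].
have sc : s <= c by exact: Ac.
have -> // : b = s.
  by case: sE => // sE; exfalso; lra.
by case: As.
Qed.

(** The intervals form a list ordered from left to right, so that the families of two adjacent
    pieces combine by concatenation. *)
Definition absc (R : realType) (a b : R) (x : R -> R) : Prop :=
  forall e : R, 0 < e -> exists2 d : R, 0 < d &
    forall s : seq (R * R),
      all (fun i => [&& a <= i.1, i.1 <= i.2 & i.2 <= b]) s ->
      pairwise (fun i j => i.2 <= j.1) s ->
      \sum_(i <- s) (i.2 - i.1) < d ->
      \sum_(i <- s) `|x i.2 - x i.1| < e.

Lemma nullset_open_cover (R : realType) (E : set R) (d : R) : nullset E -> 0 < d ->
  exists U : set R, [/\ open U, E `<=` U & (lebesgue_measure U < d%:E)%E].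
Proof.
move=> [A [mA A0 EA]] d0.
have [|U [oU AU UA]] := lebesgue_regularity_outer mA _ d0; first by rewrite [X in (X < _)%E]A0.
have mU : measurable U by exact: open_measurable.
exists U; split => //; first exact: subset_trans AU.
rewrite -(setDUK AU); apply: le_lt_trans UA.
rewrite (le_trans (measureU2 _ _ _))//; first exact: measurableD.
by rewrite [X in (X + _)%E]A0 add0e.
Qed.

(* A rate-independent, one-sided form of [phi^'(t) <= 0] that tolerates
   intervals [r, s] merely containing t. *)
Definition upper_deriv_le0 (R : realType) (phi : R -> R) (t : R) : Prop :=
  forall e : R, 0 < e -> \forall s \near t,
    (t <= s -> phi s - phi t <= e * (s - t)) /\
    (s <= t -> phi t - phi s <= e * (t - s)).

(* On the exceptional null set, covered by a small open set, the increments
   are controlled by absolute continuity; elsewhere by the derivative. *)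
Lemma absc_nonincreasing (R : realType) (a b : R) (phi : R -> R) : a <= b ->
  absc a b phi ->
  {ae @lebesgue_measure R, forall t : R, a < t < b -> upper_deriv_le0 phi t} ->
  phi b <= phi a.
Proof.
move=> ab phi_ac phi_ae.
apply/ler_addgt0Pr => e1 e10.
pose e : R := e1 / (b - a + 1).
have e0 : 0 < e by rewrite divr_gt0// ltr_wpDl// subr_ge0.
have eE : e * (b - a) + e = e1.
  by rewrite /e -{2}[e1 / _]mulr1 -mulrDr divfK// gt_eqF// ltr_wpDl// subr_ge0.
have [d d0 acd] := phi_ac e e0.
pose E := ~` [set t : R | a < t < b -> upper_deriv_le0 phi t] `|` [set a] `|` [set b].
have nE : nullset E.
  by do 2 (apply: negligibleU; last by apply/negligibleP => //; exact: lebesgue_measure_set1).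
have [U [oU EU Ud]] := nullset_open_cover nE d0.
have mU : measurable U by exact: open_measurable.
have Ufin (A : set R) : measurable A -> lebesgue_measure (U `&` A) \is a fin_num.
  move=> mA; rewrite ge0_fin_numE//; apply: le_lt_trans (lt_trans Ud (ltry d)).
  by apply: le_measure; rewrite ?inE//; exact: measurableI.
pose m (r s : R) : R := fine (@lebesgue_measure R (U `&` `[r, s[)).
have mD r s t : r <= s -> s <= t -> m r s + m s t = m r t.
  move=> rs st; rewrite /m -fineD ?Ufin//; congr fine.
  rewrite (_ : `[r, t[%classic = `[r, s[ `|` `[s, t[)%classic; last first.
    by rewrite -itv_bndbnd_setU//= bnd_simp.
  rewrite setIUr measureU//; try exact: measurableI.
  rewrite setIACA setIid; apply/seteqP; split => // x [_ []] /=.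
  by rewrite !in_itv/= => /andP[_ +] /andP[+ _]; rewrite ltNge => /negbTE ->.
(* The total length of [bad] is charged to the measure of U in [r, s[, which is additive and below d
   on the whole interval. Outside [bad] the increment costs at most e per unit length. *)
pose Q (r s : R) := exists bad : seq (R * R),
  [/\ all (fun i => [&& r <= i.1, i.1 <= i.2 & i.2 <= s]) bad,
      pairwise (fun i j => i.2 <= j.1) bad,
      \sum_(i <- bad) (i.2 - i.1) <= m r s &
      phi s - phi r <= e * (s - r) + \sum_(i <- bad) `|phi i.2 - phi i.1|].
suff [bad [Hall Hpw Hlen Hphi]] : Q a b.
  have := acd bad Hall Hpw.
  have lt_d : \sum_(i <- bad) (i.2 - i.1) < d.
    apply: le_lt_trans Hlen _; rewrite -lte_fin fineK ?Ufin//.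
    by apply: le_lt_trans Ud; apply: le_measure; rewrite ?inE//; exact: measurableI.
  by move=> /(_ lt_d); lra.
apply: cousin => //.
- move=> r s t ar rs st tb [b1 [a1 p1 l1 f1]] [b2 [a2 p2 l2 f2]].
  exists (b1 ++ b2); split.
  + rewrite all_cat; apply/andP; split.
      by apply: sub_all a1 => i /and3P[-> -> /= /le_trans]; apply.
    by apply: sub_all a2 => i /and3P[/(le_trans rs) -> -> ->].
  + rewrite pairwise_cat p1 p2 !andbT; apply/allrelP => i j ib jb.
    move/allP : a1 => /(_ _ ib) /and3P[_ _ is_].
    move/allP : a2 => /(_ _ jb) /and3P[sj _ _].
    exact: le_trans sj.
  + by rewrite big_cat/= -(mD r s t)// lerD.
  + by rewrite big_cat/=; lra.
- move=> p ap pb; have [Ep|Ep] := pselect (E p).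
    have := oU; rewrite openE => /(_ p (EU _ Ep)) /nbhs_ballP[d1 /= d10 Bd].
    exists d1 => // r s ar rp ps sb srd; exists [:: (r, s)]; split => //=.
    + by rewrite !lexx (le_trans rp ps).
    + rewrite big_seq1/= /m (_ : U `&` _ = `[r, s[%classic); last first.
        apply/seteqP; split => [x []//|x /= rxs]; split => //; apply: Bd.
        move: rxs; rewrite in_itv/= /ball/= => /andP[rx xs].
        by rewrite ltr_distlC; apply/andP; split; lra.
      rewrite lebesgue_measure_itv/= lte_fin; case: ltP => /= h; lra.
    + rewrite big_seq1/= ler_wpDl// ?ler_norm// mulr_ge0 ?(ltW e0)//.
      by rewrite subr_ge0 (le_trans rp ps).
  have [[/contrapT hp pa] pb'] : (~ (~ (a < p < b -> upper_deriv_le0 phi p)) /\ p <> a) /\ p <> b.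
    by split; [split|] => h; apply: Ep; rewrite /E; [left; left | left; right | right].
  have /hp{}hp : a < p < b.
    by rewrite !lt_neqAle ap pb !andbT; apply/andP; split; apply/eqP => // /esym.
  have /nbhs_ballP[d1 /= d10 Bd] := hp e e0.
  exists d1 => // r s ar rp ps sb srd; exists [::]; split => //=.
    by rewrite big_nil fine_ge0.
  rewrite big_nil addr0.
  have Br : ball p d1 r by rewrite /ball/= ger0_norm ?subr_ge0//; lra.
  have Bs : ball p d1 s by rewrite /ball/= distrC ger0_norm ?subr_ge0//; lra.
  have [+ _] := Bd _ Bs => /(_ ps).
  by have [_ +] := Bd _ Br => /(_ rp); lra.
Qed.

(** * Integrals of bounded Borel functions *)

Lemma ae_mono (R : realType) (P Q : R -> Prop) : (forall t, P t -> Q t) ->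
  {ae @lebesgue_measure R, forall t : R, P t} ->
  {ae @lebesgue_measure R, forall t : R, Q t}.
Proof. by move=> PQ; apply: negligibleS => t; apply: contra_not; exact: PQ. Qed.

Lemma ae_and (R : realType) (P Q : R -> Prop) :
  {ae @lebesgue_measure R, forall t : R, P t} ->
  {ae @lebesgue_measure R, forall t : R, Q t} ->
  {ae @lebesgue_measure R, forall t : R, P t /\ Q t}.
Proof.
move=> aP aQ; have := negligibleU aP aQ; apply: negligibleS => t /= /not_andP.
by move=> [?|?]; [left|right].
Qed.

Lemma ae_all (R : realType) (I : countType) (P : I -> R -> Prop) :
  (forall i, {ae @lebesgue_measure R, forall t : R, P i t}) ->
  {ae @lebesgue_measure R, forall t : R, forall i, P i t}.
Proof.
move=> aP.
have /negligible_bigcup : forall k : nat, (@lebesgue_measure R).-negligible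
    [set t | exists2 i, unpickle k = Some i & ~ P i t].
  move=> k; case E : (unpickle k) => [i|].
    by apply: negligibleS (aP i) => t /= [j [<-]].
  by apply: negligibleS (@negligible_set0 _ _ _ lebesgue_measure) => t [].
apply: negligibleS => t /= /existsNP[i Pi]; exists (pickle i) => //.
by exists i => //; rewrite pickleK.
Qed.

Definition IR (R : realType) (g : R -> R) (a b : R) : R :=
  Rintegral (@lebesgue_measure R) `[a, b] g.

(** Boundedness on the whole line makes integrability on every compact interval immediate, so the
    rules for [IR] carry no other side condition; the class is stable under all operations used
    below. *)
Definition bm (R : realType) (g : R -> R) : Prop :=
  measurable_fun [set: R] g /\ exists M : R, forall t, `|g t| <= M.

Lemma bmD (R : realType) (f g : R -> R) : bm f -> bm g -> bm (fun t => f t + g t).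
Proof.
move=> [mf [M fM]] [mg [K gK]]; split; first exact: measurable_funD.
by exists (M + K) => t; rewrite (le_trans (ler_normD _ _))// lerD.
Qed.

Lemma bmN (R : realType) (f : R -> R) : bm f -> bm (fun t => - f t).
Proof.
move=> [mf [M fM]]; split; first exact: measurableT_comp.
by exists M => t; rewrite normrN.
Qed.

Lemma bmB (R : realType) (f g : R -> R) : bm f -> bm g -> bm (fun t => f t - g t).
Proof. by move=> bf /bmN; exact: bmD. Qed.

Lemma bmM (R : realType) (f g : R -> R) : bm f -> bm g -> bm (fun t => f t * g t).
Proof.
move=> [mf [M fM]] [mg [K gK]]; split; first exact: measurable_funM.
by exists (M * K) => t; rewrite normrM ler_pM.
Qed.

Lemma bm_cst (R : realType) (c : R) : bm (fun=> c).
Proof. by split; [exact: measurable_cst | exists `|c|]. Qed.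

Lemma bm_norm (R : realType) (f : R -> R) : bm f -> bm (fun t => `|f t|).
Proof.
move=> [mf [M fM]]; split; first exact: measurableT_comp.
by exists M => t; rewrite normr_id.
Qed.

Lemma bm_max (R : realType) (f g : R -> R) : bm f -> bm g ->
  bm (fun t => Num.max (f t) (g t)).
Proof.
move=> [mf [M fM]] [mg [K gK]]; split; first exact: measurable_maxr.
exists (Num.max M K) => t; rewrite le_max.
by case: (leP (f t) (g t)) => _; rewrite ?fM ?gK ?orbT.
Qed.

Lemma bm_sum (R : realType) (I : Type) (r : seq I) (f : I -> R -> R) :
  (forall i, bm (f i)) -> bm (fun t => \sum_(i <- r) f i t).
Proof.
move=> bf; elim: r => [|i r ih].
  by under eq_fun do rewrite big_nil; exact: bm_cst.
by under eq_fun do rewrite big_cons; exact: bmD.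
Qed.

Lemma bm_indic (R : realType) (A : set R) : measurable A -> bm (\1_A : R -> R).
Proof.
move=> mA; split; first exact: measurable_indic.
by exists 1 => t; rewrite indicE; case: (_ \in _); rewrite ?normr1 ?normr0.
Qed.

Lemma bm_integrable (R : realType) (g : R -> R) (A : set R) : bm g -> measurable A ->
  (lebesgue_measure A < +oo)%E -> lebesgue_measure.-integrable A (EFin \o g).
Proof.
move=> [mg [M gM]] mA Afin; apply: measurable_bounded_integrable => //.
  exact: measurable_funS mg.
by exists M; split; [exact: num_real|move=> r Mr x _; exact: le_trans (gM x) (ltW Mr)].
Qed.

Lemma itv_measure_fin (R : realType) (a b : R) :
  (@lebesgue_measure R `[a, b] < +oo)%E.
Proof. by rewrite lebesgue_measure_itv/=; case: ifP => // _; rewrite -EFinD ltry. Qed.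

Lemma fine_lebesgue_measure_itv (R : realType) (a b : R) : a <= b ->
  fine (@lebesgue_measure R `[a, b]) = b - a.
Proof.
move=> ab; rewrite lebesgue_measure_itv/= lte_fin; case: ltP => //= ba.
by rewrite (le_anti (introT andP (conj ab ba))) subrr.
Qed.

Lemma bm_integrable_itv (R : realType) (g : R -> R) (a b : R) : bm g ->
  lebesgue_measure.-integrable `[a, b] (EFin \o g).
Proof. by move=> bg; apply: bm_integrable => //; exact: itv_measure_fin. Qed.

Lemma IRD (R : realType) (f g : R -> R) (a b : R) : bm f -> bm g ->
  IR (fun t => f t + g t) a b = IR f a b + IR g a b.
Proof. by move=> bf bg; rewrite /IR RintegralD//; exact: bm_integrable_itv. Qed.

Lemma IRB (R : realType) (f g : R -> R) (a b : R) : bm f -> bm g ->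
  IR (fun t => f t - g t) a b = IR f a b - IR g a b.
Proof. by move=> bf bg; rewrite /IR RintegralB//; exact: bm_integrable_itv. Qed.

Lemma IRZ (R : realType) (c : R) (f : R -> R) (a b : R) : bm f ->
  IR (fun t => c * f t) a b = c * IR f a b.
Proof. by move=> bf; rewrite /IR RintegralZl//; exact: bm_integrable_itv. Qed.

Lemma IR_cst (R : realType) (c : R) (a b : R) : a <= b ->
  IR (fun=> c) a b = c * (b - a).
Proof.
move=> ab; rewrite /IR Rintegral_cst//; congr (_ * _).
exact: fine_lebesgue_measure_itv.
Qed.

Lemma IR_sum (R : realType) (I : Type) (r : seq I) (f : I -> R -> R) (a b : R) :
  a <= b -> (forall i, bm (f i)) ->
  IR (fun t => \sum_(i <- r) f i t) a b = \sum_(i <- r) IR (f i) a b.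
Proof.
move=> ab bf; elim: r => [|i r ih].
  under [fun t => _]eq_fun do rewrite big_nil.
  by rewrite big_nil IR_cst// mul0r.
under [fun t => _]eq_fun do rewrite big_cons.
by rewrite big_cons IRD// ?ih//; exact: bm_sum.
Qed.

Lemma IR_split (R : realType) (f : R -> R) (a b c : R) : a <= b -> b <= c -> bm f ->
  IR f a c = IR f a b + IR f b c.
Proof.
move=> ab bc bf; apply/eqP; rewrite addrC -subr_eq; apply/eqP.
rewrite /IR Rintegral_itvB//; [|exact: bm_integrable_itv..].
rewrite Rintegral_itv_obnd_cbnd//.
by apply: integrableS (bm_integrable_itv b c bf) => //; exact: subset_itv_oc_cc.
Qed.

Lemma IR_ge0 (R : realType) (f : R -> R) (a b : R) : (forall t, 0 <= f t) ->
  0 <= IR f a b.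
Proof. by move=> f0; apply: Rintegral_ge0. Qed.

Lemma IR_eq_ae (R : realType) (f g : R -> R) (a b : R) : bm f -> bm g ->
  {ae @lebesgue_measure R, forall t : R, a <= t <= b -> f t = g t} ->
  IR f a b = IR g a b.
Proof.
move=> [mf _] [mg _] fg; rewrite /IR /Rintegral; congr fine.
apply: ae_eq_integral => //.
- by apply/measurable_EFinP; exact: measurable_funS mf.
- by apply/measurable_EFinP; exact: measurable_funS mg.
- by apply: ae_mono fg => t + tab; rewrite /= in_itv/= in tab => /(_ tab) ->.
Qed.

Lemma IR_le_ae (R : realType) (f g : R -> R) (a b : R) : bm f -> bm g ->
  {ae @lebesgue_measure R, forall t : R, a <= t <= b -> f t <= g t} ->
  IR f a b <= IR g a b.
Proof.
move=> bf bg fg.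
(* The positive part of g - f is nonnegative everywhere and agrees with g - f almost everywhere on
   [a, b]. *)
have b0 : bm (fun t => Num.max (g t - f t) 0) by apply: bm_max; [exact: bmB|exact: bm_cst].
rewrite -subr_ge0 -IRB// (@IR_eq_ae _ _ (fun t => Num.max (g t - f t) 0))//.
- by apply: IR_ge0 => t; rewrite le_max lexx orbT.
- exact: bmB.
- by apply: ae_mono fg => t h /h h1; rewrite max_l// subr_ge0.
Qed.

Lemma IR_le (R : realType) (f g : R -> R) (a b : R) : bm f -> bm g ->
  (forall t : R, a <= t <= b -> f t <= g t) -> IR f a b <= IR g a b.
Proof. by move=> bf bg fg; apply: IR_le_ae => //; exact: aeW. Qed.

Lemma IR_norm (R : realType) (f : R -> R) (a b : R) : bm f ->
  `|IR f a b| <= IR (fun t => `|f t|) a b.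
Proof.
by move=> bf; apply: le_normr_Rintegral => //; exact: bm_integrable_itv.
Qed.

Lemma IR_bound (R : realType) (f : R -> R) (M a b : R) : a <= b -> bm f ->
  (forall t, a <= t <= b -> `|f t| <= M) -> `|IR f a b| <= M * (b - a).
Proof.
move=> ab bf fM; rewrite -IR_cst// (le_trans (IR_norm _ _ bf))//.
by apply: IR_le => //; [exact: bm_norm|exact: bm_cst].
Qed.

Lemma IR_cvg (R : realType) (g_ : nat -> R -> R) (g : R -> R) (M a b : R) :
  (forall k, measurable_fun [set: R] (g_ k)) -> measurable_fun [set: R] g ->
  (forall k t, `|g_ k t| <= M) ->
  {ae @lebesgue_measure R, forall t : R, a <= t <= b -> g_ k t @[k --> \oo] --> g t} ->
  IR (g_ k) a b @[k --> \oo] --> IR g a b.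
Proof.
move=> mg_ mg gM cvg.
have [] := @dominated_convergence _ _ _ (@lebesgue_measure R) `[a, b]%classic
  (measurable_itv _) (fun k t => (g_ k t)%:E) (fun t => (g t)%:E) (fun=> M%:E).
- by move=> k; apply/measurable_EFinP; exact: measurable_funS (mg_ k).
- by apply/measurable_EFinP; exact: measurable_funS mg.
- apply: ae_mono cvg => t + tab; rewrite /= in_itv/= in tab => /(_ tab) h.
  by apply: cvg_EFin => //; exact: nearW.
- by apply: (@bm_integrable_itv _ (fun=> M)); exact: bm_cst.
- by apply: aeW => t k _; rewrite lee_fin.
- move=> ig _ h; apply: fine_cvg; rewrite fineK//.
  exact: integrable_fin_num.
Qed.

(** * Derivatives almost everywhere *)

(** The derivative without division: the inequality is meaningful at s = t and can be added and
    compared directly. *)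
Definition has_deriv (R : realType) (W : normedModType R) (x : R -> W) (t : R) (v : W) :=
  forall e : R, 0 < e ->
    \forall s \near t, `|x s - x t - (s - t) *: v| <= e * `|s - t|.

Lemma is_derive_has_deriv (R : realType) (W : normedModType R) (x : R -> W)
    (t : R) (v : W) :
  is_derive t (1 : R) x v <-> has_deriv x t v.
Proof.
have E : (h^-1 *: (x (h + t) - x t) @[h --> (0 : R)^'] --> v) <-> has_deriv x t v.
  split.
    move=> /cvgrPdist_le xv e e0.
    have /= := xv _ e0 => /nbhs_ballP[d /= d0 Bd].
    apply/nbhs_ballP; exists d => //= s st.
    have [->|sNt] := eqVneq s t; first by rewrite !subrr scale0r subrr !normr0 mulr0.
    have h0 : s - t != 0 by rewrite subr_eq0.
    have : `|v - (s - t)^-1 *: (x (s - t + t) - x t)| <= e.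
      apply: Bd => //=; rewrite /ball/= sub0r normrN distrC//.
    rewrite subrK -(ler_pM2l (x := `|s - t|)) ?normr_gt0// -normrZ scalerBr scalerA.
    by rewrite divff// scale1r distrC mulrC.
  move=> xv; apply/cvgrPdist_le => e e0.
  have /= := xv _ e0 => /nbhs_ballP[d /= d0 Bd].
  near=> h.
  have h0 : h != 0 by near: h; exact: nbhs_dnbhs_neq.
  rewrite -(ler_pM2l (x := `|h|)) ?normr_gt0// -normrZ scalerBr scalerA.
  rewrite divff// scale1r distrC.
  have := Bd (h + t); rewrite addrK (mulrC e); apply.
  rewrite /ball/= opprD addrCA subrr addr0 normrN.
  by near: h; exact: dnbhs0_lt.
rewrite -E; split.
  move=> [dx <-]; move: dx; rewrite /derivable /derive.
  under eq_fun do rewrite /= -[_ *: 1]/(_ * 1) mulr1.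
  by [].
move=> xv.
have xv' : h^-1 *: ((x \o shift t) (h *: (1 : R)) - x t) @[h --> (0 : R)^'] --> v.
  by under eq_fun do rewrite /= -[_ *: 1]/(_ * 1) mulr1.
split; first by apply/cvg_ex; exists v.
exact: cvg_lim xv'.
Unshelve. all: by end_near. Qed.

(** The upper right and upper left Dini derivatives of phi at t are at most v. *)
Definition upper_deriv_le (R : realType) (phi : R -> R) (t v : R) : Prop :=
  forall e : R, 0 < e -> \forall s \near t,
    (t <= s -> phi s - phi t <= (v + e) * (s - t)) /\
    (s <= t -> phi t - phi s <= (v + e) * (t - s)).

Lemma has_deriv_upper (R : realType) (phi : R -> R) (t v w : R) :
  v <= w -> has_deriv phi t v -> upper_deriv_le phi t w.
Proof.
move=> vw hd e e0; apply: filterS (hd e e0) => s; rewrite -[_ *: v]/(_ * v).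
rewrite ler_norml => /andP[h1 h2]; split => ts.
  have t0 : 0 <= s - t by rewrite subr_ge0.
  rewrite ger0_norm// in h2; have := ler_wpM2r t0 vw; lra.
have t0 : 0 <= t - s by rewrite subr_ge0.
rewrite distrC ger0_norm// in h1; have := ler_wpM2r t0 vw; lra.
Qed.

Lemma upper_deriv_leB (R : realType) (phi psi : R -> R) (t v w : R) :
  upper_deriv_le phi t v -> has_deriv psi t w ->
  upper_deriv_le (fun s => phi s - psi s) t (v - w).
Proof.
move=> hphi hpsi e e0.
have e2 : 0 < e / 2 by rewrite divr_gt0.
apply: filterS2 (hphi _ e2) (hpsi _ e2) => s [h1 h2].
rewrite -[_ *: w]/(_ * w) ler_norml => /andP[h3 h4]; split => ts.
  have t0 : 0 <= s - t by rewrite subr_ge0.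
  rewrite ger0_norm// in h3; have := h1 ts; lra.
have t0 : 0 <= t - s by rewrite subr_ge0.
rewrite distrC ger0_norm// in h4; have := h2 ts; lra.
Qed.

Lemma measurable_shift (R : realType) (c : R) :
  measurable_fun [set: R] (fun t : R => c + t).
Proof. by apply: measurable_funD => //; exact: measurable_cst. Qed.

Lemma lebesgue_measure_shift (R : realType) (c : R) (A : set R) : measurable A ->
  lebesgue_measure ((fun t : R => c + t) @^-1` A) = lebesgue_measure A.
Proof.
move=> mA.
pose f : measurableTypeR R -> measurableTypeR R := fun t : R => c + t.
have := @lebesgue_measure_unique R (pushforward (@lebesgue_measure R) f).
move=> /(_ (measurable_shift c) _ A mA) -> // X /ocitvP[->|[[a b] /= ab ->]].
  by rewrite measure0 [RHS]measure0.
rewrite [RHS](_ : _ = lebesgue_measure `]a - c, b - c]%classic).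
  by rewrite !lebesgue_measure_itv/= !lte_fin ab ltrD2r ab -!EFinB; congr _%:E; lra.
congr (lebesgue_measure _).
by apply/seteqP; split => t /=; rewrite !in_itv/= => /andP[h1 h2]; apply/andP; split; rewrite /f in h1 h2 *; lra.
Qed.

Lemma ae_shift (R : realType) (c : R) (P : R -> Prop) :
  {ae @lebesgue_measure R, forall t : R, P t} ->
  {ae @lebesgue_measure R, forall t : R, P (c + t)}.
Proof.
move=> [A [mA A0 PA]].
exists ((fun t : R => c + t) @^-1` A); split.
- by rewrite -[_ @^-1` _]setTI; exact: measurable_shift.
- by rewrite lebesgue_measure_shift.
- by move=> t /= nP; apply: PA.
Qed.

Lemma bm_shift (R : realType) (c : R) (g : R -> R) : bm g -> bm (fun t => g (c + t)).
Proof.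
move=> [mg [M gM]]; split; last by exists M.
exact: (measurableT_comp mg (measurable_shift c)).
Qed.

Lemma bm_locally_integrable (R : realType) (g : R -> R) : bm g ->
  locally_integrable setT g.
Proof.
move=> bg; split; [by case: bg|exact: openT|move=> K _ cK].
have /integrableP[_] : lebesgue_measure.-integrable K (EFin \o g).
  apply: bm_integrable => //; first exact: compact_measurable.
  exact: compact_finite_measure.
by [].
Qed.

Lemma locally_integrable_itv (R : realType) (g : R -> R) (a b : R) :
  locally_integrable setT g ->
  lebesgue_measure.-integrable `[a, b] (EFin \o g).
Proof.
move=> [mg _ ig]; apply/integrableP; split.
  by apply/measurable_EFinP; exact: measurable_funS mg.
by apply: ig => //; exact: segment_compact.
Qed.

(** At a Lebesgue point t of g, the integral from t - 1 to s has derivative g t in s, and x differs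
    from it by a constant near t. The base point t - 1 puts t in the interior of the range of
    integration. *)
Lemma ae_has_deriv_IR (R : realType) (g x : R -> R) : locally_integrable setT g ->
  (forall a b, a <= b -> x b - x a = IR g a b) ->
  {ae @lebesgue_measure R, forall t : R, has_deriv x t (g t)}.
Proof.
move=> lg xg.
apply: ae_mono (lebesgue_differentiation lg) => t gt.
have t1 : t < t + 1 by rewrite ltrDl.
have t2 : (BLeft (t - 1)%R < BRight t)%E by rewrite lte_fin gtrBl.
have [dF DF] := @FTC1_lebesgue_pt R g (BLeft (t - 1)) t (t + 1)
  t1 (locally_integrable_itv _ _ lg) t2 gt.
set F := (fun y => _) in dF DF.
have : is_derive t (1 : R) F (g t).
  by apply: (DeriveDef dF); rewrite -derive1E.
move=> /is_derive_has_deriv hF e e0.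
have Bt : \forall s \near t, t - 1 <= s.
  by near=> s; apply: ltW; near: s; apply: lt_nbhsr; lra.
apply: filterS2 Bt (hF e e0) => s ts.
rewrite (_ : F s - F t = x s - x t)// /F.
have <- : x s - x (t - 1) = \int[lebesgue_measure]_(t0 in `[t - 1, s]) g t0.
  by rewrite xg.
have <- : x t - x (t - 1) = \int[lebesgue_measure]_(t0 in `[t - 1, t]) g t0.
  by rewrite xg//; lra.
lra.
Unshelve. all: by end_near. Qed.

Lemma IR_gt (R : realType) (g : R -> R) (a b : R) : b < a -> IR g a b = 0.
Proof. by move=> ba; rewrite /IR set_itv_ge ?Rintegral_set0// bnd_simp -ltNge. Qed.

Lemma IR_pt (R : realType) (g : R -> R) (a : R) : IR g a a = 0.
Proof. by rewrite /IR set_itv1 Rintegral_set1. Qed.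

(* One of the two integrals is over an empty interval, so this is the oriented
   integral from 0 to t. *)
Definition primitive (R : realType) (g : R -> R) (t : R) : R := IR g 0 t - IR g t 0.

Lemma primitiveB (R : realType) (g : R -> R) (a b : R) : bm g -> a <= b ->
  primitive g b - primitive g a = IR g a b.
Proof.
move=> bg ab; rewrite /primitive.
have pos c : 0 <= c -> IR g c 0 = 0.
  by rewrite le_eqVlt => /predU1P[<-|/IR_gt->//]; rewrite IR_pt.
have neg c : c <= 0 -> IR g 0 c = 0.
  by rewrite le_eqVlt => /predU1P[->|/IR_gt->//]; rewrite IR_pt.
have [a0|a0] := leP 0 a.
  have b0 := le_trans a0 ab; rewrite (pos a)// (pos b)// (IR_split a0 ab bg); ring.
have [b0|b0] := leP 0 b.
  rewrite (pos b)// (neg a (ltW a0)) (IR_split (ltW a0) b0 bg); ring.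
rewrite (neg a (ltW a0)) (neg b (ltW b0)) (IR_split ab (ltW b0) bg); ring.
Qed.

Lemma primitive_lip (R : realType) (g : R -> R) (M s t : R) : bm g ->
  (forall t, `|g t| <= M) -> `|primitive g s - primitive g t| <= M * `|s - t|.
Proof.
move=> bg gM; wlog ts : s t / t <= s.
  have [ts|/ltW st] := leP t s; first exact.
  by move=> /(_ _ _ st); rewrite distrC (distrC s).
by rewrite primitiveB// [`|s - t|]ger0_norm ?subr_ge0//; exact: IR_bound.
Qed.

Lemma lip_absc (R : realType) (a b L : R) (phi : R -> R) :
  (forall s t, a <= s -> s <= t -> t <= b -> `|phi t - phi s| <= L * (t - s)) ->
  absc a b phi.
Proof.
move=> phiL e e0; exists (e / (`|L| + 1)); first by rewrite divr_gt0// ltr_wpDl.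
move=> s sab _ slt.
have L1 : 0 < `|L| + 1 by rewrite ltr_wpDl.
rewrite ltr_pdivlMr// in slt; apply: le_lt_trans slt.
rewrite mulr_suml big_seq [leRHS]big_seq; apply: ler_sum => i /(allP sab)/and3P[ai ii ib].
apply: le_trans (phiL _ _ ai ii ib) _; rewrite mulrC ler_wpM2l ?subr_ge0//.
by rewrite (le_trans (ler_norm _))// lerDl.
Qed.

Lemma abscB (R : realType) (a b : R) (phi psi : R -> R) :
  absc a b phi -> absc a b psi -> absc a b (fun t => phi t - psi t).
Proof.
move=> hphi hpsi e e0; have e2 : 0 < e / 2 by rewrite divr_gt0.
have [d d0 dphi] := hphi _ e2; have [c c0 cpsi] := hpsi _ e2.
exists (Num.min d c); first by rewrite lt_min d0 c0.
move=> s sab spw; rewrite lt_min => /andP[sd sc].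
have := ltrD (dphi s sab spw sd) (cpsi s sab spw sc).
rewrite -splitr -big_split/=; apply: le_lt_trans; apply: ler_sum => i _.
rewrite (_ : phi i.2 - _ - _ = (phi i.2 - phi i.1) - (psi i.2 - psi i.1)); last by ring.
exact: ler_normB.
Qed.

Lemma abscN (R : realType) (a b : R) (phi : R -> R) :
  absc a b phi -> absc a b (fun t => - phi t).
Proof.
move=> hphi e /hphi[d d0 dphi]; exists d => // s sab spw sd.
by under eq_bigr do rewrite -opprD normrN; exact: dphi.
Qed.

(** Subtracting a primitive of g reduces this to [absc_nonincreasing]. It is the half of the
    fundamental theorem that integrates the decrease of V along a trajectory. *)
Lemma absc_le_IR (R : realType) (a b : R) (phi g : R -> R) : a <= b ->
  absc a b phi -> bm g ->
  {ae @lebesgue_measure R, forall t : R, a < t < b -> upper_deriv_le phi t (g t)} ->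
  phi b - phi a <= IR g a b.
Proof.
move=> ab phi_ac bg phi_ae; rewrite -primitiveB//.
suff : phi b - primitive g b <= phi a - primitive g a by lra.
apply: (@absc_nonincreasing R a b (fun t => phi t - primitive g t)) => //.
  apply: abscB => //; have [_ [M gM]] := bg; apply: (@lip_absc _ _ _ M) => s t _ st _.
  by rewrite (le_trans (primitive_lip t s bg gM))// ger0_norm ?subr_ge0.
have := ae_has_deriv_IR (bm_locally_integrable bg) (fun a b => @primitiveB _ g a b bg).
move=> /(ae_and phi_ae); apply: ae_mono => t [h1 h2] /h1 h3 e e0.
have := upper_deriv_leB h3 h2 e0; apply: filterS => s.
by rewrite subrr add0r.
Qed.

Lemma absc_eq_IR (R : realType) (a b : R) (phi g : R -> R) : a <= b ->
  absc a b phi -> bm g ->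
  {ae @lebesgue_measure R, forall t : R, a < t < b -> has_deriv phi t (g t)} ->
  phi b - phi a = IR g a b.
Proof.
move=> ab phi_ac bg phi_ae; apply/eqP; rewrite eq_le; apply/andP; split.
  apply: absc_le_IR => //; apply: ae_mono phi_ae => t h /h.
  exact: has_deriv_upper.
have : - phi b - - phi a <= IR (fun t => -1 * g t) a b.
  apply: (@absc_le_IR _ _ _ (fun t => - phi t)) => //; first exact: abscN.
    by apply: bmM => //; exact: bm_cst.
  apply: ae_mono phi_ae => t h /h {}h; rewrite mulN1r.
  apply: (has_deriv_upper (lexx _)) => e /h; apply: filterS => s.
  by rewrite scalerN -!opprD normrN.
by rewrite IRZ//; lra.
Qed.

Lemma absc_lip (R : realType) (a b M : R) (phi : R -> R) : a <= b ->
  absc a b phi ->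
  {ae @lebesgue_measure R, forall t : R, a < t < b ->
    exists2 v, `|v| <= M & has_deriv phi t v} ->
  `|phi b - phi a| <= M * (b - a).
Proof.
move=> ab phi_ac phi_ae; rewrite ler_norml; apply/andP; split.
  have : - phi b - - phi a <= IR (fun=> M) a b.
    apply: (@absc_le_IR _ _ _ (fun t => - phi t)) => //; first exact: abscN.
      exact: bm_cst.
    apply: ae_mono phi_ae => t h /h[v vM {}h].
    apply: (@has_deriv_upper _ _ _ (- v)); first by move: vM; rewrite ler_norml; lra.
    move=> e /h; apply: filterS => s.
    by rewrite scalerN -!opprD normrN.
  by rewrite IR_cst//; lra.
rewrite -(IR_cst M ab); apply: absc_le_IR => //; first exact: bm_cst.
apply: ae_mono phi_ae => t h /h[v vM].
by apply: has_deriv_upper; move: vM; rewrite ler_norml; lra.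
Qed.

Lemma lip_of_local (R : realType) (a b C : R) (phi : R -> R) : a <= b ->
  (forall p, a <= p <= b -> \forall s \near p, a <= s <= b ->
    `|phi s - phi p| <= C * `|s - p|) ->
  `|phi b - phi a| <= C * (b - a).
Proof.
move=> ab loc.
apply: (@cousin R a b (fun r s => `|phi s - phi r| <= C * (s - r))) => //.
  move=> r s t _ _ _ _ h1 h2.
  rewrite (_ : phi t - phi r = (phi s - phi r) + (phi t - phi s)); last by ring.
  by rewrite (le_trans (ler_normD _ _))//; lra.
move=> p ap pb.
have /nbhs_ballP[d /= d0 Bd] := loc p (introT andP (conj ap pb)).
exists d => // r s ar rp ps sb srd.
have Br : ball p d r by rewrite /ball/= ger0_norm ?subr_ge0//; lra.
have Bs : ball p d s by rewrite /ball/= distrC ger0_norm ?subr_ge0//; lra.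
have hr : `|phi r - phi p| <= C * `|r - p| by apply: Bd => //; lra.
have hs : `|phi s - phi p| <= C * `|s - p| by apply: Bd => //; lra.
have rp0 : 0 <= p - r by rewrite subr_ge0.
have ps0 : 0 <= s - p by rewrite subr_ge0.
rewrite distrC (distrC r) (ger0_norm rp0) in hr.
rewrite (ger0_norm ps0) in hs.
rewrite (_ : phi s - phi r = (phi s - phi p) + (phi p - phi r)); last by ring.
by rewrite (le_trans (ler_normD _ _))//; lra.
Qed.

(** * Euclidean norm and max norm *)

Lemma coord_le_enorm (R : realType) (n : nat) (v : 'rV[R]_n) (j : 'I_n) :
  `|v 0 j| <= enorm v.
Proof.
rewrite -sqrtr_sqr ler_sqrt; last by apply: sumr_ge0 => k _; rewrite -expr2 sqr_ge0.
rewrite /dotv (bigD1 j)//= -expr2 lerDl.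
by apply: sumr_ge0 => k _; rewrite -expr2 sqr_ge0.
Qed.

Lemma mxnorm_le (R : realType) (n : nat) (v : 'rV[R]_n) (e : R) : 0 <= e ->
  (forall j, `|v 0 j| <= e) -> `|v| <= e.
Proof.
move=> e0 ve; rewrite /Num.Def.normr/= mx_normrE.
by apply: bigmax_le => // -[i j] _ /=; rewrite ord1.
Qed.

Lemma coord_le_mxnorm (R : realType) (n : nat) (v : 'rV[R]_n) (j : 'I_n) :
  `|v 0 j| <= `|v|.
Proof.
rewrite [leRHS]/Num.Def.normr/= mx_normrE.
exact: (le_bigmax _ (fun i : 'I_1 * 'I_n => `|v i.1 i.2|) (0, j)).
Qed.

Lemma enorm_ge0 (R : realType) (n : nat) (v : 'rV[R]_n) : 0 <= enorm v.
Proof. exact: sqrtr_ge0. Qed.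

Lemma mxnorm_le_enorm (R : realType) (n : nat) (v : 'rV[R]_n) : `|v| <= enorm v.
Proof. by apply: mxnorm_le; [exact: enorm_ge0|move=> j; exact: coord_le_enorm]. Qed.

Lemma dotv_le (R : realType) (n : nat) (v w : 'rV[R]_n) :
  `|dotv v w| <= n%:R * (`|v| * `|w|).
Proof.
rewrite /dotv (le_trans (ler_norm_sum _ _ _))//.
apply: (@le_trans _ _ (\sum_(j < n) (`|v| * `|w|))).
  by apply: ler_sum => j _; rewrite normrM ler_pM// coord_le_mxnorm.
by rewrite sumr_const card_ord mulr_natl.
Qed.

Lemma enorm_le_mxnorm (R : realType) (n : nat) (v : 'rV[R]_n) :
  enorm v <= n%:R * `|v|.
Proof.
rewrite -(ger0_norm (_ : 0 <= n%:R * `|v|)) ?mulr_ge0// -sqrtr_sqr.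
rewrite ler_sqrt ?sqr_ge0// (le_trans (ler_norm _))// (le_trans (dotv_le _ _))//.
rewrite exprMn -!expr2 ler_wpM2r ?sqr_ge0// -natrX ler_nat.
by rewrite -mulnn; case: (n) => // k; exact: leq_pmulr.
Qed.

Lemma enorm_continuous (R : realType) (n : nat) : continuous (@enorm R n).
Proof.
move=> v; apply: continuous_comp; last exact: sqrt_continuous.
suff h : continuous (fun w : 'rV[R]_n => \sum_(j < n) w 0 j * w 0 j) by exact: h.
apply: continuous_big => [|j _ w]; first exact: add_continuous.
have cj : {for w, continuous (fun v : 'rV[R]_n => v 0 j)} by exact: (@coord_continuous R 1 n 0 j w).
exact: (continuousM cj cj).
Qed.

Lemma ac_absc (R : realType) (n : nat) (a b : R) (x : R -> 'rV[R]_n) (j : 'I_n) :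
  absolutely_continuous_on a b x -> absc a b (fun t => x t 0 j).
Proof.
move=> xac e e0; have [d d0 xd] := xac e e0; exists d => // s sab spw sd.
have := @xd (size s) (fun i => (tnth (in_tuple s) i).1) (fun i => (tnth (in_tuple s) i).2).
rewrite -(big_tnth _ _ s xpredT (fun i => i.2 - i.1)).
rewrite -(big_tnth _ _ s xpredT (fun i => enorm (x i.2 - x i.1))) => h.
apply: le_lt_trans (h _ _ sd).
- by apply: ler_sum => i _; have := coord_le_enorm (x i.2 - x i.1) j; rewrite !mxE.
- by move=> i; have /and3P[] := allP sab _ (mem_tnth i (in_tuple s)).
- move=> i k ik.
  have P (i1 i2 : 'I_(size s)) : (i1 < i2)%N ->
      (tnth (in_tuple s) i1).2 <= (tnth (in_tuple s) i2).1.
    move=> i12; rewrite !(tnth_nth (0, 0)) /=.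
    by have /(pairwiseP (0, 0)) := spw; apply; rewrite ?inE.
  move: ik; rewrite neq_ltn => /orP[/P|/P]; by [left|right].
Qed.

(** * Borel versions *)

Lemma completed_measurable_borel (R : realType) (A : set R) :
  measurable (A : set (lebR R)) ->
  exists B N : set R, [/\ measurable B, nullset N & A = B `|` N].
Proof.
move=> mA.
have : (completed_algebra_gen (@lebesgue_measure R)) A.
  by rewrite -g_sigma_completed_algebra_genE completed_caratheodory_measurable.
by move=> [B mB [N nN <-]]; exists B, N.
Qed.

Lemma borel_completed_measurable (R : realType) (A : set R) :
  measurable A -> measurable (A : set (lebR R)).
Proof. by move=> mA; apply: sub_caratheodory. Qed.

(** The upper limit in the extended reals is Borel without any convergence assumption, and it is the
    limit wherever there is one. *)
Lemma lim_version (R : realType) (B : nat -> R -> R) :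
  (forall m, measurable_fun [set: R] (B m)) ->
  exists2 b : R -> R, measurable_fun [set: R] b &
    forall t l, B m t @[m --> \oo] --> l -> b t = l.
Proof.
move=> mB; exists (fun t => fine (limn_esup (fun m => (B m t)%:E))).
  apply: (measurableT_comp (@fine_measurable R _ measurableT)).
  by apply: measurable_fun_limn_esup => m; apply/measurable_EFinP; exact: mB.
move=> t l Bl.
have Bl' : (B m t)%:E @[m --> \oo] --> l%:E.
  by apply: cvg_EFin => //; exact: nearW.
by rewrite is_cvg_limn_esupE; [rewrite (cvg_lim _ Bl')|apply/cvg_ex; exists l%:E].
Qed.

(** Each superlevel set {g > q}, q rational, is the union of a Borel set and a null set. The version
    is the supremum of the q whose Borel part contains t; it gives g t off the countably many null
    parts. *)
Lemma borel_version (R : realType) (D : set R) (g : R -> R) : measurable D ->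
  measurable_fun (D : set (lebR R)) (g : lebR R -> R) ->
  exists2 b : R -> R, measurable_fun [set: R] b &
    {ae @lebesgue_measure R, forall t : R, D t -> g t = b t}.
Proof.
move=> mD mg.
have /choice[BN BNP] : forall q : rat, exists BN : set R * set R,
    [/\ measurable BN.1, nullset BN.2 & D `&` g @^-1` `]ratr q, +oo[ = BN.1 `|` BN.2].
  move=> q; have [|B [N [mB nN E]]] := @completed_measurable_borel R (D `&` g @^-1` `]ratr q, +oo[).
    by apply: mg => //; exact: borel_completed_measurable.
  by exists (B, N).
pose u (k : nat) (t : R) : \bar R :=
  if unpickle k is Some q then (if t \in (BN q).1 then (ratr q)%:E else -oo%E) else -oo%E.
exists (fun t => fine (esups (fun k => u k t) 0%N)).
  apply: (measurableT_comp (@fine_measurable R _ measurableT)).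
  apply: measurable_fun_esups => k; rewrite /u; case: (unpickle k) => [q|].
    apply: measurable_fun_ifT => //; apply: (measurable_fun_bool true).
    have [mB _ _] := BNP q; rewrite setTI (_ : _ @^-1` _ = (BN q).1)//.
    by apply/seteqP; split => t /=; [move/set_mem|move/mem_set].
  exact: measurable_cst.
have : forall q : rat, {ae @lebesgue_measure R, forall t : R, ~ (BN q).2 t}.
  by move=> q; have [_ + _] := BNP q; apply: negligibleS => t /contrapT.
move=> /ae_all; apply: ae_mono => t tN Dt.
suff -> : esups (fun k => u k t) 0%N = (g t)%:E by [].
rewrite /esups/=; apply/eqP; rewrite eq_le; apply/andP; split.
  apply: ge_ereal_sup => _ [k _ <-]; rewrite /u; case: (unpickle k) => [q|]; last exact: leNye.
  case: ifPn => [|_]; last exact: leNye.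
  rewrite inE => tB; rewrite lee_fin.
  have [_ _ E] := BNP q.
  have [_ /=] : (D `&` g @^-1` `]ratr q, +oo[) t by rewrite E; left.
  by rewrite in_itv/= andbT => /ltW.
apply/lee_subgt0Pr => e e0.
have : g t - e < g t by rewrite ltrBlDr ltrDl.
move=> /rat_in_itvoo[q]; rewrite in_itv/= => /andP[q1 q2].
apply: (@le_trans _ _ (ratr q)%:E); first by rewrite -EFinB lee_fin ltW.
apply: ereal_sup_ubound; exists (pickle q) => //; rewrite /u pickleK.
have [_ _ E] := BNP q.
have : (BN q).1 t.
  have : (D `&` g @^-1` `]ratr q, +oo[) t by split => //=; rewrite in_itv/= q2.
  by rewrite E => -[//|/(tN q)].
by move=> tB; rewrite mem_set.
Qed.

(** Only [G z] matters where z <= c * t < z + 1, and there are countably many such Borel sets. *)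
Lemma measurable_grid (R : realType) (c : R) (G : int -> R -> R) :
  (forall z, measurable_fun [set: R] (G z)) ->
  measurable_fun [set: R] (fun t => G (Num.floor (c * t)) t).
Proof.
move=> mG _ Y mY; rewrite setTI.
pose F (k : nat) : set R := if unpickle k is Some z then
  (fun t : R => c * t) @^-1` `[z%:~R, (z + 1)%:~R[ `&` G z @^-1` Y else set0.
rewrite (_ : _ @^-1` Y = \bigcup_k F k).
  apply: bigcupT_measurable => k; rewrite /F; case: (unpickle k) => [z|//].
  apply: measurableI; last by rewrite -[_ @^-1` _]setTI; exact: mG.
  have mc : measurable_fun [set: R] (fun t : R => c * t).
    by apply: measurable_funM; [exact: measurable_cst|exact: measurable_id].
  by rewrite -[_ @^-1` _]setTI; exact: mc.
apply/seteqP; split => t /=.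
  move=> Yt; exists (pickle (Num.floor (c * t))); first exact: Logic.I.
  by rewrite /F pickleK; split; [rewrite /= in_itv/= floor_itv|exact: Yt].
move=> [k _]; rewrite /F; case: (unpickle k) => [z [/=]|//].
by rewrite in_itv/= => /floor_def ->.
Qed.

Definition grid (R : realType) (m : nat) (t : R) : R :=
  (Num.floor (m.+1%:R * t))%:~R / m.+1%:R.

Lemma grid_cvg (R : realType) (t : R) : grid m t @[m --> \oo] --> t.
Proof.
apply/cvgrPdist_le => e e0; near=> m.
have m0 : (0 : R) < m.+1%:R by [].
have /andP[h1 h2] := floor_itv (m.+1%:R * t).
have -> : t - grid m t = (m.+1%:R * t - (Num.floor (m.+1%:R * t))%:~R) / m.+1%:R.
  by rewrite /grid mulrBl mulrAC divff ?mul1r// gt_eqF.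
rewrite ger0_norm; last by rewrite divr_ge0// subr_ge0.
apply: (@le_trans _ _ (m.+1%:R^-1)).
  rewrite -[leRHS]mul1r ler_wpM2r ?invr_ge0//.
  by move: h2; rewrite intrD; lra.
by apply: ltW; near: m; exact: near_infty_natSinv_lt (PosNum e0).
Unshelve. all: by end_near. Qed.

(** Right-continuity of a signal speaks only of times to the right of t, hence the next grid point
    instead of [grid m t]. *)
Lemma right_grid (R : realType) (m : nat) (t : R) :
  t < grid m t + m.+1%:R^-1 <= t + m.+1%:R^-1.
Proof.
have m0 : (0 : R) < m.+1%:R by [].
have /andP[h1 h2] := floor_itv (m.+1%:R * t).
rewrite lerD2r /grid; apply/andP; split.
  rewrite -[X in _ + X]mul1r -mulrDl ltr_pdivlMr// mulrC.
  by move: h2; rewrite intrD.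
by rewrite ler_pdivrMr// [leRHS]mulrC.
Qed.

(** Superposition of a Caratheodory function with a curve. Sampling x at grid points involves only
    countably many points xi, hence countably many null sets; continuity in xi then passes to the
    limit along [grid m t]. *)
Lemma comp_version (R : realType) (n : nat) (X : set 'rV[R]_n) (D : set R)
    (g : R -> 'rV[R]_n -> R) (x : R -> 'rV[R]_n) :
  (forall xi, X xi -> exists2 b : R -> R, measurable_fun [set: R] b &
    {ae @lebesgue_measure R, forall t : R, D t -> g t xi = b t}) ->
  {ae @lebesgue_measure R, forall t : R, D t -> {within X, continuous (g t)}} ->
  (forall t, X (x t)) -> continuous x ->
  exists2 b : R -> R, measurable_fun [set: R] b &
    {ae @lebesgue_measure R, forall t : R, D t -> g t (x t) = b t}.
Proof.
move=> gb gc xX xc.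
have /choice[b bP] : forall r : R, exists b : R -> R, measurable_fun [set: R] b /\
    {ae @lebesgue_measure R, forall t : R, D t -> g t (x r) = b t}.
  by move=> r; have [b mb bP] := gb _ (xX r); exists b.
pose B (m : nat) (t : R) := b (grid m t) t.
have mB m : measurable_fun [set: R] (B m).
  exact: (@measurable_grid R m.+1%:R (fun z => b (z%:~R / m.+1%:R)) (fun z => (bP _).1)).
have [c mc cP] := lim_version mB.
exists c => //.
have : forall mz : nat * int, {ae @lebesgue_measure R, forall t : R, D t ->
    g t (x (mz.2%:~R / mz.1.+1%:R)) = b (mz.2%:~R / mz.1.+1%:R) t}.
  by move=> mz; exact: (bP _).2.
move=> /ae_all /(ae_and gc); apply: ae_mono => t [gct Bt] Dt; apply/esym/cP.
have E m : B m t = g t (x (grid m t)).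
  by rewrite /B /grid -(Bt (m, Num.floor (m.+1%:R * t))).
rewrite (_ : (fun m => B m t) = (fun m => g t (x (grid m t)))); last exact/funext.
have xg : x (grid m t) @[m --> \oo] --> x t.
  by apply: (@continuous_cvg _ _ _ _ _ (fun m => grid m t) x); [exact: xc | exact: grid_cvg].
have /subspace_continuousP/(_ _ (xX t)) H := gct Dt.
move=> Y /H h.
have h' : \forall m \near \oo, X (x (grid m t)) -> Y (g t (x (grid m t))) := xg _ h.
suff : \forall m \near \oo, Y (g t (x (grid m t))) by [].
by apply: filterS h' => m; apply; exact: xX.
Qed.

Lemma bm_signal (R : realType) (N : nat) (sigma : R -> 'I_N) (i : 'I_N) :
  (forall t, \forall s \near t^'+, sigma s = sigma t) ->
  bm (fun t => (sigma t == i)%:R : R).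
Proof.
move=> sr; split; last first.
  by exists 1 => t; case: (_ == _); rewrite ?normr1 ?normr0.
apply: (@measurable_fun_cvg _ _ _ _
  (fun m (t : R) => (sigma (grid m t + m.+1%:R^-1) == i)%:R)).
  move=> m; exact: (@measurable_grid R m.+1%:R
    (fun z _ => (sigma (z%:~R / m.+1%:R + m.+1%:R^-1) == i)%:R)
    (fun z => measurable_cst _)).
move=> t _; apply: cvg_near_cst.
have /nbhs_ballP[d /= d0 Bd] := sr t.
near=> m.
have /andP[h1 h2] := right_grid m t.
rewrite Bd//= /ball/= ltr_distlC; apply/andP; split.
  by apply: lt_trans h1; rewrite ltrBlDr ltrDl.
apply: le_lt_trans h2 _; rewrite ltrD2l.
by near: m; exact: near_infty_natSinv_lt (PosNum d0).
Unshelve. all: by end_near. Qed.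

(** * Densities of nondecreasing 1-Lipschitz functions *)

Lemma stieltjes_ocitv (R : realType) (f : cumulative R R) (a b : R) : a <= b ->
  lebesgue_stieltjes_measure f `]a, b]%classic = (f b - f a)%:E.
Proof.
move=> ab; rewrite /lebesgue_stieltjes_measure /measure_extension.
rewrite measurable_mu_extE/=; last exact: is_ocitv.
by rewrite wlength_itv_bnd.
Qed.

(** Writing t = P t + (t - P t) splits Lebesgue measure into two Stieltjes measures, so the one of P
    is dominated by it. P is then the integral of a Radon-Nikodym density and is differentiable at
    its Lebesgue points. The limits 0 and 1 at infinity make the measure finite. *)
Lemma lip_cumulative_ae_deriv (R : realType) (P : cumulativeBounded (0 : R) (1 : R)) :
  (forall s t, s <= t -> P t - P s <= t - s) ->
  {ae @lebesgue_measure R, forall t : R, exists v, has_deriv P t v}.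
Proof.
move=> P_lip.
have nd : {homo (fun t : R => t - P t) : s t / s <= t}.
  by move=> s t st; have := P_lip s t st; lra.
have rc : forall t : R, t - P t @[t --> t^'+] --> t - P t.
  move=> t; apply: cvgB; first exact: cvg_at_right_filter.
  exact: cumulative_is_right_continuous.
pose H : cumulative R R := HB.pack (fun t : R => t - P t)
  (isCumulative.Build R _ R (fun t : R => t - P t) nd rc).
pose nu : {finite_measure set (measurableTypeR R) -> \bar R} :=
  lebesgue_stieltjes_measure P.
have le_nu (A : set (measurableTypeR R)) : measurable A -> (nu A <= lebesgue_measure A)%E.
  move=> mA; rewrite (@lebesgue_measure_unique R
    (measure_add (lebesgue_stieltjes_measure P) (lebesgue_stieltjes_measure H)))//.
    by rewrite [leRHS]measure_addE leeDl.
  move=> X /ocitvP[->|[[a b] /= ab ->]]; first by rewrite !measure0.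
  transitivity ((P b - P a)%:E + (H b - H a)%:E)%E.
    rewrite -EFinD; transitivity (b - a)%:E; first exact: (stieltjes_ocitv _ (ltW ab)).
    by congr _%:E; rewrite /H/=; lra.
  rewrite [RHS]measure_addE.
  by congr (_ + _)%E; apply/esym; exact: (stieltjes_ocitv _ (ltW ab)).
have nu_dom : nu `<< (@lebesgue_measure R).
  apply/null_content_dominatesP => A mA A0; apply/eqP.
  by rewrite eq_le measure_ge0 andbT -A0 le_nu.
have [g [g0 gfin gint gE]] := radon_nikodym_sigma_finite nu_dom.
have gEF : EFin \o (fine \o g) = g by apply/funext => t /=; rewrite fineK.
have lg : locally_integrable setT (fine \o g).
  by apply: open_integrable_locally; [exact: openT|rewrite gEF].
apply: (@ae_mono _ (fun t => has_deriv P t (fine (g t)))); first by move=> t; exists (fine (g t)).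
apply: (ae_has_deriv_IR lg) => a b ab.
apply: EFin_inj; rewrite -stieltjes_ocitv// [LHS]gE; last exact: measurable_itv.
rewrite /IR -Rintegral_itv_obnd_cbnd; last first.
  by apply: integrableS (locally_integrable_itv a b lg) => //; exact: subset_itv_oc_cc.
rewrite /Rintegral fineK; last first.
  apply: integrable_fin_num => //.
  by apply: integrableS (locally_integrable_itv a b lg) => //; exact: subset_itv_oc_cc.
by apply: eq_integral => t _ /=; rewrite fineK.
Qed.

(** Applied to the time, it freezes a curve outside [a, b] and makes it a total continuous function;
    applied to values, it turns an almost everywhere bound into one valid everywhere. *)
Definition clamp (R : realType) (a b t : R) : R := Num.max a (Num.min b t).

Lemma clampE (R : realType) (a b t : R) : a <= t <= b -> clamp a b t = t.
Proof. by move=> /andP[at_ tb]; rewrite /clamp (min_r tb) (max_r at_). Qed.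

Lemma clamp_itv (R : realType) (a b t : R) : a <= b -> a <= clamp a b t <= b.
Proof. by move=> ab; rewrite /clamp le_max lexx/= ge_max ab ge_min lexx. Qed.

Lemma clamp_mono (R : realType) (a b s t : R) : s <= t -> clamp a b s <= clamp a b t.
Proof.
move=> st; rewrite /clamp; case: (leP b s) => bs; case: (leP b t) => bt;
  rewrite ?ge_max ?le_max ?lexx ?orbT//=; lra.
Qed.

Lemma clamp_lip (R : realType) (a b s t : R) : a <= b -> s <= t ->
  clamp a b t - clamp a b s <= t - s.
Proof.
move=> ab st; rewrite /clamp; case: (leP b s) => bs; case: (leP b t) => bt.
- lra.
- lra.
- by case: (leP a b) => h1; case: (leP a s) => h2; lra.
- by case: (leP a t) => h1; case: (leP a s) => h2; lra.
Qed.

Lemma lip_continuous (R : realType) (W : normedModType R) (F : R -> W) (L : R) :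
  (forall s t, `|F s - F t| <= L * `|s - t|) -> continuous F.
Proof.
move=> FL t; apply/cvgrPdist_le => e e0.
have L1 : 0 < `|L| + 1 by rewrite ltr_wpDl.
have d0 : 0 < e / (`|L| + 1) by rewrite divr_gt0.
near=> s.
apply: le_trans (FL _ _) _.
have st : `|t - s| <= e / (`|L| + 1) by near: s; exact: cvgr_dist_le.
rewrite ler_pdivlMr// in st; apply: le_trans st; rewrite mulrC ler_wpM2l//.
by rewrite (le_trans (ler_norm _))// lerDl.
Unshelve. all: by end_near. Qed.

Lemma ndlip_norm (R : realType) (F : R -> R) :
  (forall s t, s <= t -> 0 <= F t - F s <= t - s) ->
  forall s t, `|F s - F t| <= 1 * `|s - t|.
Proof.
move=> F_lip t s; rewrite mul1r; wlog st : s t / s <= t.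
  have [st|/ltW ts] := leP s t; first exact.
  by move=> /(_ _ _ ts); rewrite distrC (distrC t).
by have /andP[h1 h2] := F_lip _ _ st; rewrite !ger0_norm// subr_ge0.
Qed.

Lemma ndlip_ae_deriv_bounded (R : realType) (F : R -> R) (M : R) : 1 <= M ->
  (forall s t, s <= t -> 0 <= F t - F s <= t - s) ->
  {ae @lebesgue_measure R, forall t : R, - M < t < M -> exists v, has_deriv F t v}.
Proof.
move=> M1 F_lip.
have MM : - M <= M by lra.
(* F stopped at -M and M, shifted and rescaled to the distribution function of
   a probability measure *)
pose D : R := F M - F (- M) + 2 * M.
(* P is built from F plus the identity, so D is positive even if F is constant. The numerator of P
   is 2-Lipschitz, and D >= 2 makes P 1-Lipschitz. *)
have D2 : 2 <= D by have /andP[h _] := F_lip _ _ MM; rewrite /D; lra.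
have D0 : 0 < D by lra.
pose P (t : R) : R := (F (clamp (- M) M t) - F (- M) + clamp (- M) M t + M) / D.
have P_nd : {homo P : s t / s <= t}.
  move=> s t st; rewrite /P ler_pM2r ?invr_gt0//.
  by have := clamp_mono (- M) M st => h; have /andP[h1 h2] := F_lip _ _ h; lra.
have P_lip (s t : R) : s <= t -> P t - P s <= t - s.
  move=> st; rewrite /P -mulrBl ler_pdivrMr//.
  have h := clamp_mono (- M) M st; have /andP[_ h2] := F_lip _ _ h.
  have h3 := clamp_lip MM st.
  apply: (@le_trans _ _ ((t - s) * 2)); first by lra.
  by rewrite ler_wpM2l// subr_ge0.
have P_cont : continuous P.
  apply: (@lip_continuous _ _ _ 1); apply: ndlip_norm => s t st.
  by rewrite P_lip// subr_ge0 P_nd.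
have P_rc : forall t : R, P t @[t --> t^'+] --> P t.
  by move=> t; apply: cvg_at_right_filter; exact: P_cont.
have P_0 : P t @[t --> -oo] --> (0 : R).
  apply: cvg_near_cst; exists (- M); split; first exact: num_real.
  move=> t tM; rewrite /P /clamp min_r ?max_l ?(ltW tM)//; last by lra.
  by rewrite subrr add0r addNr mul0r.
have P_1 : P t @[t --> +oo] --> (1 : R).
  apply: cvg_near_cst; exists M; split; first exact: num_real.
  move=> t tM; rewrite /P /clamp min_l ?max_r ?(ltW tM)//.
  by rewrite -addrA -/D (_ : M + M = 2 * M) ?divff ?gt_eqF//; ring.
pose P' : cumulativeBounded (0 : R) (1 : R) := HB.pack P
  (isCumulative.Build R _ R P P_nd P_rc)
  (isCumulativeBounded.Build R 0 1 P P_0 P_1).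
have := @lip_cumulative_ae_deriv R P' P_lip.
apply: ae_mono => t [v Pv] tM; exists (D * v - 1) => e e0.
have eD : 0 < e / D by rewrite divr_gt0.
have Ht := Pv _ eD.
have tM' : \forall s \near t, s \in `](- M), M[.
  by apply: near_in_itvoo; rewrite in_itv.
apply: filterS2 tM' Ht => s; rewrite in_itv/= => /andP[s1 s2].
have cs : clamp (- M) M s = s by rewrite clampE// !ltW.
have ct : clamp (- M) M t = t by move/andP : tM => [t1 t2]; rewrite clampE// !ltW.
have -> : F s - F t - (s - t) *: (D * v - 1) = D * (P' s - P' t - (s - t) *: v).
  rewrite -[P' s]/(P s) -[P' t]/(P t) /P cs ct -![_ *: _]/(_ * _).
  by field; rewrite gt_eqF.
by move=> h; rewrite normrM (gtr0_norm D0) mulrC -ler_pdivlMr// mulrAC.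
Qed.

(** The density is the limit of the difference quotients with step 1 / (m + 1), in its Borel
    version, clamped so that its bounds hold at every t. *)
Lemma ndlip_density (R : realType) (F : R -> R) :
  (forall s t, s <= t -> 0 <= F t - F s <= t - s) ->
  exists u : R -> R, [/\ bm u, forall t, 0 <= u t <= 1 &
    forall a b, a <= b -> F b - F a = IR u a b].
Proof.
move=> F_lip.
have F_cont : continuous F by apply: (@lip_continuous _ _ _ 1); exact: ndlip_norm.
pose B (m : nat) (t : R) : R := m.+1%:R * (F (t + m.+1%:R^-1) - F t).
have mF := continuous_measurable_fun F_cont.
have mB m : measurable_fun [set: R] (B m).
  apply: measurable_funM; first exact: measurable_cst.
  apply: measurable_funB => //; apply: (measurableT_comp mF).
  by apply: measurable_funD; [exact: measurable_id|exact: measurable_cst].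
have [c mc cP] := lim_version mB.
have bu : bm (fun t => clamp 0 1 (c t)).
  split; first by apply: measurable_maxr; [exact: measurable_cst|];
    apply: measurable_minr => //; exact: measurable_cst.
  by exists 1 => t; have /andP[h1 h2] := @clamp_itv R 0 1 (c t) ler01; rewrite ger0_norm.
exists (fun t => clamp 0 1 (c t)); split => //; first by move=> t; exact: clamp_itv.
move=> a b ab; apply: absc_eq_IR => //.
  apply: (@lip_absc _ _ _ 1) => s t _ st _.
  by have /andP[h1 h2] := F_lip _ _ st; rewrite mul1r ger0_norm.
have : forall m : nat, {ae @lebesgue_measure R, forall t : R,
    - m.+1%:R < t < m.+1%:R -> exists v, has_deriv F t v}.
  by move=> m; apply: ndlip_ae_deriv_bounded => //; rewrite ler1n.
move=> /ae_all; apply: ae_mono => t h _.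
have [|v Fv] := h (Num.bound `|t|).
  have := archi_boundP (normr_ge0 t); have := ler_norm t; have := lerNnormlW (lexx `|t|).
  by rewrite -natr1; lra.
have B01 m : 0 <= B m t <= 1.
  have m0 : (0 : R) < m.+1%:R by [].
  have /andP[h1 h2] : 0 <= F (t + m.+1%:R^-1) - F t <= (t + m.+1%:R^-1) - t.
    by apply: F_lip; rewrite lerDl invr_ge0.
  rewrite /B mulr_ge0//= mulrC -ler_pdivlMr// mul1r; apply: le_trans h2 _.
  by rewrite addrAC subrr add0r.
have Bv : B m t @[m --> \oo] --> v.
  apply/cvgrPdist_le => e e0.
  have /nbhs_ballP[d /= d0 Bd] := Fv _ e0.
  near=> m.
  have m0 : (0 : R) < m.+1%:R by [].
  have mi : (0 : R) <= m.+1%:R^-1 by rewrite invr_ge0.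
  have : ball t d (t + m.+1%:R^-1).
    rewrite /ball/= opprD addrA subrr sub0r normrN ger0_norm ?invr_ge0//.
    by near: m; exact: near_infty_natSinv_lt (PosNum d0).
  move=> /Bd; rewrite -[_ *: v]/(_ * v) (addrAC t) subrr add0r (ger0_norm mi).
  move=> hm; rewrite distrC.
  rewrite (_ : B m t - v = m.+1%:R * (F (t + m.+1%:R^-1) - F t - m.+1%:R^-1 * v)).
    by rewrite normrM (ger0_norm (ltW m0)) mulrC -ler_pdivlMr.
  by rewrite /B; field; rewrite gt_eqF.
rewrite (cP t v Bv) clampE//.
have cB : cvg (B m t @[m --> \oo]) by apply/cvg_ex; exists v.
rewrite -(cvg_lim (@Rhausdorff R) Bv); apply/andP; split.
  by apply: limr_ge => //; apply: nearW => m; case/andP : (B01 m).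
by apply: limr_le => //; apply: nearW => m; case/andP : (B01 m).
Unshelve. all: by end_near. Qed.

(** * Weak convergence *)

Lemma cvg0P (R : realType) (u : nat -> R) :
  u k @[k --> \oo] --> (0 : R) <-> forall e, 0 < e -> \forall k \near \oo, `|u k| <= e.
Proof.
split=> [/cvgrPdist_le h e /h|h].
  by apply: filterS => k; rewrite sub0r normrN.
by apply/cvgrPdist_le => e /h; apply: filterS => k; rewrite sub0r normrN.
Qed.

(** On a short interval around p, replacing g by g p costs at most e1 per unit length, and the part
    with the constant g p tends to 0 by hypothesis. Cousin's lemma adds up the pieces. *)
Lemma IR_cvg0_continuous (R : realType) (d : nat -> R -> R) (g : R -> R) (M a b : R) :
  a <= b -> (forall k, bm (d k)) -> (forall k t, `|d k t| <= M) ->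
  (forall r s, r <= s -> IR (d k) r s @[k --> \oo] --> (0 : R)) ->
  bm g -> continuous g ->
  IR (fun t => g t * d k t) a b @[k --> \oo] --> (0 : R).
Proof.
move=> ab bd dM d0 bg gc; apply/cvg0P => e e0.
pose e1 : R := e / (2 * (b - a + 1)).
have ba0 : 0 < b - a + 1 by rewrite ltr_wpDl// subr_ge0.
have e10 : 0 < e1 by rewrite divr_gt0// mulr_gt0.
have M0 : 0 <= M by rewrite (le_trans _ (dM 0%N 0)).
(* The additive error e' is arbitrary on each interval, so it can be halved whenever two intervals
   are joined. *)
pose Q (r s : R) := forall e', 0 < e' ->
  \forall k \near \oo, `|IR (fun t => g t * d k t) r s| <= e1 * (s - r) + e'.
suff : Q a b.
  have e2 : 0 < e / 2 by rewrite divr_gt0.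
  move=> /(_ _ e2); apply: filterS => k /le_trans; apply.
  suff : e1 * (b - a) <= e / 2 by lra.
  by rewrite /e1 mulrAC ler_pdivrMr ?mulr_gt0//; lra.
apply: cousin => //.
  move=> r s t _ rs st _ Qrs Qst e' e'0.
  have e2 : 0 < e' / 2 by rewrite divr_gt0.
  apply: filterS2 (Qrs _ e2) (Qst _ e2) => k h1 h2.
  rewrite (IR_split rs st (bmM bg (bd k))) (le_trans (ler_normD _ _))//.
  have -> : e1 * (t - r) + e' = (e1 * (s - r) + e' / 2) + (e1 * (t - s) + e' / 2).
    by field.
  exact: lerD.
move=> p _ _.
have e3 : 0 < e1 / (M + 1) by rewrite divr_gt0// ltr_wpDl.
have /nbhs_ballP[c /= c0 Bc] : \forall s \near p, `|g p - g s| <= e1 / (M + 1).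
  by have /cvgrPdist_le/(_ _ e3) := gc p.
exists c => // r s _ rp ps _ sr e' e'0.
have rs := le_trans rp ps.
have g1 : 0 < `|g p| + 1 by rewrite ltr_wpDl.
have e4 : 0 < e' / (`|g p| + 1) by rewrite divr_gt0.
have := (cvg0P _).1 (d0 r s rs) _ e4.
apply: filterS => k hk.
have bgp : bm (fun t => (g t - g p) * d k t).
  by apply: bmM => //; apply: bmB => //; exact: bm_cst.
have bgd : bm (fun t => g p * d k t) by apply: bmM => //; exact: bm_cst.
rewrite (_ : (fun t => g t * d k t) = (fun t => (g t - g p) * d k t + g p * d k t)); last first.
  by apply/funext => t; rewrite -mulrDl subrK.
rewrite IRD// (le_trans (ler_normD _ _))// lerD//.
  apply: IR_bound => // t /andP[rt ts].
  rewrite normrM distrC.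
  have h1 : `|g p - g t| <= e1 / (M + 1).
    by apply: Bc; rewrite /ball/= ltr_distl; apply/andP; split; lra.
  apply: (@le_trans _ _ (e1 / (M + 1) * M)); first by rewrite ler_pM.
  rewrite mulrAC ler_pdivrMr; last by rewrite ltr_wpDl.
  by rewrite ler_pM2l// lerDl.
rewrite IRZ// normrM; rewrite ler_pdivlMr// mulrC in hk.
apply: le_trans hk; rewrite ler_wpM2r// lerDl//.
Qed.

Lemma clamp_dist (R : realType) (a b s t : R) : a <= b ->
  `|clamp a b s - clamp a b t| <= `|s - t|.
Proof.
move=> ab; wlog st : s t / s <= t.
  have [st|/ltW ts] := leP s t; first exact.
  by move=> /(_ _ _ ts); rewrite distrC (distrC t).
by rewrite distrC (distrC s) !ger0_norm ?subr_ge0 ?clamp_mono ?clamp_lip.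
Qed.

Lemma clamp_continuous (R : realType) (a b : R) : a <= b -> continuous (clamp a b).
Proof.
by move=> ab; apply: (@lip_continuous _ _ _ 1) => s t; rewrite mul1r; exact: clamp_dist.
Qed.

Lemma continuous_clamp_bm (R : realType) (g : R -> R) (a b : R) : a <= b ->
  continuous g -> continuous (g \o clamp a b) /\ bm (g \o clamp a b).
Proof.
move=> ab gc.
have cc : continuous (g \o clamp a b).
  by move=> t; apply: continuous_comp; [exact: clamp_continuous|exact: gc].
split => //; split; first exact: continuous_measurable_fun.
have [M [_ gM]] := compact_bounded (continuous_compact
  (continuous_subspaceT gc) (@segment_compact R a b)).
exists (M + 1) => t; apply: (gM (M + 1)); first by rewrite ltrDl.
by exists (clamp a b t) => //=; rewrite in_itv/= clamp_itv.
Qed.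

Lemma Rintegrable_norm (R : realType) (f : R -> R) :
  lebesgue_measure.-integrable [set: R] (EFin \o f) ->
  lebesgue_measure.-integrable [set: R] (EFin \o (fun t => `|f t|)).
Proof. by move=> /integrable_norm; apply. Qed.

Lemma RintegrableB (R : realType) (f g : R -> R) :
  lebesgue_measure.-integrable [set: R] (EFin \o f) ->
  lebesgue_measure.-integrable [set: R] (EFin \o g) ->
  lebesgue_measure.-integrable [set: R] (EFin \o (fun t => f t - g t)).
Proof. by move=> fi gi; exact: (integrableB measurableT fi gi). Qed.

Lemma integrable_bmM (R : realType) (phi d : R -> R) :
  lebesgue_measure.-integrable [set: R] (EFin \o phi) -> bm d ->
  lebesgue_measure.-integrable [set: R] (EFin \o (fun t => phi t * d t)).
Proof.
move=> iphi [md [M dM]].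
have := @integrableMl _ _ _ (@lebesgue_measure R) setT measurableT (EFin \o phi) d iphi md.
apply.
by exists M; split; [exact: num_real|move=> r Mr x _; exact: le_trans (dM x) (ltW Mr)].
Qed.

Lemma integrable_bm_indic (R : realType) (g : R -> R) (a b : R) : bm g ->
  lebesgue_measure.-integrable [set: R]
    (EFin \o (fun t => g t * \1_(`[a, b]%classic) t)).
Proof.
move=> bg; rewrite (_ : (fun t => _) = (fun t => \1_(`[a, b]%classic) t * g t)); last first.
  by apply/funext => t; rewrite mulrC.
by apply: integrable_bmM => //; exact: integrable_indic_itv.
Qed.

Lemma Rint_normM_le (R : realType) (phi d : R -> R) (M : R) :
  lebesgue_measure.-integrable [set: R] (EFin \o phi) -> bm d -> (forall t, `|d t| <= M) ->
  `|Rintegral (@lebesgue_measure R) setT (fun t => phi t * d t)| <=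
  M * Rintegral (@lebesgue_measure R) setT (fun t => `|phi t|).
Proof.
move=> iphi bd dM.
have inorm := integrable_norm iphi.
apply: le_trans (le_normr_Rintegral measurableT (integrable_bmM iphi bd)) _.
rewrite -RintegralZl//; apply: le_Rintegral => //.
- exact: (integrable_norm (integrable_bmM iphi bd)).
- exact: (integrableZl measurableT M inorm).
- by move=> t _; rewrite normrM mulrC ler_wpM2r.
Qed.

(** Truncation to [-k, k] by dominated convergence, then approximation in L1 by a continuous
    function there. Clamping its argument makes that function continuous and bounded on the line;
    the indicator stays a separate factor so as not to spoil continuity. *)
Lemma integrable_approx (R : realType) (phi : R -> R) (e : R) : 0 < e ->
  lebesgue_measure.-integrable [set: R] (EFin \o phi) ->
  exists (g : R -> R) (m : R), [/\ 0 <= m, continuous g, bm g &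
    Rintegral (@lebesgue_measure R) setT
      (fun t => `|phi t - g t * \1_(`[- m, m]%classic) t|) <= e].
Proof.
move=> e0 iphi.
pose A (k : nat) : set R := `[- k%:R, k%:R]%classic.
have b1 k : bm (\1_(A k) : R -> R) by apply: bm_indic; exact: measurable_itv.
have i1 k := integrable_bmM iphi (b1 k).
have A1 k t : `|(\1_(A k) : R -> R) t| <= 1.
  by rewrite indicE; case: (_ \in _); rewrite ?normr1 ?normr0.
have [] := @dominated_convergence _ _ _ (@lebesgue_measure R) setT measurableT
  (fun k t => (phi t * \1_(A k) t)%:E) (EFin \o phi) (fun t => `|(phi t)%:E|%E).
- by move=> k; exact: measurable_int (i1 k).
- exact: measurable_int iphi.
- apply: aeW => t _; apply: cvg_near_cst; exists (Num.bound `|t|) => //= k tk.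
  rewrite indicE mem_set ?mulr1// /A/= in_itv/= -ler_norml.
  by apply: (le_trans (ltW (archi_boundP (normr_ge0 t)))); rewrite ler_nat.
- exact: integrable_abse.
- by apply: aeW => t k _; rewrite /= lee_fin normrM ler_piMr.
move=> _ /fine_cvgP[_ /cvg0P tail] _.
have e2 : 0 < e / 2 by rewrite divr_gt0.
have [k _ /(_ k (leqnn k)) tk] := tail _ e2.
have k0 : - k%:R <= k%:R :> R by rewrite (le_trans (_ : _ <= 0))// oppr_le0.
have iA : lebesgue_measure.-integrable (A k) (EFin \o phi).
  by apply: integrableS iphi => //; exact: measurable_itv.
have [g_ [g_c _]] := approximation_continuous_integrable (measurable_itv _)
  (itv_measure_fin _ _) iA.
move=> /fine_cvgP[_ /cvg0P close].
have [j _ /(_ j (leqnn j)) tj] := close _ e2.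
have [gc bg] := continuous_clamp_bm k0 (g_c j).
set g := g_ j \o _ in gc bg.
exists g, k%:R; split => //.
have i2 : lebesgue_measure.-integrable setT (EFin \o (fun t => `|phi t * \1_(A k) t - phi t|)).
  by apply: Rintegrable_norm; apply: RintegrableB => //; exact: i1.
have b2 : bm (fun t => g t * \1_(A k) t) by exact: bmM.
have ig : lebesgue_measure.-integrable setT (EFin \o (fun t => g t * \1_(A k) t)).
  exact: integrable_bm_indic.
have i3 : lebesgue_measure.-integrable setT
    (EFin \o (fun t => `|phi t * \1_(A k) t - g t * \1_(A k) t|)).
  by apply: Rintegrable_norm; apply: RintegrableB => //; exact: i1.
apply: (@le_trans _ _ (Rintegral (@lebesgue_measure R) setT (fun t =>
    `|phi t * \1_(A k) t - phi t| + `|phi t * \1_(A k) t - g t * \1_(A k) t|))).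
  apply: le_Rintegral => //.
  - by apply: Rintegrable_norm; exact: RintegrableB.
  - exact: (integrableD measurableT i2 i3).
  - move=> t _; rewrite [X in _ <= X + _]distrC.
    rewrite (_ : phi t - g t * \1_(A k) t = (phi t - phi t * \1_(A k) t)
      + (phi t * \1_(A k) t - g t * \1_(A k) t)); last by ring.
    exact: ler_normD.
rewrite RintegralD// [e]splitr lerD//; first exact: le_trans (ler_norm _) tk.
apply: le_trans tj; apply: le_trans (ler_norm _); rewrite le_eqVlt; apply/orP; left.
apply/eqP; transitivity (Rintegral (@lebesgue_measure R) (A k) (fun t => `|phi t - g_ j t|)) => //.
rewrite [RHS]Rintegral_mkcond; apply: eq_Rintegral => t _; rewrite patchE indicE.
case: ifPn => tA; last by rewrite !mulr0 subrr normr0.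
rewrite !mulr1 /g/= clampE//.
by move: tA; rewrite inE /A/= in_itv.
Qed.

(** Density argument: [IR_cvg0_continuous] treats truncated continuous test functions, and an L1
    error in phi is multiplied by at most M, uniformly in k. *)
Lemma weak_limit (R : realType) (d : nat -> R -> R) (M : R) :
  (forall k, bm (d k)) -> (forall k t, `|d k t| <= M) ->
  (forall a b, a <= b -> IR (d k) a b @[k --> \oo] --> (0 : R)) ->
  forall phi : R -> R, lebesgue_measure.-integrable [set: R] (EFin \o phi) ->
  Rintegral (@lebesgue_measure R) setT (fun t => phi t * d k t) @[k --> \oo] --> (0 : R).
Proof.
move=> bd dM d0 phi iphi; apply/cvg0P => e e0.
have M0 : 0 <= M by rewrite (le_trans _ (dM 0%N 0)).
have e1 : 0 < e / (2 * (M + 1)) by rewrite divr_gt0// mulr_gt0// ltr_wpDl.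
have [g [m [m0 gc bg close]]] := integrable_approx e1 iphi.
have mm : - m <= m by lra.
have e2 : 0 < e / 2 by rewrite divr_gt0.
have := (cvg0P _).1 (IR_cvg0_continuous mm bd dM d0 bg gc) _ e2.
apply: filterS => k hk.
set A : set R := `[- m, m]%classic.
have bA : bm (\1_A : R -> R) by apply: bm_indic; exact: measurable_itv.
have ig : lebesgue_measure.-integrable setT (EFin \o (fun t => g t * \1_A t)).
  exact: integrable_bm_indic.
have idf : lebesgue_measure.-integrable setT (EFin \o (fun t => phi t - g t * \1_A t)).
  exact: RintegrableB.
rewrite (_ : (fun t => phi t * d k t) =
  (fun t => (phi t - g t * \1_A t) * d k t + g t * \1_A t * d k t)); last first.
  by apply/funext => t; ring.
rewrite RintegralD//; [|exact: (integrable_bmM idf (bd k))|exact: (integrable_bmM ig (bd k))].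
rewrite (le_trans (ler_normD _ _))// [e]splitr lerD//.
  apply: le_trans (Rint_normM_le idf (bd k) (dM k)) _.
  apply: (@le_trans _ _ (M * (e / (2 * (M + 1))))); first by rewrite ler_wpM2l.
  rewrite mulrA ler_pdivrMr; last by rewrite mulr_gt0// ltr_wpDl.
  nra.
rewrite (_ : Rintegral _ _ _ = IR (fun t => g t * d k t) (- m) m)//.
rewrite /IR [RHS]Rintegral_mkcond; apply: eq_Rintegral => t _; rewrite patchE indicE.
by case: ifPn => tA; rewrite ?mulr1// mulr0 mul0r.
Qed.

(** * Subsequences *)

Lemma increasing_ge (p : nat -> nat) : increasing_seq p -> forall k, (k <= p k)%N.
Proof.
move=> ip; elim=> // k ih; apply: leq_ltn_trans ih _.
by have /increasing_seqP := ip; apply.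
Qed.

Lemma increasing_comp (p q : nat -> nat) :
  increasing_seq p -> increasing_seq q -> increasing_seq (p \o q).
Proof. by move=> ip iq a b /=; rewrite ip -leEnat iq. Qed.

(** Stated with k <= p k so that it also serves index maps known only to be large, as in
    [diag_subseq]. *)
Lemma cvg_ge_subseq (T : topologicalType) (u : nat -> T) (l : T) (p : nat -> nat) :
  (forall k, (k <= p k)%N) -> u k @[k --> \oo] --> l -> u (p k) @[k --> \oo] --> l.
Proof.
move=> kp ul Y /ul [m _ mY]; exists m => // k /= mk; apply: mY => /=.
exact: leq_trans (kp k).
Qed.

Lemma diag_subseq (R : realType) (a : nat -> nat -> R) :
  (forall j, exists M : R, forall k, `|a j k| <= M) ->
  exists2 p : nat -> nat, increasing_seq p & forall j, cvg (a j (p k) @[k --> \oo]).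
Proof.
move=> abd.
have /choice[f fP] : forall jq : nat * (nat -> nat), exists f : nat -> nat,
    increasing_seq f /\ cvg (a jq.1 (jq.2 (f k)) @[k --> \oo]).
  move=> [j q] /=; have [M aM] := abd j.
  have [|f fi fc] := @bolzano_weierstrass R (fun k => a j (q k)); last by exists f.
  by exists M; split; [exact: num_real|move=> r Mr x _; exact: le_trans (aM _) (ltW Mr)].
(* [P j] is the subsequence after j extractions. Each refines the preceding one, so the diagonal is
   eventually taken from every one of them. *)
pose P := fix P (j : nat) : nat -> nat :=
  if j is i.+1 then P i \o f (i, P i) else id.
have Pi j : increasing_seq (P j).
  by elim: j => [|j ih] //=; apply: increasing_comp => //; exact: (fP _).1.
have Pc j m : exists2 q : nat -> nat, increasing_seq q & P (j + m)%N = P j \o q.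
  elim: m => [|m [q qi E]]; first by exists id; rewrite ?addn0.
  exists (q \o f ((j + m)%N, P (j + m)%N)).
    by apply: increasing_comp => //; exact: (fP _).1.
  by rewrite addnS /= E.
exists (fun k => P k k).
  apply/increasing_seqP => k /=; rewrite ltEnat/=.
  have -> : (P k k < P k (f (k, P k) k.+1))%N = (k < f (k, P k) k.+1)%N.
    by rewrite !ltnNge; congr (~~ _); exact: (Pi k).
  exact: increasing_ge (fP _).1 _.
move=> j; have [_ /cvg_ex[l /= hl]] := fP (j, P j).
apply/cvg_ex; exists l.
(* For k > j the diagonal term is a term, of index at least k, of the convergent sequence extracted
   at stage j. *)
have /choice[q qP] : forall k, exists q, (k <= q)%N /\
    ((j < k)%N -> P k k = P j (f (j, P j) q)).
  move=> k; have [jk|kj] := ltnP j k; last by exists k; rewrite leqnn.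
  have [q qi E] := Pc j.+1 (k - j.+1)%N.
  exists (q k); split => [|_]; first exact: increasing_ge.
  by rewrite -{1}(subnKC jk) E.
have := cvg_ge_subseq (fun k => (qP k).1) hl; apply: cvg_trans; apply: near_eq_cvg.
exists j.+1 => // k /= jk; by rewrite (qP k).2.
Qed.

(** Arzela-Ascoli: diagonal extraction at rational times, extended to all times by the common
    Lipschitz constant. The index I allows all coordinates of the states and all primitives of the
    mode indicators to be extracted at once. *)
Lemma lip_subseq (R : realType) (I : countType) (G : nat -> I -> R -> R) (L B : R) :
  (forall k i s t, `|G k i s - G k i t| <= L * `|s - t|) ->
  (forall k i, `|G k i 0| <= B) ->
  exists2 p : nat -> nat, increasing_seq p &
    exists Ginf : I -> R -> R, forall i t, G (p k) i t @[k --> \oo] --> Ginf i t.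
Proof.
move=> GL GB.
pose a (j k : nat) : R := if unpickle j is Some (i, q) then G k i (ratr q) else 0.
have [|p pi pc] := @diag_subseq R a.
  move=> j; exists (`|match unpickle j with Some iq => L * `|ratr (iq : I * rat).2 : R| + B | None => 0 end|).
  move=> k; rewrite /a; case: (unpickle j) => [[i q]|]; last by rewrite !normr0.
  apply: le_trans (ler_norm _) => /=.
  rewrite -[G k i _](subrK (G k i 0)) (le_trans (ler_normD _ _))// lerD//.
  by have := GL k i (ratr q) 0; rewrite subr0.
exists p => //.
suff : forall it : I * R, exists l : R, G (p k) it.1 it.2 @[k --> \oo] --> l.
  move=> /choice[Ginf GP].
  by exists (fun i t => Ginf (i, t)) => i t; exact: (GP (i, t)).
move=> [i t] /=; apply/cvg_ex/cauchy_cvgP/cauchy_exP => e e0.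
have L1 : 0 < `|L| + 1 by rewrite ltr_wpDl.
pose d : R := e / (3 * (`|L| + 1)).
have d0 : 0 < d by rewrite divr_gt0// mulr_gt0.
have [q] : exists q : rat, ratr q \in `]t - d, t + d[.
  by have [|q qt] := @rat_in_itvoo R (t - d) (t + d); [lra|exists q].
rewrite in_itv/= => /andP[q1 q2].
have qt : `|t - ratr q| < d by rewrite ltr_distl; apply/andP; split; lra.
have Gq k : `|G k i t - G k i (ratr q)| <= e / 3.
  apply: le_trans (GL _ _ _ _) _.
  apply: (@le_trans _ _ ((`|L| + 1) * d)).
    apply: (@le_trans _ _ ((`|L| + 1) * `|t - ratr q|)).
      by rewrite ler_wpM2r// (le_trans (ler_norm _))// lerDl.
    by rewrite ler_wpM2l// ltW.
  rewrite /d mulrC invfM mulrA divfK ?gt_eqF//.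
have /cvg_ex[l /= hl] := pc (pickle (i, q)).
exists l; suff : \forall k \near \oo, ball l e (G (p k) i t) by [].
have e3 : 0 < e / 3 by rewrite divr_gt0.
move/cvgrPdist_lt : hl => /(_ _ e3); rewrite /a pickleK; apply: filterS => k hk.
have := Gq (p k); move: hk; rewrite /ball/= => hk h2.
rewrite (_ : l - G (p k) i t = (l - G (p k) i (ratr q)) + (G (p k) i (ratr q) - G (p k) i t)); last by ring.
rewrite (le_lt_trans (ler_normD _ _))//; rewrite distrC in h2; lra.
Qed.

(** * Completed Lebesgue measure and weak convergence of controls *)

(** The identity, from the completed sigma-algebra to the Borel one, pushes the completed measure
    forward to [lebesgue_measure]. *)
Lemma completed_integralE (R : realType) (g : R -> \bar R) : measurable_fun [set: R] g ->
  (\int[@completed_lebesgue_measure R]_x g x = \int[@lebesgue_measure R]_x g x)%E.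
Proof.
move=> mg.
have mid : measurable_fun [set: lebR R] (id : lebR R -> measurableTypeR R).
  by move=> _ Y mY; rewrite setTI; exact: borel_completed_measurable.
have pf (f : R -> \bar R) : measurable_fun [set: R] f -> (forall x, 0 <= f x)%E ->
    (\int[@completed_lebesgue_measure R]_x f x = \int[@lebesgue_measure R]_x f x)%E.
  move=> mf f0.
  have := @ge0_integral_pushforward _ _ (lebR R) (measurableTypeR R) R (id : lebR R -> measurableTypeR R)
    mid (@completed_lebesgue_measure R) setT f measurableT mf (fun x _ => f0 x).
  rewrite preimage_setT => <-.
  by apply: eq_measure_integral => A mA _.
rewrite [LHS]integralE [RHS]integralE; congr (_ - _)%E; apply: pf => //.
  exact: measurable_funepos.
exact: measurable_funeneg.
Qed.

Lemma nullset_completed (R : realType) (E : set R) : nullset E ->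
  (@completed_lebesgue_measure R).-negligible E.
Proof. by move=> [A [mA A0 EA]]; exists A; split => //; exact: borel_completed_measurable. Qed.

Lemma borel_completed_measurable_fun (R : realType) (g : R -> R) :
  measurable_fun [set: R] g -> measurable_fun [set: lebR R] (g : lebR R -> R).
Proof.
move=> mg _ Y mY; rewrite setTI; apply: borel_completed_measurable.
by rewrite -[_ @^-1` _]setTI; exact: mg.
Qed.

Lemma Rintegral_sum_bm (R : realType) (I : Type) (r : seq I) (b d : I -> R -> R) :
  (forall j, lebesgue_measure.-integrable [set: R] (EFin \o b j)) ->
  (forall j, bm (d j)) ->
  lebesgue_measure.-integrable [set: R] (EFin \o (fun t => \sum_(j <- r) b j t * d j t)) /\
  Rintegral (@lebesgue_measure R) setT (fun t => \sum_(j <- r) b j t * d j t) =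
  \sum_(j <- r) Rintegral (@lebesgue_measure R) setT (fun t => b j t * d j t).
Proof.
move=> ib bd; elim: r => [|j r [ih1 ih2]].
  under [fun t => _]eq_fun do rewrite big_nil.
  rewrite big_nil; split; last by rewrite /Rintegral integral0.
  exact: integrable0.
under [fun t => \sum_(j0 <- _) _]eq_fun do rewrite big_cons.
have i1 := integrable_bmM (ib j) (bd j).
split; first exact: (integrableD measurableT i1 ih1).
by rewrite big_cons RintegralD// ih2.
Qed.

Lemma integrable_version (R : realType) (phi : R -> R) : lebesgue_integrable setT phi ->
  exists2 b : R -> R, lebesgue_measure.-integrable [set: R] (EFin \o b) &
    {ae @lebesgue_measure R, forall t : R, phi t = b t}.
Proof.
move=> iphi; have [/measurable_EFinP mphi fin] := integrableP _ _ _ iphi.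
have [b mb bE] := @borel_version R setT phi measurableT mphi.
exists b; last by apply: ae_mono bE => t; exact.
apply/integrableP; split; first exact/measurable_EFinP.
have mnb : measurable_fun [set: R] (fun t => `|b t|) by exact: measurableT_comp.
have mnphi : measurable_fun [set: lebR R] ((fun t => `|phi t|%:E) : lebR R -> \bar R).
  by apply/measurable_EFinP; exact: (measurableT_comp (@normr_measurable R setT) mphi).
have mnb' : measurable_fun [set: lebR R] ((fun t => `|b t|%:E) : lebR R -> \bar R).
  exact/measurable_EFinP/borel_completed_measurable_fun.
under eq_integral do rewrite abse_EFin.
rewrite -completed_integralE; last exact/measurable_EFinP.
rewrite (ae_eq_integral _ _ measurableT mnb' mnphi)//.
by apply: negligibleS (nullset_completed bE) => t /=; apply: contra_not => h _; rewrite h.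
Qed.

Lemma lebesgue_integralT_dotv (R : realType) (N : nat) (phi : R -> 'rV[R]_N)
    (b : 'I_N -> R -> R) (u : R -> 'rV[R]_N) :
  L1 phi -> (forall j, lebesgue_measure.-integrable [set: R] (EFin \o b j)) ->
  (forall j, {ae @lebesgue_measure R, forall t : R, phi t 0 j = b j t}) ->
  (forall j, bm (fun t => u t 0 j)) ->
  lebesgue_integralT (fun t => dotv (phi t) (u t)) =
  \sum_(j < N) Rintegral (@lebesgue_measure R) setT (fun t => b j t * u t 0 j).
Proof.
move=> iphi ib phib bu.
have [isum <-] := Rintegral_sum_bm (index_enum 'I_N) ib bu.
have mphi j : measurable_fun [set: lebR R] ((fun t => phi t 0 j) : lebR R -> R).
  by have /integrableP[/measurable_EFinP] := iphi j.
have msum : measurable_fun [set: R] (fun t => \sum_(j < N) b j t * u t 0 j).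
  by have /integrableP[/measurable_EFinP] := isum.
rewrite /lebesgue_integralT /Rintegral -completed_integralE; last exact/measurable_EFinP.
have mdot : measurable_fun [set: lebR R]
    ((fun t => (dotv (phi t) (u t))%:E) : lebR R -> \bar R).
  apply/measurable_EFinP; apply: measurable_sum => j.
  apply: measurable_funM; first exact: mphi.
  by apply: borel_completed_measurable_fun; case: (bu j).
have msum' : measurable_fun [set: lebR R]
    ((fun t => (\sum_(j < N) b j t * u t 0 j)%:E) : lebR R -> \bar R).
  exact/measurable_EFinP/borel_completed_measurable_fun.
congr fine; apply: (ae_eq_integral _ _ measurableT mdot msum').
have := nullset_completed (ae_all phib); apply: negligibleS => t /=.
apply: contra_not => h _; congr _%:E.
by apply: eq_bigr => j _; rewrite h.
Qed.

(** Under a uniform bound it suffices to test against indicators of intervals. Test functions in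
    [L1] are first replaced by Borel versions, which does not change the pairings. *)
Lemma weak_cvg_of_IR (R : realType) (N : nat) (u_ : nat -> R -> 'rV[R]_N)
    (u : R -> 'rV[R]_N) :
  (forall k j, bm (fun t => u_ k t 0 j)) -> (forall j, bm (fun t => u t 0 j)) ->
  (forall k j t, `|u_ k t 0 j| <= 1) -> (forall j t, `|u t 0 j| <= 1) ->
  (forall j a b, a <= b ->
    IR (fun t => u_ k t 0 j) a b @[k --> \oo] --> IR (fun t => u t 0 j) a b) ->
  weak_cvg u_ u.
Proof.
move=> bu_ bu u_1 u1 cvu phi iphi.
have /choice[b bP] : forall j, exists b : R -> R,
    lebesgue_measure.-integrable [set: R] (EFin \o b) /\
    {ae @lebesgue_measure R, forall t : R, phi t 0 j = b t}.
  by move=> j; have [b ib bE] := integrable_version (iphi j); exists b.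
have ib j := (bP j).1; have bE j := (bP j).2.
rewrite (lebesgue_integralT_dotv iphi ib bE bu).
under eq_fun do rewrite (lebesgue_integralT_dotv iphi ib bE (bu_ _)).
apply: cvg_big => [|j _]; first exact: add_continuous.
have := @weak_limit R (fun k t => u_ k t 0 j - u t 0 j) 2.
move=> /(_ (fun k => bmB (bu_ k j) (bu j))) h.
have {h} : forall phi : R -> R, lebesgue_measure.-integrable [set: R] (EFin \o phi) ->
    Rintegral (@lebesgue_measure R) setT (fun t => phi t * (u_ k t 0 j - u t 0 j))
    @[k --> \oo] --> (0 : R).
  apply: h.
    by move=> k t; rewrite (le_trans (ler_normB _ _))//; have := u_1 k j t; have := u1 j t; lra.
  move=> a c ac; under eq_fun do rewrite IRB//.
  by rewrite -(subrr (IR (fun t => u t 0 j) a c)); apply: cvgB; [exact: cvu|exact: cvg_cst].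
move=> /(_ _ (ib j)) h; rewrite -[X in _ --> X]add0r.
under eq_fun do rewrite -[Rintegral _ _ _](subrK
  (Rintegral (@lebesgue_measure R) setT (fun t => b j t * u t 0 j))).
apply: cvgD; last exact: cvg_cst.
apply: cvg_trans h; apply: near_eq_cvg; apply: nearW => k.
rewrite -RintegralB//; [|exact: integrable_bmM|exact: integrable_bmM].
by apply: eq_Rintegral => t _; rewrite mulrBr.
Qed.

(** The zero function is then a primitive of g, so its derivative is g almost everywhere. *)
Lemma IR_zero_ae (R : realType) (g : R -> R) : bm g ->
  (forall a b, a <= b -> IR g a b = 0) ->
  {ae @lebesgue_measure R, forall t : R, g t = 0}.
Proof.
move=> bg g0.
have := @ae_has_deriv_IR R g (fun=> 0) (bm_locally_integrable bg).
move=> h; have {h} := h (fun a b ab => ltac:(by rewrite subrr g0)).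
apply: ae_mono => t /is_derive_has_deriv [_ <-].
by rewrite derive_cst.
Qed.

(** * Functions of class KL *)

(* The supremum against the tent [max 0 (min r (2 r - rho))], which is
   2-Lipschitz in r, regularizes [sup {y | rho <= r}]; dividing by r gives a
   continuous majorant that only sees the data with [rho <= 2 r]. *)
Definition tent (R : realType) (r rho : R) : R := Num.max 0 (Num.min r (2 * r - rho)).

Definition tent_sup (R : realType) (A : R -> R -> R -> Prop) (r t : R) : R :=
  sup [set z | z = 0 \/ exists rho th y, [/\ A rho th y, t <= th & z = y * tent r rho]].

Lemma tent_ge0 (R : realType) (r rho : R) : 0 <= tent r rho.
Proof. by rewrite /tent le_max lexx. Qed.

Lemma tent0 (R : realType) (r rho : R) : 2 * r <= rho -> tent r rho = 0.
Proof. by move=> h; rewrite /tent max_l// ge_min; apply/orP; right; lra. Qed.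

Lemma tent_le (R : realType) (r rho : R) : 0 <= r -> tent r rho <= r.
Proof. by move=> r0; rewrite /tent ge_max r0 ge_min lexx. Qed.

Lemma tent_diag (R : realType) (r : R) : 0 <= r -> tent r r = r.
Proof. by move=> r0; rewrite /tent min_l ?max_r//; lra. Qed.

Lemma tent_lip (R : realType) (r s rho : R) : `|tent r rho - tent s rho| <= 2 * `|r - s|.
Proof.
wlog rs : r s / s <= r.
  have [sr|/ltW rs] := leP s r; first exact.
  by move=> /(_ _ _ rs); rewrite distrC (distrC s).
rewrite (ger0_norm (_ : 0 <= r - s)) ?subr_ge0// /tent ler_norml.
by case: (leP r (2 * r - rho)) => h1; case: (leP s (2 * s - rho)) => h2;
  [case: (leP 0 r) => h3; case: (leP 0 s) => h4|
   case: (leP 0 r) => h3; case: (leP 0 (2 * s - rho)) => h4|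
   case: (leP 0 (2 * r - rho)) => h3; case: (leP 0 s) => h4|
   case: (leP 0 (2 * r - rho)) => h3; case: (leP 0 (2 * s - rho)) => h4];
  apply/andP; split; lra.
Qed.

(** For r > 0, [tent r rho / r] is max 0 (min 1 (2 - rho / r)), which is nondecreasing in r; this
    makes [tent_sup A r t / r] nondecreasing in r. *)
Lemma tent_scale (R : realType) (r s rho : R) : 0 <= rho -> 0 <= r -> r <= s ->
  tent r rho * s <= tent s rho * r.
Proof.
move=> rho0 r0 rs; have s0 := le_trans r0 rs.
have [h|h] := leP (2 * r) rho; first by rewrite tent0// mul0r mulr_ge0// tent_ge0.
have rho_rs : rho * r <= rho * s by rewrite ler_wpM2l.
rewrite /tent (max_r (_ : 0 <= Num.min r _)); last by rewrite le_min r0; lra.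
rewrite (max_r (_ : 0 <= Num.min s _)); last by rewrite le_min s0; lra.
case: (leP r (2 * r - rho)) => h1; case: (leP s (2 * s - rho)) => h2.
- by rewrite mulrC.
- by exfalso; lra.
- by rewrite (mulrC s) ler_wpM2r//; lra.
- by lra.
Qed.

Lemma KL_bound (R : realType) (A : R -> R -> R -> Prop) :
  (forall rho th y, A rho th y -> [/\ 0 <= rho, 0 <= th & 0 <= y]) ->
  (forall r : R, 0 <= r -> exists M : R, forall rho th y, A rho th y -> rho <= r -> y <= M) ->
  (forall e : R, 0 < e -> exists2 d : R, 0 < d &
    forall rho th y, A rho th y -> rho <= d -> y <= e) ->
  (forall r e : R, 0 <= r -> 0 < e -> exists T : R,
    forall rho th y, A rho th y -> rho <= r -> T <= th -> y <= e) ->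
  exists2 b : R -> R -> R, classKL b & forall rho th y, A rho th y -> y <= b rho th.
Proof.
move=> A0 Abd Asm Aatt.
pose S (r t : R) : set R :=
  [set z | z = 0 \/ exists rho th y, [/\ A rho th y, t <= th & z = y * tent r rho]].
have G_le (r t c : R) : 0 <= c ->
    (forall rho th y, A rho th y -> t <= th -> y * tent r rho <= c) -> tent_sup A r t <= c.
  move=> c0 h; apply: ge_sup; first by exists 0; left.
  by move=> z [->//|[rho [th [y [Ay tth ->]]]]]; exact: (h _ _ _ Ay tth).
have S_ub (r t : R) : 0 <= r -> has_ubound (S r t).
  move=> r0; have [M HM] := Abd (2 * r) (ltac:(lra)).
  exists (`|M| * r) => z [->|[rho [th [y [Ay tth ->]]]]]; first by rewrite mulr_ge0.
  have [rho0 th0 y0] := A0 _ _ _ Ay.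
  have [h|/ltW h] := leP rho (2 * r); last by rewrite tent0// mulr0 mulr_ge0.
  by rewrite ler_pM ?tent_ge0 ?tent_le// (le_trans (HM _ _ _ Ay h))// ler_norm.
have le_G (r t : R) rho th y : 0 <= r -> A rho th y -> t <= th ->
    y * tent r rho <= tent_sup A r t.
  move=> r0 Ay tth; apply: ub_le_sup; first exact: S_ub.
  by right; exists rho, th, y.
have G_ge0 (r t : R) : 0 <= r -> 0 <= tent_sup A r t.
  by move=> r0; apply: ub_le_sup; [exact: S_ub|left].
(* The first term dominates the data; the second makes b strictly increasing and unbounded in r
   while tending to 0 in t. *)
pose b (r t : R) : R := tent_sup A r t / r + r / (1 + t).
have g_le (r t c : R) : 0 <= r -> 0 <= c ->
    (forall rho th y, A rho th y -> t <= th -> rho <= 2 * r -> y <= c) ->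
    tent_sup A r t / r <= c.
  move=> r0 c0 h; have [->|rN0] := eqVneq r 0; first by rewrite invr0 mulr0.
  have r1 : 0 < r by rewrite lt_neqAle eq_sym rN0.
  rewrite ler_pdivrMr//; apply: G_le; first by rewrite mulr_ge0.
  move=> rho th y Ay tth; have [rho0 th0 y0] := A0 _ _ _ Ay.
  have [h1|/ltW h1] := leP rho (2 * r); last by rewrite tent0// mulr0 mulr_ge0.
  by rewrite ler_pM ?tent_ge0 ?tent_le//; exact: (h _ _ _ Ay tth h1).
have g_ge0 (r t : R) : 0 <= r -> 0 <= tent_sup A r t / r.
  by move=> r0; rewrite divr_ge0// G_ge0.
have g_nd (r s t : R) : 0 <= r -> r <= s -> tent_sup A r t / r <= tent_sup A s t / s.
  move=> r0 rs; have s0 := le_trans r0 rs.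
  have [->|rN0] := eqVneq r 0; first by rewrite invr0 mulr0 g_ge0.
  have r1 : 0 < r by rewrite lt_neqAle eq_sym rN0.
  have s1 := lt_le_trans r1 rs.
  rewrite ler_pdivrMr// mulrAC; apply: G_le.
    by rewrite divr_ge0// mulr_ge0// G_ge0.
  move=> rho th y Ay tth; have [rho0 th0 y0] := A0 _ _ _ Ay.
  rewrite ler_pdivlMr// -mulrA.
  apply: (@le_trans _ _ (y * (tent s rho * r))); first by rewrite ler_wpM2l// tent_scale.
  by rewrite mulrA ler_wpM2r//; exact: (le_G _ _ _ _ _ s0 Ay tth).
have t1 (t : R) : 0 <= t -> 0 < 1 + t by move=> h; lra.
exists b; last first.
  move=> rho th y Ay; have [rho0 th0 y0] := A0 _ _ _ Ay.
  apply: (@le_trans _ _ (tent_sup A rho th / rho)); last first.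
    by rewrite lerDl divr_ge0// ltW// t1.
  (* At rho = 0 the quotient is 0 by the convention on division, and the smallness hypothesis forces
     y <= 0. *)
  have [rhoE|rhoN0] := eqVneq rho 0.
    rewrite rhoE invr0 mulr0; apply/ler_addgt0Pr => e e0; rewrite add0r.
    have [d d0 hd] := Asm _ e0; apply: (hd _ _ _ Ay).
    by rewrite rhoE ltW.
  have rho1 : 0 < rho by rewrite lt_neqAle eq_sym rhoN0.
  by rewrite ler_pdivlMr// -{1}(tent_diag rho0); exact: (le_G _ _ _ _ _ rho0 Ay (lexx _)).
split; last first.
  move=> r r0; split.
    move=> s t s0 st; rewrite lerD//.
      rewrite ler_wpM2r ?invr_ge0//; apply: G_le; first exact: G_ge0.
      by move=> rho th y Ay tth; apply: (le_G _ _ _ _ _ r0 Ay); exact: le_trans tth.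
    rewrite ler_wpM2l// lef_pV2 ?posrE; [lra|exact: t1 (le_trans s0 st)|exact: t1].
  rewrite -[X in _ --> X](addr0 0); apply: cvgD.
    apply/cvgrPdist_le => e e0.
    have [T hT] := Aatt (2 * r) e (ltac:(lra)) e0.
    near=> t; rewrite sub0r normrN ger0_norm ?g_ge0//.
    apply: g_le => //; first exact: ltW.
    move=> rho th y Ay tth rho2; apply: (hT _ _ _ Ay rho2); apply: le_trans tth.
    by near: t; apply: nbhs_pinfty_ge; exact: num_real.
  rewrite -[X in _ --> X](mulr0 r); apply: cvgM; first exact: cvg_cst.
  apply/cvgrPdist_le => e e0; near=> t.
  have t0 : e^-1 <= t by near: t; apply: nbhs_pinfty_ge; exact: num_real.
  have ei : 0 < e^-1 by rewrite invr_gt0.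
  rewrite sub0r normrN ger0_norm; last by rewrite invr_ge0; lra.
  by rewrite -[leRHS]invrK lef_pV2 ?posrE//; lra.
move=> t t0; have tp := t1 _ t0; split; last first.
  move=> M; exists ((`|M| + 1) * (1 + t)); first by rewrite mulr_ge0// ?ltW// ltr_wpDl.
  apply: (@lt_le_trans _ _ (`|M| + 1)); first by rewrite ltr_pwDr// ler_norm.
  by rewrite /b mulfK ?gt_eqF// lerDr g_ge0// mulr_ge0// ltW// ltr_wpDl.
split; last by rewrite /b invr0 mulr0 mul0r addr0.
- apply/subspace_continuousP => r /= r0.
  apply: cvgD; last first.
    by apply: cvgM; [exact: cvg_within|exact: cvg_cst].
  move: r0; rewrite /nonneg_reals/= le_eqVlt => /predU1P[<-|r0].
    rewrite invr0 mulr0; apply/cvgrPdist_le => e e0.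
    have [d d0 hd] := Asm _ e0.
    have d2 : 0 < d / 2 by rewrite divr_gt0.
    near=> s.
    have s0 : 0 <= s by near: s; exact: withinT.
    have sd : s <= d / 2.
      by apply: ltW; near: s; apply: cvg_within; exact: lt_nbhsl.
    rewrite sub0r normrN ger0_norm ?g_ge0//.
    apply: g_le => //; first exact: ltW.
    by move=> rho th y Ay _ h; apply: (hd _ _ _ Ay); lra.
  apply: cvg_within_filter; apply: cvgM; last first.
    by apply: cvgV; [rewrite gt_eqF|exact: cvg_id].
  (* For p <= 2 * r the tent vanishes once rho > 4 * r, so M bounds all the data that matter near
     r. *)
  have [M HM] := Abd (4 * r) (ltac:(lra)).
  apply/cvgrPdist_le => e e0.
  have M1 : 0 < `|M| + 1 by rewrite ltr_wpDl.
  have d0 : 0 < e / (2 * (`|M| + 1)) by rewrite divr_gt0// mulr_gt0.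
  near=> s.
  have s0 : 0 <= s by apply: ltW; near: s; exact: lt_nbhsr.
  have s2 : s <= 2 * r by apply: ltW; near: s; apply: lt_nbhsl; lra.
  have rs : `|r - s| <= e / (2 * (`|M| + 1)) by near: s; exact: cvgr_dist_le.
  have key (p q : R) : 0 <= p -> 0 <= q -> p <= 2 * r -> `|p - q| = `|r - s| ->
      tent_sup A p t <= tent_sup A q t + e.
    move=> p0 q0 pr pq; apply: G_le; first by rewrite addr_ge0 ?G_ge0// ltW.
    move=> rho th y Ay tth; have [rho0 th0 y0] := A0 _ _ _ Ay.
    have [h1|/ltW h1] := leP rho (4 * r); last first.
      by rewrite tent0; [rewrite mulr0 addr_ge0 ?G_ge0// ltW|lra].
    have yM : y <= `|M| by rewrite (le_trans (HM _ _ _ Ay h1))// ler_norm.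
    have h2 : tent p rho <= tent q rho + 2 * `|r - s|.
      by have := tent_lip p q rho; rewrite pq ler_norml; lra.
    have h3 := le_G _ _ _ _ _ q0 Ay tth.
    apply: (@le_trans _ _ (y * (tent q rho + 2 * `|r - s|))); first by rewrite ler_wpM2l.
    rewrite mulrDr lerD//.
    move: rs; rewrite ler_pdivlMr ?mulr_gt0// => rs.
    apply: (@le_trans _ _ ((`|M| + 1) * (2 * `|r - s|))).
      by rewrite ler_wpM2r ?mulr_ge0//; lra.
    by rewrite (le_trans _ rs)//; lra.
  rewrite ler_norml; apply/andP; split.
    by have := key s r s0 (ltW r0) s2 (distrC _ _); lra.
  by have := key r s (ltW r0) s0 (ltac:(lra)) erefl; lra.
- move=> r s r0 rs; rewrite /b; apply: ler_ltD; first by rewrite g_nd// ltW.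
  by rewrite ltr_pM2r ?invr_gt0.
Unshelve. all: by end_near. Qed.

(** * Functions along curves *)

Lemma comp_bm_version (R : realType) (n m : nat) (K : set 'rV[R]_n) (J : set R)
    (g : R -> 'rV[R]_n -> 'rV[R]_m) (M : R) (y : R -> 'rV[R]_n) (j : 'I_m) :
  0 <= M ->
  (forall xi, K xi -> exists2 b : R -> R, measurable_fun [set: R] b &
    {ae @lebesgue_measure R, forall t : R, J t -> g t xi 0 j = b t}) ->
  {ae @lebesgue_measure R, forall t : R, J t -> {within K, continuous (g t)}} ->
  {ae @lebesgue_measure R, forall t : R, J t -> forall xi, K xi -> enorm (g t xi) <= M} ->
  (forall t, K (y t)) -> continuous y ->
  exists b : R -> R, [/\ bm b, forall t, `|b t| <= M &
    {ae @lebesgue_measure R, forall t : R, J t -> g t (y t) 0 j = b t}].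
Proof.
move=> M0 gv gc gM yK yc.
have [|b mb bP] := @comp_version R n K J (fun t xi => g t xi 0 j) y gv _ yK yc.
  apply: ae_mono gc => t h /h gt xi.
  apply: (continuous_comp (f := (g t : subspace K -> _)) (g := fun v : 'rV[R]_m => v 0 j)).
    exact: gt.
  exact: coord_continuous.
have MM : - M <= M by lra.
have bM t : `|clamp (- M) M (b t)| <= M by rewrite ler_norml; exact: clamp_itv.
exists (fun t => clamp (- M) M (b t)); split => //.
  split; last by exists M.
  apply: measurable_maxr; first exact: measurable_cst.
  by apply: measurable_minr => //; exact: measurable_cst.
apply: ae_mono (ae_and bP gM) => t [h1 h2] Jt.
rewrite -h1// clampE// -ler_norml (le_trans (coord_le_enorm _ _))//.
exact: h2.
Qed.

Lemma lebesgue_measurable_version (R : realType) (m : nat) (D : set R)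
    (g : R -> 'rV[R]_m) (j : 'I_m) : measurable D -> lebesgue_measurable D g ->
  exists2 b : R -> R, measurable_fun [set: R] b &
    {ae @lebesgue_measure R, forall t : R, D t -> g t 0 j = b t}.
Proof. by move=> mD mg; exact: borel_version. Qed.

Lemma measurable_nonneg_reals (R : realType) : measurable (@nonneg_reals R).
Proof.
rewrite (_ : @nonneg_reals R = `[0, +oo[%classic); first exact: measurable_itv.
by apply/seteqP; split => t /=; rewrite /nonneg_reals/= in_itv/= andbT.
Qed.

Lemma uniformly_bounded_ae (R : realType) (n m : nat) (J : set R) (X K : set 'rV[R]_n)
    (g : R -> 'rV[R]_n -> 'rV[R]_m) :
  uniformly_bounded J X g -> compact K -> K `<=` X ->
  exists M : R, 0 <= M /\ {ae @lebesgue_measure R, forall t : R, J t ->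
    forall xi, K xi -> enorm (g t xi) <= M}.
Proof.
move=> [J' [_ nJ gM]] cK KX; have [M gMK] := gM K cK KX.
exists `|M|; split => //; apply: negligibleS nJ => t /= /not_implyP[Jt nb]; split => // J't.
by apply: nb => xi Kxi; rewrite (le_trans (gMK _ _ J't Kxi))// ler_norm.
Qed.

Lemma continuous_within_curve (T U V : topologicalType) (D : set U)
    (g : U -> V) (c : T -> U) :
  {within D, continuous g} -> continuous c -> (forall t, D (c t)) ->
  continuous (g \o c).
Proof.
move=> /subspace_continuousP gD cc cD t Y /(gD _ (cD t)) h.
have h' : \forall s \near t, D (c s) -> Y (g (c s)) := cc t _ h.
suff : \forall s \near t, Y (g (c s)) by [].
by apply: filterS h' => s; apply.
Qed.

Lemma continuous_bounded_itv (R : realType) (g : R -> R) (a b : R) : a <= b ->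
  continuous g -> exists2 M : R, 0 <= M & forall t, a <= t <= b -> `|g t| <= M.
Proof.
move=> ab gc; have [_ [_ [M gM]]] := continuous_clamp_bm ab gc.
exists `|M| => // t tab; have := gM t; rewrite /= clampE// => /le_trans; apply.
exact: ler_norm.
Qed.

(** The Frechet condition with e = 1. The partial derivatives are bounded along a compact piece of
    curve, so [lip_of_local] then makes V Lipschitz along trajectories. The time is a function th to
    allow clamped time. *)
Lemma C1_curve_lip (R : realType) (n : nat) (X : set 'rV[R]_n) (W Wt : R -> 'rV[R]_n -> R)
    (Wx : R -> 'rV[R]_n -> 'rV[R]_n) (th : R -> R) (y : R -> 'rV[R]_n) (L t : R) :
  continuously_differentiable X W Wt Wx -> continuous th -> continuous y ->
  (forall s, 0 <= th s) -> (forall s, X (y s)) -> 0 <= L ->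
  (forall s r, `|th s - th r| <= `|s - r|) -> (forall s r, `|y s - y r| <= L * `|s - r|) ->
  \forall s \near t, `|W (th s) (y s) - W (th t) (y t)| <=
    (`|Wt (th t) (y t)| + n%:R * `|Wx (th t) (y t)| * L + 1 + n%:R * L) * `|s - t|.
Proof.
move=> [frechet _ _] thc yc th0 yX L0 thL yL.
pose c (s : R) : R * 'rV[R]_n := (th s, y s).
have cc : continuous c by move=> s; exact: (cvg_pair (thc s) (yc s)).
have Dc s : (@nonneg_reals R `*` X) (c s) by split; [exact: th0|exact: yX].
have h := frechet _ (Dc t) 1 ltr01.
have {}h : \forall s \near t, (@nonneg_reals R `*` X) (c s) ->
    `|W (c s).1 (c s).2 - W (c t).1 (c t).2 - (Wt (c t).1 (c t).2 * ((c s).1 - (c t).1) +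
      dotv (Wx (c t).1 (c t).2) ((c s).2 - (c t).2))|
    <= 1 * (`|(c s).1 - (c t).1| + enorm ((c s).2 - (c t).2)) := cc t _ h.
apply: filterS h => s /(_ (Dc s)) /=; rewrite mul1r => h.
have h1 := thL s t; have h2 := yL s t.
have h3 := dotv_le (Wx (th t) (y t)) (y s - y t).
have h4 := enorm_le_mxnorm (y s - y t).
have h5 : `|Wt (th t) (y t) * (th s - th t)| <= `|Wt (th t) (y t)| * `|s - t|.
  by rewrite normrM ler_wpM2l.
have h6 : n%:R * (`|Wx (th t) (y t)| * `|y s - y t|) <=
    n%:R * `|Wx (th t) (y t)| * L * `|s - t|.
  by rewrite -!mulrA ler_wpM2l// ler_wpM2l.
have h7 : n%:R * `|y s - y t| <= n%:R * L * `|s - t| by rewrite -mulrA ler_wpM2l.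
set A := W (th s) (y s) - W (th t) (y t) in h *.
set B := Wt (th t) (y t) * _ in h h5; set C := dotv _ _ in h h3.
rewrite -(subrK (B + C) A) (le_trans (ler_normD _ _))//.
have := ler_normD B C.
move: h h1 h2 h3 h4 h5 h6 h7; clear; move: `|A - (B + C)| `|B + C| `|B| `|C| => a bc b c.
rewrite !mulrDl mul1r; lra.
Qed.

(** Chain rule at a time near which th is the identity: half of e pays for the Frechet remainder
    (e1), half for the remainder of y (e2). *)
Lemma C1_curve_deriv (R : realType) (n : nat) (X : set 'rV[R]_n) (W Wt : R -> 'rV[R]_n -> R)
    (Wx : R -> 'rV[R]_n -> 'rV[R]_n) (th : R -> R) (y : R -> 'rV[R]_n) (L t : R)
    (v : 'rV[R]_n) :
  continuously_differentiable X W Wt Wx -> continuous th -> continuous y ->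
  (forall s, 0 <= th s) -> (forall s, X (y s)) -> 0 <= L ->
  (forall s r, `|y s - y r| <= L * `|s - r|) ->
  (\forall s \near t, th s = s) -> has_deriv y t v ->
  has_deriv (fun s => W (th s) (y s)) t (Wt t (y t) + dotv (Wx t (y t)) v).
Proof.
move=> [frechet _ _] thc yc th0 yX L0 yL thid yv e e0.
have tht : th t = t by exact: nbhs_singleton thid.
pose c (s : R) : R * 'rV[R]_n := (th s, y s).
have cc : continuous c by move=> s; exact: (cvg_pair (thc s) (yc s)).
have Dc s : (@nonneg_reals R `*` X) (c s) by split; [exact: th0|exact: yX].
pose e1 : R := e / (2 * (1 + n%:R * L)).
have nL0 : 0 < 1 + n%:R * L by rewrite ltr_pwDl// mulr_ge0.
have e10 : 0 < e1 by rewrite divr_gt0// mulr_gt0.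
have h := frechet _ (Dc t) e1 e10.
have {}h : \forall s \near t, (@nonneg_reals R `*` X) (c s) ->
    `|W (c s).1 (c s).2 - W (c t).1 (c t).2 - (Wt (c t).1 (c t).2 * ((c s).1 - (c t).1) +
      dotv (Wx (c t).1 (c t).2) ((c s).2 - (c t).2))|
    <= e1 * (`|(c s).1 - (c t).1| + enorm ((c s).2 - (c t).2)) := cc t _ h.
pose G : R := n%:R * `|Wx t (y t)|.
have G0 : 0 <= G by rewrite mulr_ge0.
pose e2 : R := e / (2 * (G + 1)).
have e20 : 0 < e2 by rewrite divr_gt0// mulr_gt0// ltr_wpDl.
apply: filterS3 h thid (yv _ e20) => s /(_ (Dc s)) /= h1 ths h2.
rewrite ths tht in h1 *.
have dotB (a b d : 'rV[R]_n) (k : R) : dotv a b = dotv a (b - k *: d) + k * dotv a d.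
  rewrite /dotv mulr_sumr -big_split/=; apply: eq_bigr => j _; rewrite !mxE; ring.
rewrite (dotB _ (y s - y t) v (s - t)) in h1.
have h3 := dotv_le (Wx t (y t)) (y s - y t - (s - t) *: v).
have h4 := enorm_le_mxnorm (y s - y t).
have h5 := yL s t.
have h6 : e1 * (`|s - t| + enorm (y s - y t)) <= e / 2 * `|s - t|.
  apply: (@le_trans _ _ (e1 * ((1 + n%:R * L) * `|s - t|))).
    rewrite ler_pM2l// mulrDl mul1r lerD2l (le_trans h4)// -mulrA ler_wpM2l//.
  rewrite mulrA ler_wpM2r// /e1 invfM mulrA -mulrA mulVf ?mulr1// gt_eqF//.
have h7 : n%:R * (`|Wx t (y t)| * `|y s - y t - (s - t) *: v|) <= e / 2 * `|s - t|.
  rewrite mulrA -/G; apply: (@le_trans _ _ (G * (e2 * `|s - t|))); first by rewrite ler_wpM2l.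
  rewrite mulrA ler_wpM2r// /e2 mulrA ler_pdivrMr ?mulr_gt0 ?ltr_wpDl//.
  have := mulr_ge0 G0 (ltW e0); lra.
rewrite -[_ *: (_ + _)]/(_ * (_ + _)).
set A := W s (y s) - W t (y t) in h1 *.
set D := dotv _ (_ - _ *: _) in h1 h3; set E := dotv _ v in h1 *.
have -> : A - (s - t) * (Wt t (y t) + E) =
    (A - (Wt t (y t) * (s - t) + (D + (s - t) * E))) + D by ring.
rewrite (le_trans (ler_normD _ _))//.
have h8 := le_trans h1 h6; have h9 := le_trans h3 h7.
by apply: le_trans (lerD h8 h9) _; lra.
Qed.

Lemma ac_dist (R : realType) (n : nat) (a b e : R) (x : R -> 'rV[R]_n) :
  absolutely_continuous_on a b x -> 0 < e ->
  exists2 d : R, 0 < d & forall s t, a <= s -> s <= t -> t <= b -> t - s < d ->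
    `|x t - x s| < e.
Proof.
move=> xac e0; have [d d0 xd] := xac e e0; exists d => // s t as_ st tb std.
have := @xd 1%N (fun=> s) (fun=> t); rewrite !big_ord1 => h.
apply: le_lt_trans (mxnorm_le_enorm _) _; apply: h => // i j.
by rewrite !ord1 eqxx.
Qed.

Lemma ac_clamp_continuous (R : realType) (n : nat) (a b : R) (x : R -> 'rV[R]_n) :
  a <= b -> absolutely_continuous_on a b x -> continuous (x \o clamp a b).
Proof.
move=> ab xac t; apply/cvgrPdist_lt => e e0.
have [d d0 xd] := ac_dist xac e0.
near=> s.
have ts : `|t - s| < d by near: s; exact: cvgr_dist_lt.
have cts := le_lt_trans (clamp_dist t s ab) ts.
have /andP[t1 t2] := clamp_itv t ab; have /andP[s1 s2] := clamp_itv s ab.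
have [h|/ltW h] := leP (clamp a b s) (clamp a b t).
  by apply: xd => //; rewrite ger0_norm ?subr_ge0 in cts.
rewrite /= distrC; apply: xd => //.
by rewrite distrC ger0_norm ?subr_ge0 in cts.
Unshelve. all: by end_near. Qed.

(** Finitely many jumps in [p - 1, p] leave a jump-free interval to the left of p; there the signal
    is locally constant, hence constant by Cousin's lemma. *)
Lemma signal_left (R : realType) (N : nat) (sigma : R -> 'I_N) (p : R) :
  switching_signal sigma -> exists2 d : R, 0 < d &
    forall r s, p - d < r -> r <= s -> s < p -> sigma r = sigma s.
Proof.
move=> [fin _].
pose F : set R := (`[p - 1, p]%classic `&` jumps sigma) `\ p.
have cF : closed F.
  have /accessible_finite_set_closed h : accessible_space R.
    by apply: hausdorff_accessible; exact: Rhausdorff.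
  by apply: h; apply: sub_finite_set (fin (p - 1) p) => t [].
have : nbhs p (~` F).
  apply: open_nbhs_nbhs; split; first exact: (closed_openC cF).
  by move=> -[_ /= h]; apply: h.
move=> /nbhs_ballP[d /= d0 Bd].
exists (Num.min d 1); first by rewrite lt_min d0 ltr01.
move=> r s rd rs sp.
apply: (@cousin R r s (fun a b => sigma a = sigma b)) => //.
  by move=> a b c _ _ _ _ -> ->.
move=> q rq qs.
have [q1 q2] : p - d < q /\ p - 1 < q.
  have h1 : Num.min d 1 <= d by rewrite ge_min lexx.
  have h2 : Num.min d 1 <= 1 by rewrite ge_min lexx orbT.
  by move: rd h1 h2; move: (Num.min d 1) => m; split; lra.
have nj : \forall t \near q, sigma t = sigma q.
  apply: contrapT => jq.
  apply: (Bd q); first by rewrite /ball/= ltr_distlC; apply/andP; split; lra.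
  split; last by move=> /= qp; lra.
  by split => //=; rewrite in_itv/=; apply/andP; split; lra.
have /nbhs_ballP[c /= c0 Bc] := nj.
exists c => // a b ra aq qb bs bac.
transitivity (sigma q); [apply/Bc|apply/esym/Bc];
  by rewrite /ball/= ltr_distlC; apply/andP; split; lra.
Qed.

(** * Limiting functions *)

Lemma classK_small (R : realType) (w : R -> R) (e : R) : classK w -> 0 < e ->
  exists2 d : R, 0 < d & forall r, 0 <= r -> r < d -> `|w r| <= e.
Proof.
move=> [/subspace_continuousP wc _ w0] e0.
have /cvgrPdist_le/(_ _ e0) := wc 0 (lexx _).
move=> /nbhs_ballP[d /= d0 Bd]; exists d => // r r0 rd.
have := Bd r; rewrite /from_subspace w0 sub0r normrN; apply => //.
by rewrite /ball/= sub0r normrN ger0_norm.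
Qed.

Lemma rV_cvg (R : realType) (n : nat) (u : nat -> 'rV[R]_n) (l : 'rV[R]_n) :
  (forall j, u k 0 j @[k --> \oo] --> l 0 j) -> u k @[k --> \oo] --> l.
Proof.
move=> ul; apply/cvgrPdist_le => e e0.
have : \forall k \near \oo, forall j, `|l 0 j - u k 0 j| <= e.
  by apply: filter_forall => j; have /cvgrPdist_le/(_ _ e0) := ul j.
apply: filterS => k h; apply: mxnorm_le; first exact: ltW.
by move=> j; rewrite !mxE.
Qed.

Lemma cvg_le_near (R : realType) (u v : nat -> R) (l m : R) :
  u k @[k --> \oo] --> l -> v k @[k --> \oo] --> m ->
  (\forall k \near \oo, u k <= v k) -> l <= m.
Proof. by move=> ul vm uv; apply: ler_cvg_to ul vm uv. Qed.

Lemma shift_ge0 (R : realType) (gam : nat -> R) (t : R) :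
  gam k @[k --> \oo] --> +oo -> \forall k \near \oo, 0 <= gam k + t.
Proof.
move=> /cvgryPge/(_ (- t)); apply: filterS => k; lra.
Qed.

Section limiting.
Context (R : realType) (n m : nat) (X K : set 'rV[R]_n)
  (g ggam : R -> 'rV[R]_n -> 'rV[R]_m) (gam : nat -> R) (M : R) (w : R -> R).
Context (KX : K `<=` X) (M0 : 0 <= M).
Context (g_meas : measurable_in_t (@nonneg_reals R) X g).
Context (g_le : {ae @lebesgue_measure R, forall t : R, 0 <= t ->
  forall xi, K xi -> enorm (g t xi) <= M}).
Context (w_K : classK w).
Context (g_cont : {ae @lebesgue_measure R, forall t : R, 0 <= t ->
  forall xi zeta, K xi -> K zeta -> enorm (g t xi - g t zeta) <= w (enorm (xi - zeta))}).
Context (gam_cvg : gam k @[k --> \oo] --> +oo).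
Context (g_lim : limiting_function X g gam ggam).

(** Countably many translates of a null set form a null set, and gam k + t is nonnegative for large
    k whatever the sign of t. *)
Lemma ae_shifts (P : R -> Prop) : {ae @lebesgue_measure R, forall t : R, 0 <= t -> P t} ->
  {ae @lebesgue_measure R, forall t : R, \forall k \near \oo, P (gam k + t)}.
Proof.
move=> aP.
have /ae_all : forall k : nat, {ae @lebesgue_measure R, forall t : R,
    0 <= gam k + t -> P (gam k + t)}.
  by move=> k; exact: (@ae_shift R (gam k) (fun t => 0 <= t -> P t)).
apply: ae_mono => t h; apply: filterS (shift_ge0 t gam_cvg) => k; exact: h.
Qed.

Lemma limiting_ae : {ae @lebesgue_measure R, forall t : R, forall xi, X xi ->
  g (gam k + t) xi @[k --> \oo] --> ggam t xi}.
Proof.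
have [E nE h] := g_lim; apply: negligibleS nE => t /=.
by move=> nh; apply: contrapT => nEt; apply: nh => xi Xxi; exact: h.
Qed.

Lemma limiting_version xi j : X xi ->
  exists2 b : R -> R, measurable_fun [set: R] b &
    {ae @lebesgue_measure R, forall t : R, setT t -> ggam t xi 0 j = b t}.
Proof.
move=> Xxi.
have [b mb bE] := lebesgue_measurable_version j (@measurable_nonneg_reals R) (g_meas Xxi).
have [|c mc cP] := @lim_version R (fun k t => b (gam k + t)).
  by move=> k; exact: (measurableT_comp mb (measurable_shift (gam k))).
exists c => //; apply: ae_mono (ae_and (ae_shifts bE) limiting_ae) => t [h1 h2] _.
apply/esym/cP; have := h2 xi Xxi => h3.
have {}h3 : g (gam k + t) xi 0 j @[k --> \oo] --> ggam t xi 0 j.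
  exact: (cvg_comp _ _ h3 (@coord_continuous R 1 m 0 j (ggam t xi))).
apply: cvg_trans h3; apply: near_eq_cvg.
by apply: filterS h1 => k ->.
Qed.

Lemma limiting_le : {ae @lebesgue_measure R, forall t : R, setT t ->
  forall xi, K xi -> enorm (ggam t xi) <= M}.
Proof.
apply: ae_mono (ae_and (ae_shifts g_le) limiting_ae) => t [h1 h2] _ xi Kxi.
have h3 : enorm (g (gam k + t) xi) @[k --> \oo] --> enorm (ggam t xi).
  exact: (cvg_comp _ _ (h2 _ (KX Kxi)) (@enorm_continuous R m (ggam t xi))).
apply: cvg_le_near h3 (cvg_cst M) _.
by apply: filterS h1 => k; apply.
Qed.

Lemma limiting_modulus : {ae @lebesgue_measure R, forall t : R,
  forall xi zeta, K xi -> K zeta ->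
  enorm (ggam t xi - ggam t zeta) <= w (enorm (xi - zeta))}.
Proof.
apply: ae_mono (ae_and (ae_shifts g_cont) limiting_ae) => t [h1 h2] xi zeta Kxi Kzeta.
have h3 : g (gam k + t) xi - g (gam k + t) zeta @[k --> \oo] --> ggam t xi - ggam t zeta.
  by apply: cvgB; apply: h2; exact: KX.
have h4 : enorm (g (gam k + t) xi - g (gam k + t) zeta) @[k --> \oo]
    --> enorm (ggam t xi - ggam t zeta).
  exact: (cvg_comp _ _ h3 (@enorm_continuous R m _)).
apply: cvg_le_near h4 (cvg_cst (w (enorm (xi - zeta)))) _.
by apply: filterS h1 => k; apply.
Qed.

Lemma limiting_continuous : {ae @lebesgue_measure R, forall t : R, setT t ->
  {within K, continuous (ggam t)}}.
Proof.
apply: ae_mono limiting_modulus => t h _.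
apply/subspace_continuousP => xi Kxi; apply/cvgrPdist_le => e e0.
have [d d0 wd] := classK_small w_K e0.
(* The factor n comes from comparing the norms; n + 1 keeps the divisor positive when n = 0. *)
have n0 : (0 : R) < n%:R + 1 by rewrite ltr_wpDl.
have dn : 0 < d / (n%:R + 1) by rewrite divr_gt0.
have near_xi : \forall zeta \near xi, `|xi - zeta| < d / (n%:R + 1).
  by apply/nbhs_ballP; exists (d / (n%:R + 1)) => // z; rewrite -ball_normE.
suff : \forall zeta \near xi, K zeta -> `|ggam t xi - ggam t zeta| <= e by [].
apply: filterS near_xi => zeta hz Kz.
rewrite (le_trans (mxnorm_le_enorm _))// (le_trans (h _ _ Kxi Kz))//.
rewrite (le_trans (ler_norm _))// wd ?enorm_ge0//.
apply: le_lt_trans (enorm_le_mxnorm _) _.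
move: hz; rewrite ltr_pdivlMr// => hz; apply: le_lt_trans hz.
by rewrite mulrC ler_wpM2l// lerDl.
Qed.

(** Time and point both move with k. The modulus, uniform in time, first replaces y k t by x t; then
    the pointwise convergence to the limiting function applies. *)
Lemma limiting_curve (y : nat -> R -> 'rV[R]_n) (x : R -> 'rV[R]_n) :
  (forall k t, K (y k t)) -> (forall t, K (x t)) ->
  (forall t, y k t @[k --> \oo] --> x t) ->
  {ae @lebesgue_measure R, forall t : R,
    enorm (g (gam k + t) (y k t) - ggam t (x t)) @[k --> \oo] --> (0 : R)}.
Proof.
move=> yK xK yx.
apply: ae_mono (ae_and (ae_shifts g_cont) limiting_ae) => t [h1 h2].
have n0 : (0 : R) < n%:R + 1 by rewrite ltr_wpDl.
have m0 : (0 : R) < m%:R + 1 by rewrite ltr_wpDl.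
apply/cvg0P => e e0.
have e1 : 0 < e / 2 / (m%:R + 1) by rewrite !divr_gt0.
have [d d0 wd] := classK_small w_K e1.
have dn : 0 < d / (n%:R + 1) by rewrite divr_gt0.
have /cvgrPdist_lt/(_ _ dn) h3 := yx t.
have /cvgrPdist_le/(_ _ e1) h4 := h2 _ (KX (xK t)).
apply: filterS3 h1 h3 h4 => k h1 h3 h4.
rewrite ger0_norm ?enorm_ge0// (le_trans (enorm_le_mxnorm _))//.
have : `|g (gam k + t) (y k t) - ggam t (x t)| <= e / (m%:R + 1).
  rewrite (_ : _ - _ = (g (gam k + t) (y k t) - g (gam k + t) (x t)) +
    (g (gam k + t) (x t) - ggam t (x t))); last by rewrite addrA subrK.
  rewrite (le_trans (ler_normD _ _))// [e in leRHS]splitr mulrDl lerD//.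
    rewrite (le_trans (mxnorm_le_enorm _))//.
    apply: le_trans (h1 _ _ (yK k t) (xK t)) _.
    rewrite (le_trans (ler_norm _))// wd ?enorm_ge0//.
    apply: le_lt_trans (enorm_le_mxnorm _) _.
    move: h3; rewrite ltr_pdivlMr// => h3; rewrite distrC in h3; apply: le_lt_trans h3.
    by rewrite mulrC ler_wpM2l// lerDl.
  by rewrite distrC.
rewrite ler_pdivlMr//; apply: le_trans.
by rewrite mulrC ler_wpM2l// lerDl.
Qed.

End limiting.

(** Both sides are the increment over [a, b] of the translated primitive of g. *)
Lemma IR_shift (R : realType) (g : R -> R) (c a b : R) : a <= b -> bm g ->
  IR (fun t => g (c + t)) a b = IR g (c + a) (c + b).
Proof.
move=> ab bg; transitivity (primitive g (c + b) - primitive g (c + a)); last first.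
  by rewrite primitiveB ?lerD2l.
apply/esym.
have [_ [M gM]] := bg.
apply: (@absc_eq_IR R a b (fun t => primitive g (c + t))) => //.
- apply: (@lip_absc _ _ _ M) => s t _ st _.
  apply: le_trans (primitive_lip _ _ bg gM) _.
  by rewrite (_ : c + t - (c + s) = t - s) ?ger0_norm ?subr_ge0//; ring.
- exact: bm_shift.
have := ae_has_deriv_IR (bm_locally_integrable bg) (fun a b => @primitiveB _ g a b bg).
move=> /(ae_shift c); apply: ae_mono => t h _ e /h /nbhs_ballP[d /= d0 Bd].
apply/nbhs_ballP; exists d => //= s st.
have := Bd (c + s); rewrite (_ : c + s - (c + t) = s - t); last by ring.
by apply; rewrite /ball/= (_ : c + t - (c + s) = t - s)//; ring.
Qed.

Lemma weak_IR (R : realType) (d : nat -> R -> R) (M : R) (g : R -> R) (a b : R) :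
  (forall k, bm (d k)) -> (forall k t, `|d k t| <= M) ->
  (forall a b, a <= b -> IR (d k) a b @[k --> \oo] --> (0 : R)) -> bm g ->
  IR (fun t => g t * d k t) a b @[k --> \oo] --> (0 : R).
Proof.
move=> bd dM d0 bg.
have := weak_limit bd dM d0 (integrable_bm_indic a b bg).
apply: cvg_trans; apply: near_eq_cvg; apply: nearW => k /=.
rewrite /IR [RHS]Rintegral_mkcond; apply: eq_Rintegral => t _; rewrite patchE indicE.
by case: ifPn => tA; rewrite ?mulr1// mulr0 mul0r.
Qed.

Lemma sum_signal (R : realType) (N : nat) (s : 'I_N) (b : 'I_N -> R) :
  \sum_(i < N) (s == i)%:R * b i = b s.
Proof.
rewrite (bigD1 s)//= eqxx mul1r big1 ?addr0// => i.
by rewrite eq_sym => /negbTE ->; rewrite mul0r.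
Qed.

(** * Convex hulls and admissible subsequences *)

(** The sum is normalized because partial sums of the weights are not 1 during the induction; points
    of weight 0 are not assumed to lie in C. *)
Lemma convex_set_sum (R : realType) (M : lmodType R) (I : Type) (r : seq I) (c : I -> R)
    (v : I -> M) (C : set M) :
  convex_set C -> (forall i, 0 <= c i) -> (forall i, c i != 0 -> C (v i)) ->
  0 < \sum_(i <- r) c i -> C ((\sum_(i <- r) c i)^-1 *: \sum_(i <- r) c i *: v i).
Proof.
move=> /convex_setW cvC c0 cv; elim: r => [|i r IH]; first by rewrite big_nil ltxx.
rewrite !big_cons; set S := \sum_(j <- r) c j in IH *; set W := \sum_(j <- r) _ in IH *.
have S0 : 0 <= S by apply: sumr_ge0 => j _.
have [ci0|ci0] := eqVneq (c i) 0; first by rewrite ci0 !add0r scale0r add0r.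
have cip : 0 < c i by rewrite lt_neqAle eq_sym ci0 c0.
have [S_0|S_0] := eqVneq S 0.
  move=> _; suff -> : W = 0 by rewrite S_0 !addr0 scalerA mulVf// scale1r; exact: cv.
  rewrite /W; clear IH; elim: r @S S0 S_0 W => [|j r IH]/=; first by rewrite !big_nil.
  rewrite !big_cons => _ /eqP; rewrite paddr_eq0 ?sumr_ge0// => /andP[/eqP -> /eqP S0].
  by rewrite scale0r add0r; apply: IH => //; exact: sumr_ge0.
have Sp : 0 < S by rewrite lt_neqAle eq_sym S_0 S0.
move=> cS; have CW := IH Sp.
have l0 : 0 < c i / (c i + S) by rewrite divr_gt0.
have l1 : c i / (c i + S) < 1 by rewrite ltr_pdivrMr// mul1r ltrDl.
have := cvC (v i) (S^-1 *: W) ; rewrite !inE => /(_ (cv _ ci0) CW).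
move=> /(_ (Itv01 (ltW l0) (ltW l1)) l0 l1); rewrite /conv/= inE.
rewrite scalerDr !scalerA /unstable.onem mulrC.
suff -> : (1 - (c i + S)^-1 * c i) * S^-1 = (c i + S)^-1 by [].
have S1 : c i + S != 0 by rewrite gt_eqF.
by field; rewrite S_0 S1.
Qed.

Lemma simplex_convex_hull (R : realType) (N : nat) (A : set 'I_N) (mu : 'rV[R]_N) :
  simplex mu -> (forall i, ~ A i -> mu 0 i = 0) ->
  convex_hull [set @evec R N i | i in A] mu.
Proof.
move=> [mu0 mu1] muA C [cvC AC].
have := @convex_set_sum R _ 'I_N (index_enum 'I_N) (fun i => mu 0 i) (@evec R N) C cvC mu0.
rewrite mu1 invr1 scale1r (_ : \sum_i _ = mu); last first.
  by rewrite [RHS]row_sum_delta.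
apply=> // i mui; apply: AC; exists i => //; apply: contrapT => /muA mu_0.
by rewrite mu_0 eqxx in mui.
Qed.

Lemma limiting_function_subseq (R : realType) (n m : nat) (X : set 'rV[R]_n)
    (g g_gam : R -> 'rV[R]_n -> 'rV[R]_m) (gam : nat -> R) (p : nat -> nat) :
  (forall k, (k <= p k)%N) -> limiting_function X g gam g_gam ->
  limiting_function X g (gam \o p) g_gam.
Proof.
move=> pk [E nE H]; exists E => // xi s Xxi Es.
exact: cvg_ge_subseq pk (H xi s Xxi Es).
Qed.

Lemma pinfty_subseq (R : realType) (gam : nat -> R) (p : nat -> nat) :
  (forall k, (k <= p k)%N) -> gam k @[k --> \oo] --> +oo ->
  gam (p k) @[k --> \oo] --> +oo.
Proof.
move=> pk /cvgryPge H; apply/cvgryPge => A.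
have [m _ mA] := H A; exists m => // k /= mk; apply: mA.
exact: leq_trans mk (pk k).
Qed.

Lemma admissible_subseq (R : realType) (n m : nat) (X : set 'rV[R]_n)
    (g : R -> 'rV[R]_n -> 'rV[R]_m) (gam : nat -> R) (p : nat -> nat) :
  (forall k, (k <= p k)%N) -> admissible X g gam -> admissible X g (gam \o p).
Proof.
move=> pk [g0 gi [gg gl]]; split; first by move=> k; exact: g0.
  by exact: (pinfty_subseq pk gi).
by exists gg; exact: limiting_function_subseq.
Qed.

Lemma precompact_common (R : realType) (n m : nat) (X : set 'rV[R]_n) (I : eqType)
    (r : seq I) (g : I -> R -> 'rV[R]_n -> 'rV[R]_m) (gam : nat -> R) :
  (forall i, precompact_fun X (g i)) ->
  (forall k, 0 <= gam k) -> gam k @[k --> \oo] --> +oo ->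
  exists2 p : nat -> nat, increasing_seq p &
    forall i, i \in r -> admissible X (g i) (gam \o p).
Proof.
move=> gp g0 gi; elim: r => [|i r [p pinc pr]]; first by exists id.
have [||q qinc qi] := gp i (gam \o p).
- by move=> k; exact: g0.
- exact: (pinfty_subseq (increasing_ge pinc) gi).
exists (p \o q); first exact: increasing_comp.
move=> j; rewrite inE => /predU1P[->|jr]; first exact: qi.
exact: admissible_subseq (increasing_ge qinc) (pr j jr).
Qed.

Lemma Lambda_subseq (R : realType) (n m N : nat) (X : set 'rV[R]_n)
    (fhat : 'I_N -> R -> 'rV[R]_n -> 'rV[R]_n) (h : 'I_N -> R -> 'rV[R]_n -> 'rV[R]_m)
    (gam : nat -> R) (p : nat -> nat) :
  (forall k, (k <= p k)%N) -> Lambda X fhat h gam -> Lambda X fhat h (gam \o p).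
Proof. by move=> pk L i; have [L1 L2] := L i; split; exact: admissible_subseq. Qed.

Lemma precompact_Lambda (R : realType) (n m N : nat) (X : set 'rV[R]_n)
    (fhat : 'I_N -> R -> 'rV[R]_n -> 'rV[R]_n) (h : 'I_N -> R -> 'rV[R]_n -> 'rV[R]_m)
    (gam : nat -> R) :
  (forall i, precompact_fun X (fhat i)) -> (forall i, precompact_fun X (h i)) ->
  (forall k, 0 <= gam k) -> gam k @[k --> \oo] --> +oo ->
  exists2 p : nat -> nat, increasing_seq p & Lambda X fhat h (gam \o p).
Proof.
move=> fp hp g0 gi.
have [p pinc pf] := precompact_common (enum 'I_N) fp g0 gi.
have [||q qinc qh] := precompact_common (gam := gam \o p) (enum 'I_N) hp.
- by move=> k; exact: g0.
- exact: (pinfty_subseq (increasing_ge pinc) gi).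
exists (p \o q); first exact: increasing_comp.
move=> i; split; last by apply: qh; rewrite mem_enum.
by apply: admissible_subseq (increasing_ge qinc) (pf i _); rewrite mem_enum.
Qed.

Lemma has_deriv_rV (R : realType) (n : nat) (x : R -> 'rV[R]_n) (t : R) (v : 'rV[R]_n) :
  (forall j, has_deriv (fun s => x s 0 j) t (v 0 j)) -> has_deriv x t v.
Proof.
move=> H e e0.
have : \forall s \near t, forall j, `|x s 0 j - x t 0 j - (s - t) * v 0 j| <= e * `|s - t|.
  exact: (@filter_forall _ _ _ (nbhs t) _ (fun j => H j e e0)).
apply: filterS => s h; apply: mxnorm_le; first by rewrite mulr_ge0// ltW.
by move=> j; rewrite !mxE; exact: h.
Qed.

Lemma lip_absolutely_continuous (R : realType) (n : nat) (x : R -> 'rV[R]_n) (M a b : R) :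
  0 <= M -> (forall s t, `|x s - x t| <= M * `|s - t|) -> absolutely_continuous_on a b x.
Proof.
move=> M0 xM e e0.
have L0 : 0 < n%:R * M + 1 by rewrite ltr_wpDl// mulr_ge0.
exists (e / (n%:R * M + 1)); first by rewrite divr_gt0.
move=> k l r lr _; rewrite ltr_pdivlMr// => se; apply: le_lt_trans se.
rewrite mulrC mulr_sumr; apply: ler_sum => i _.
have [_ [lri _]] := lr i.
apply: le_trans (enorm_le_mxnorm _) _.
apply: (@le_trans _ _ (n%:R * (M * (r i - l i)))).
  by rewrite ler_wpM2l// (le_trans (xM _ _))// ger0_norm// subr_ge0.
by rewrite mulrA ler_wpM2r ?subr_ge0// lerDl.
Qed.

Lemma enorm_row1 (R : realType) (v : 'rV[R]_1) : enorm v = `|v 0 0|.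
Proof. by rewrite /enorm /dotv big_ord1 -expr2 sqrtr_sqr. Qed.

Lemma bm_switch (R : realType) (N : nat) (s : R -> 'I_N) (g : 'I_N -> R -> R) :
  (forall t, \forall r \near t^'+, s r = s t) -> (forall i, bm (g i)) ->
  bm (fun t => g (s t) t).
Proof.
move=> s_right bg.
rewrite (_ : (fun t => _) = (fun t => \sum_(i < N) (s t == i)%:R * g i t)).
  by apply: bm_sum => i; apply: bmM => //; exact: bm_signal.
by apply/funext => t; rewrite -(sum_signal (s t) (fun i => g i t)).
Qed.

Lemma has_deriv_coord (R : realType) (n : nat) (x : R -> 'rV[R]_n) (t : R) (v : 'rV[R]_n) j :
  has_deriv x t v -> has_deriv (fun s => x s 0 j) t (v 0 j).
Proof.
move=> H e e0; apply: filterS (H e e0) => s; apply: le_trans.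
by have := coord_le_mxnorm (x s - x t - (s - t) *: v) j; rewrite !mxE.
Qed.

(** * Limiting trajectories *)

(** By contradiction, the zeroing condition gives d such that |Df| <= eps where eta < d and t is
    large. Where eta >= d, the a priori bound M is at most (M / d) * eta. *)
Lemma zeroing_bound (R : realType) (n : nat) (X K : set 'rV[R]_n)
    (eta : R -> 'rV[R]_n -> R) (h : R -> 'rV[R]_n -> 'rV[R]_1)
    (Df : R -> 'rV[R]_n -> 'rV[R]_n) (e M eps : R) :
  zeroing_pair X h Df -> (forall t v, h t v = const_mx (eta t v)) ->
  (forall t xi, 0 <= t -> X xi -> 0 <= eta t xi) ->
  compact K -> K `<=` X -> 0 < e -> 0 < eps -> 0 <= M ->
  exists C T : R, 0 <= C /\ forall t v, 0 <= t -> T <= t -> K v -> e <= enorm v ->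
    `|Df t v| <= M -> `|Df t v| <= eps + C * eta t v.
Proof.
move=> zp hE eta0 cK KX e0 eps0 M0.
suff [d [T [d0 H]]] : exists d T : R, 0 < d /\ forall t v, 0 <= t -> T <= t -> K v ->
    e <= enorm v -> eta t v < d -> `|Df t v| <= eps.
  exists (M / d), T; split; first by rewrite divr_ge0// ltW.
  move=> t v t0 Tt Kv ev DM; have n0 := eta0 t v t0 (KX _ Kv).
  have [ld|dl] := ltP (eta t v) d.
    by rewrite (le_trans (H _ _ t0 Tt Kv ev ld))// lerDl mulr_ge0// divr_ge0// ltW.
  rewrite (le_trans DM)// -[leLHS]add0r lerD ?(ltW eps0)//.
  by rewrite mulrAC ler_pdivlMr// ler_wpM2l.
apply: contrapT => nH.
have /choice[tv tvP] : forall k : nat, exists tv : R * 'rV[R]_n,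
    [/\ 0 <= tv.1, k%:R <= tv.1, K tv.2, e <= enorm tv.2 &
        eta tv.1 tv.2 < k.+1%:R^-1 /\ eps < `|Df tv.1 tv.2|].
  move=> k; apply: contrapT => nk; apply: nH; exists k.+1%:R^-1, k%:R; split => //.
  move=> t v t0 kt Kv ev tv; rewrite leNgt; apply/negP => lt.
  by apply: nk; exists (t, v).
have := zp (fun k => (tv k).1) K e (fun k => (tv k).2).
have t_cvg : (tv k).1 @[k --> \oo] --> +oo.
  apply/cvgryPge => A; apply: filterS (nbhs_infty_ger A) => k Ak.
  by have [_ h1 _ _ _] := tvP k; exact: le_trans h1.
have h_cvg : h (tv k).1 (tv k).2 @[k --> \oo] --> (0 : 'rV[R]_1).
  apply: rV_cvg => j; rewrite mxE; apply/cvg0P => r r0; near=> k.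
  have [t0 _ Kv _ [lt _]] := tvP k.
  rewrite hE mxE ger0_norm; last by apply: eta0 => //; exact: KX.
  apply: le_trans (ltW lt) _; apply: ltW.
  by near: k; exact: near_infty_natSinv_lt (PosNum r0).
move=> /(_ _ t_cvg cK KX e0 _ h_cvg) H.
have /cvgrPdist_le/(_ _ eps0) : Df (tv k).1 (tv k).2 @[k --> \oo] --> (0 : 'rV[R]_n).
  by apply: H => k; have [] := tvP k.
move=> [k _ /(_ k (leqnn k))]; rewrite /= sub0r normrN.
by have [_ _ _ _ [_ lt]] := tvP k; rewrite leNgt lt.
Unshelve. all: by end_near. Qed.

Section limit.
Context (R : realType) (n N : nat) (X K : set 'rV[R]_n)
  (f fhat Df : 'I_N -> R -> 'rV[R]_n -> 'rV[R]_n)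
  (eta : 'I_N -> R -> 'rV[R]_n -> R) (h : 'I_N -> R -> 'rV[R]_n -> 'rV[R]_1)
  (chi : 'I_N -> set 'rV[R]_n) (e M : R) (wf wh : 'I_N -> R -> R).
(* Pieces of trajectories over [gam k - k, gam k + k], translated to [- k, k]: s_ k
   is the signal, y k the state, and D k and E k are Borel versions of its velocity
   and of the output. *)
Record vanishing_windows (gam : nat -> R) (s_ : nat -> R -> 'I_N) (y : nat -> R -> 'rV[R]_n)
    (D : nat -> 'I_n -> R -> R) (E : nat -> R -> R) : Prop := VanishingWindows {
  gam_ge : forall k, k%:R <= gam k ;
  s_right : forall k t, \forall s \near t^'+, s_ k s = s_ k t ;
  yK : forall k t, K (y k t) ;
  ye : forall k t, e <= enorm (y k t) ;
  yL : forall k s t, `|y k s - y k t| <= M * `|s - t| ;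
  bD : forall k j, bm (D k j) ;
  D_le : forall k j t, `|D k j t| <= M ;
  D_ae : forall k j, {ae @lebesgue_measure R, forall t : R, - k%:R <= t <= k%:R ->
    D k j t = f (s_ k t) (gam k + t) (y k t) 0 j} ;
  y_IR : forall k j a b, - k%:R <= a -> a <= b -> b <= k%:R ->
    y k b 0 j - y k a 0 j = IR (D k j) a b ;
  bE : forall k, bm (E k) ;
  E_ge0 : forall k t, 0 <= E k t ;
  E_ae : forall k, {ae @lebesgue_measure R, forall t : R, - k%:R <= t <= k%:R ->
    E k t = eta (s_ k t) (gam k + t) (y k t)} ;
  E_IR : forall k, IR (E k) (- k%:R) k%:R <= k.+1%:R^-1 ;
  y_chi : forall k t, - k%:R <= t <= k%:R -> chi (s_ k t) (y k t) }.

Context (cK : compact K) (KX : K `<=` X) (e0 : 0 < e) (M0 : 0 <= M).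
Context (f_dec : forall i t xi, 0 <= t -> X xi -> f i t xi = fhat i t xi + Df i t xi).
Context (hE : forall i t xi, h i t xi = const_mx (eta i t xi)).
Context (eta_ge0 : forall i t xi, 0 <= t -> X xi -> 0 <= eta i t xi).
Context (h_zeroing : forall i, zeroing_pair X (h i) (Df i)).
Context (chi_closed : forall i, closed (chi i)).
Context (f_le : forall i, {ae @lebesgue_measure R, forall t : R, 0 <= t ->
  forall xi, K xi -> enorm (f i t xi) <= M}).
Context (fhat_meas : forall i, measurable_in_t (@nonneg_reals R) X (fhat i)).
Context (fhat_le : forall i, {ae @lebesgue_measure R, forall t : R, 0 <= t ->
  forall xi, K xi -> enorm (fhat i t xi) <= M}).
Context (wf_K : forall i, classK (wf i)).
Context (fhat_cont : forall i, {ae @lebesgue_measure R, forall t : R, 0 <= t ->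
  forall xi zeta, K xi -> K zeta ->
  enorm (fhat i t xi - fhat i t zeta) <= wf i (enorm (xi - zeta))}).
Context (h_meas : forall i, measurable_in_t (@nonneg_reals R) X (h i)).
Context (h_le : forall i, {ae @lebesgue_measure R, forall t : R, 0 <= t ->
  forall xi, K xi -> enorm (h i t xi) <= M}).
Context (wh_K : forall i, classK (wh i)).
Context (h_cont : forall i, {ae @lebesgue_measure R, forall t : R, 0 <= t ->
  forall xi zeta, K xi -> K zeta ->
  enorm (h i t xi - h i t zeta) <= wh i (enorm (xi - zeta))}).
Arguments h_zeroing : clear implicits.
Arguments wf_K : clear implicits.
Arguments wh_K : clear implicits.
Arguments fhat_cont : clear implicits.
Arguments h_cont : clear implicits.
Arguments f_le : clear implicits.
Arguments fhat_le : clear implicits.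

Section limits.
Context (gam : nat -> R) (s_ : nat -> R -> 'I_N) (y : nat -> R -> 'rV[R]_n)
  (D : nat -> 'I_n -> R -> R) (E : nat -> R -> R) (W : vanishing_windows gam s_ y D E).
Context (f_gam : 'I_N -> R -> 'rV[R]_n -> 'rV[R]_n) (h_gam : 'I_N -> R -> 'rV[R]_n -> 'rV[R]_1)
  (x : R -> 'rV[R]_n) (U : R -> 'rV[R]_N).
Context (f_lim : forall i, limiting_function X (fhat i) gam (f_gam i)).
Context (h_lim : forall i, limiting_function X (h i) gam (h_gam i)).
Context (yx : forall t, y k t @[k --> \oo] --> x t).
Arguments f_lim : clear implicits.
Arguments h_lim : clear implicits.
Arguments yx : clear implicits.
Context (bU : forall i, bm (fun t => U t 0 i)) (U_ge0 : forall t i, 0 <= U t 0 i).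
Context (U_sum : forall t, \sum_(i < N) U t 0 i = 1).
Context (U_IR : forall i a b, a <= b ->
  IR (fun t => (s_ k t == i)%:R) a b @[k --> \oo] --> IR (fun t => U t 0 i) a b).

Let gam_cvg : gam k @[k --> \oo] --> +oo.
Proof.
apply/cvgryPge => A; apply: filterS (nbhs_infty_ger A) => k Ak; exact: le_trans (gam_ge W k).
Qed.

Lemma limit_K t : K (x t).
Proof.
have clK : closed K by apply: compact_closed => //; exact: norm_hausdorff.
apply: contrapT => nK.
have : \forall k \near \oo, (~` K) (y k t).
  by apply: (yx t); apply: open_nbhs_nbhs; split => //; exact: closed_openC.
by move=> [k _ /(_ k (leqnn k))]; apply; exact: (yK W).
Qed.

Lemma limit_lip s t : `|x s - x t| <= M * `|s - t|.
Proof.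
have h1 : `|y k s - y k t| @[k --> \oo] --> `|x s - x t|.
  by apply: cvg_norm; apply: cvgB; exact: yx.
by apply: cvg_le_near h1 (cvg_cst (M * `|s - t|)) _; apply: nearW => k; exact: (yL W).
Qed.

Lemma limit_continuous : continuous x.
Proof. exact: lip_continuous limit_lip. Qed.

Lemma U_le1 t i : U t 0 i <= 1.
Proof. by rewrite -(U_sum t) (bigD1 i)//= lerDl sumr_ge0. Qed.

Let w (k : nat) (i : 'I_N) (t : R) : R := (s_ k t == i)%:R.

Let bw k i : bm (w k i).
Proof. exact: bm_signal (s_right W k). Qed.

Let w01 k i t : 0 <= w k i t <= 1.
Proof. by rewrite /w; case: (_ == _); rewrite /= ?lexx ?ler01. Qed.

Lemma limit_weak i g a b : bm g ->
  IR (fun t => w k i t * g t) a b @[k --> \oo] --> IR (fun t => U t 0 i * g t) a b.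
Proof.
move=> bg.
have hd : forall a b, a <= b -> IR (fun t => w k i t - U t 0 i) a b @[k --> \oo] --> (0 : R).
  move=> c d cd; under eq_fun do rewrite IRB//.
  rewrite -(subrr (IR (fun t => U t 0 i) c d)); apply: cvgB; last exact: cvg_cst.
  exact: U_IR.
have := @weak_IR R (fun k t => w k i t - U t 0 i) 2 g a b.
move=> /(_ (fun k => bmB (bw k i) (bU i))) H.
have {}H : IR (fun t => g t * (w k i t - U t 0 i)) a b @[k --> \oo] --> (0 : R).
  apply: H => //.
  move=> k t; have /andP[w0 w1] := w01 k i t; have u1 := U_le1 t i; have u0 := U_ge0 t i.
  by rewrite (le_trans (ler_normB _ _))// !ger0_norm//; lra.
rewrite -[X in _ --> X]add0r.
have EI k : IR (fun t => w k i t * g t) a b =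
    IR (fun t => g t * (w k i t - U t 0 i)) a b + IR (fun t => U t 0 i * g t) a b.
  rewrite -IRD; [|by apply: bmM => //; exact: bmB|exact: bmM].
  by congr (IR _ a b); apply/funext => t; ring.
under eq_fun do rewrite EI.
by apply: cvgD => //; exact: cvg_cst.
Qed.

Lemma limit_weak_sum (g : 'I_N -> R -> R) a b : a <= b -> (forall i, bm (g i)) ->
  IR (fun t => g (s_ k t) t) a b @[k --> \oo] -->
  IR (fun t => \sum_(i < N) U t 0 i * g i t) a b.
Proof.
move=> ab bg.
rewrite IR_sum//; last by move=> i; exact: bmM.
have EI k : IR (fun t => g (s_ k t) t) a b = \sum_(i < N) IR (fun t => w k i t * g i t) a b.
  rewrite -IR_sum//; last by move=> i; exact: bmM.
  by congr (IR _ a b); apply/funext => t; rewrite -(sum_signal (s_ k t) (fun i => g i t)).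
under eq_fun do rewrite EI.
apply: cvg_big => [|i _]; first exact: add_continuous.
exact: limit_weak.
Qed.

Lemma E_IR_sub a b : a <= b -> \forall k \near \oo, IR (E k) a b <= k.+1%:R^-1.
Proof.
move=> ab; near=> k.
have ka : - k%:R <= a.
  by rewrite lerNl; near: k; exact: nbhs_infty_ger.
have kb : b <= k%:R by near: k; exact: nbhs_infty_ger.
apply: le_trans (E_IR W k).
rewrite (IR_split ka (le_trans ab kb) (bE W k)) (IR_split ab kb (bE W k)).
by rewrite ler_wpDl ?(IR_ge0 _ _ (E_ge0 W k))// lerDl (IR_ge0 _ _ (E_ge0 W k)).
Unshelve. all: by end_near. Qed.

(* Bounded convergence applied to the positive part of |r_k| - eps - C E_k. *)
Lemma IR_small (r : nat -> R -> R) (B a b : R) : a <= b -> (forall k, bm (r k)) ->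
  (forall k t, `|r k t| <= B) ->
  (forall eps : R, 0 < eps -> exists2 C : R, 0 <= C &
    {ae @lebesgue_measure R, forall t : R, a <= t <= b ->
      forall d : R, 0 < d -> \forall k \near \oo, `|r k t| <= eps + C * E k t + d}) ->
  IR (r k) a b @[k --> \oo] --> (0 : R).
Proof.
move=> ab br rB H; apply/cvg0P => c c0.
have ba : 0 < b - a + 1 by rewrite ltr_wpDl// subr_ge0.
have eps0 : 0 < c / 3 / (b - a + 1) by rewrite !divr_gt0.
have [C C0 HC] := H _ eps0.
set eps : R := c / 3 / (b - a + 1) in eps0 HC.
pose r' k t : R := Num.max (`|r k t| - eps - C * E k t) 0.
have bdom k : bm (fun t => eps + C * E k t).
  by apply: bmD; [exact: bm_cst|exact: bmM (bm_cst C) (bE W k)].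
have br' k : bm (r' k).
  apply: bm_max; last exact: bm_cst.
  apply: bmB; first by apply: bmB; [exact: bm_norm|exact: bm_cst].
  exact: bmM (bm_cst C) (bE W k).
have B0 : 0 <= B by rewrite (le_trans _ (rB 0%N 0)).
have CE k t : 0 <= C * E k t by rewrite mulr_ge0// (E_ge0 W).
have r'0 k t : 0 <= r' k t by rewrite le_max lexx orbT.
have r'_cvg : IR (r' k) a b @[k --> \oo] --> (0 : R).
  have : IR (r' k) a b @[k --> \oo] --> IR (fun=> 0 : R) a b.
    apply: (@IR_cvg _ _ _ B).
    - by move=> k; case: (br' k).
    - exact: measurable_cst.
    - move=> k t; rewrite ger0_norm// ge_max B0 andbT.
      by have := rB k t; have := CE k t; lra.
    apply: ae_mono HC => t h1 /h1{}h1; apply/cvg0P => d d0.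
    apply: filterS (h1 d d0) => k h2; rewrite ger0_norm// ge_max (ltW d0) andbT; lra.
  by rewrite IR_cst// mul0r.
have c3 : 0 < c / 3 by rewrite divr_gt0.
have c3C : 0 < c / 3 / (C + 1) by rewrite divr_gt0// ltr_wpDl.
have /cvg0P/(_ _ c3) h1 := r'_cvg.
have h2 := near_infty_natSinv_lt (PosNum c3C).
apply: filterS3 h1 h2 (E_IR_sub ab) => k h1 h2 h3.
apply: le_trans (IR_norm _ _ (br k)) _.
apply: (@le_trans _ _ (IR (fun t => (eps + C * E k t) + r' k t) a b)).
  apply: IR_le; [exact: bm_norm|exact: bmD|].
  by move=> t _; rewrite -lerBlDl opprD addrA le_max lexx.
rewrite IRD// IRD; [|exact: bm_cst|exact: bmM (bm_cst C) (bE W k)].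
rewrite (IRZ _ _ _ (bE W k))// IR_cst//.
have h4 : IR (r' k) a b <= c / 3 by rewrite (le_trans (ler_norm _)).
have h5 : C * IR (E k) a b <= c / 3.
  apply: (@le_trans _ _ (C * (c / 3 / (C + 1)))).
    by rewrite ler_wpM2l// (le_trans h3)// ltW.
  rewrite mulrA ler_pdivrMr ?ltr_wpDl// mulrC ler_wpM2l ?(ltW c3)//; lra.
have h6 : eps * (b - a) <= c / 3.
  rewrite /eps mulrAC ler_pdivrMr//; rewrite ler_wpM2l ?(ltW c3)//; lra.
lra.
Qed.

Lemma window_eventually (a b : R) : \forall k \near \oo, - k%:R <= a /\ b <= k%:R.
Proof.
near=> k; split; first by rewrite lerNl; near: k; exact: nbhs_infty_ger.
by near: k; exact: nbhs_infty_ger.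
Unshelve. all: by end_near. Qed.

Lemma limit_dynamics j (F : 'I_N -> R -> R) :
  (forall i, bm (F i)) -> (forall i t, `|F i t| <= M) ->
  (forall i, {ae @lebesgue_measure R, forall t : R, f_gam i t (x t) 0 j = F i t}) ->
  forall a b, a <= b -> x b 0 j - x a 0 j = IR (fun t => \sum_(i < N) U t 0 i * F i t) a b.
Proof.
move=> bF F_le FE a b ab.
pose r k t := D k j t - F (s_ k t) t.
have br k : bm (r k) by exact: bmB (bD W k j) (bm_switch (s_right W k) bF).
have r_cvg : IR (r k) a b @[k --> \oo] --> (0 : R).
  apply: (@IR_small r (M + M)) => //.
    by move=> k t; rewrite (le_trans (ler_normB _ _))// lerD// (D_le W).
  move=> eps eps0.
  have /choice[CT CTP] : forall i, exists CT : R * R, 0 <= CT.1 /\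
      forall t v, 0 <= t -> CT.2 <= t -> K v -> e <= enorm v ->
      `|Df i t v| <= M + M -> `|Df i t v| <= eps + CT.1 * eta i t v.
    move=> i; have [C [T [C0 CP]]] := zeroing_bound (h_zeroing i) (hE i) (@eta_ge0 i) cK KX e0 eps0 (addr_ge0 M0 M0).
    by exists (C, T).
  (* The active mode at time t changes with k, so the constants of all modes are added up. *)
  exists (\sum_i (CT i).1); first by apply: sumr_ge0 => i _; have [] := CTP i.
  have a1 := ae_all (fun i => limiting_curve KX (wf_K i) (fhat_cont i) gam_cvg (f_lim i) (yK W) limit_K yx).
  have a2 : {ae @lebesgue_measure R, forall t : R, forall i, \forall k \near \oo,
      forall xi, K xi -> enorm (f i (gam k + t) xi) <= M /\ enorm (fhat i (gam k + t) xi) <= M}.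
    apply: ae_all => i; apply: (@ae_shifts _ gam gam_cvg (fun t => forall xi, K xi ->
      enorm (f i t xi) <= M /\ enorm (fhat i t xi) <= M)).
    apply: ae_mono (ae_and (f_le i) (fhat_le i)) => t [h1 h2] t0 xi Kxi.
    by split; [exact: h1|exact: h2].
  have a3 := ae_all (fun k => ae_and (D_ae W k j) (E_ae W k)).
  have a4 := ae_all FE.
  apply: ae_mono (ae_and (ae_and a1 a2) (ae_and a3 a4)) => t [[b1 b2] [b3 b4]] tab d d0.
  have c1 : \forall k \near \oo, forall i,
      `|enorm (fhat i (gam k + t) (y k t) - f_gam i t (x t))| <= d.
    by apply: filter_forall => i; have /cvg0P/(_ _ d0) := b1 i.
  have c2 : \forall k \near \oo, forall i, forall xi, K xi ->
      enorm (f i (gam k + t) xi) <= M /\ enorm (fhat i (gam k + t) xi) <= M.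
    exact: filter_forall.
  have c3 : \forall k \near \oo, forall i, (CT i).2 <= gam k + t.
    apply: filter_forall => i.
    have /cvgryPge/(_ ((CT i).2 - t)) := gam_cvg; apply: filterS => k; lra.
  have c4 := shift_ge0 t gam_cvg.
  have c5 : \forall k \near \oo, - k%:R <= a /\ b <= k%:R := window_eventually a b.
  apply: filterS2 (filterI c1 c2) (filterI (filterI c3 c4) c5) => k [k1 k2] [[k3 k4] [ka kb]].
  have tk : - k%:R <= t <= k%:R.
    by case/andP : tab => t1 t2; rewrite (le_trans ka t1) (le_trans t2 kb).
  have [/(_ tk) Dt /(_ tk) Et] := b3 k.
  rewrite /r Dt Et; set i := s_ k t.
  have Ky := yK W k t; have Xy := KX Ky.
  have [fM fhM] := k2 i _ Ky.
  have dec := f_dec i k4 Xy.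
  have DfE : Df i (gam k + t) (y k t) = f i (gam k + t) (y k t) - fhat i (gam k + t) (y k t).
    by rewrite dec addrAC subrr add0r.
  have DfM : `|Df i (gam k + t) (y k t)| <= M + M.
    rewrite DfE (le_trans (ler_normB _ _))// lerD//.
      exact: le_trans (mxnorm_le_enorm _) fM.
    exact: le_trans (mxnorm_le_enorm _) fhM.
  have [CT0 /(_ _ _ k4 (k3 i) Ky (ye W k t) DfM) Dfle] := CTP i.
  have eta0 := eta_ge0 i k4 Xy.
  have CTle : (CT i).1 * eta i (gam k + t) (y k t) <= (\sum_i (CT i).1) * eta i (gam k + t) (y k t).
    rewrite ler_wpM2r// (bigD1 i)//= lerDl sumr_ge0// => i' _.
    by have [] := CTP i'.
  have := k1 i; rewrite ger0_norm ?enorm_ge0// => k1i.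
  have := coord_le_enorm (fhat i (gam k + t) (y k t) - f_gam i t (x t)) j.
  rewrite !mxE b4 => k1j.
  have := coord_le_mxnorm (Df i (gam k + t) (y k t)) j => Dfj.
  rewrite dec mxE (_ : _ + _ - _ = Df i (gam k + t) (y k t) 0 j +
    (fhat i (gam k + t) (y k t) 0 j - F i t)); last by ring.
  rewrite (le_trans (ler_normD _ _))// lerD//; last exact: le_trans k1i.
  by rewrite (le_trans Dfj)// (le_trans Dfle)// lerD2l.
have xj t : y k t 0 j @[k --> \oo] --> x t 0 j.
  exact: (cvg_comp _ _ (yx t) (@coord_continuous R 1 n 0 j (x t))).
have x_cvg : y k b 0 j - y k a 0 j @[k --> \oo] --> x b 0 j - x a 0 j.
  by apply: cvgB; exact: xj.
have := cvgD r_cvg (limit_weak_sum ab bF); rewrite add0r => IR_lim.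
apply: (cvg_unique (@Rhausdorff R) x_cvg).
apply: cvg_trans (IR_lim _); apply: near_eq_cvg.
case: (window_eventually a b) => m _ wm; exists m => // k /wm[ka kb] /=.
transitivity (IR (r k) a b + IR (fun t => F (s_ k t) t) a b) => //.
rewrite -IRD//; last exact: (bm_switch (s_right W k)).
rewrite (y_IR W j ka ab kb); congr (IR _ a b).
by apply/funext => t; rewrite subrK.
Qed.

Lemma limit_output (H : 'I_N -> R -> R) :
  (forall i, bm (H i)) -> (forall i t, 0 <= H i t <= M) ->
  (forall i, {ae @lebesgue_measure R, forall t : R, enorm (h_gam i t (x t)) = H i t}) ->
  {ae @lebesgue_measure R, forall t : R, \sum_(i < N) U t 0 i * H i t = 0}.
Proof.
move=> bH H_le HE; apply: IR_zero_ae.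
  by apply: bm_sum => i; exact: bmM.
move=> a b ab; have H_cvg := limit_weak_sum ab bH.
apply: (cvg_unique (@Rhausdorff R) H_cvg).
apply: (@IR_small (fun k t => H (s_ k t) t) M) => //.
- by move=> k; exact: (bm_switch (s_right W k)).
- by move=> k t; have /andP[h1 h2] := H_le (s_ k t) t; rewrite ger0_norm.
(* C = 1 because E k is the output itself, which differs from H by at most d for large k. *)
move=> eps eps0; exists 1 => //.
have a1 := ae_all (fun i => limiting_curve KX (wh_K i) (h_cont i) gam_cvg (h_lim i) (yK W) limit_K yx).
apply: ae_mono (ae_and a1 (ae_and (ae_all (E_ae W)) (ae_all HE))) => t [b1 [b2 b3]] tab d d0.
have c1 : \forall k \near \oo, forall i,
    `|enorm (h i (gam k + t) (y k t) - h_gam i t (x t))| <= d.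
  by apply: filter_forall => i; have /cvg0P/(_ _ d0) := b1 i.
have c4 := shift_ge0 t gam_cvg.
apply: filterS3 c1 c4 (window_eventually a b) => k k1 k4 [ka kb].
have tk : - k%:R <= t <= k%:R.
  by case/andP : tab => t1 t2; rewrite (le_trans ka t1) (le_trans t2 kb).
rewrite (b2 k tk); set i := s_ k t.
have Ky := yK W k t; have Xy := KX Ky.
have eta0 := eta_ge0 i k4 Xy.
have := k1 i; rewrite ger0_norm ?enorm_ge0// => k1i.
have := coord_le_enorm (h i (gam k + t) (y k t) - h_gam i t (x t)) 0.
rewrite !mxE hE mxE => k1j.
have /andP[Ht0 _] := H_le i t.
rewrite ger0_norm// -b3 enorm_row1.
rewrite mul1r; have := ler_normB (eta i (gam k + t) (y k t))
  (eta i (gam k + t) (y k t) - h_gam i t (x t) 0 0).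
rewrite opprB addrCA subrr addr0 (ger0_norm eta0) => q1; apply: (le_trans q1).
rewrite -hE in k1j; have k1d := le_trans k1j k1i; rewrite [eps + _]addrC -addrA lerD2l (le_trans k1d)// lerDr ltW//.
Qed.

(** If x t is outside the closed set [chi i], so is y k t for large k, hence mode i is inactive at t
    by invariance. Bounded convergence carries this over to the weak limit U. *)
Lemma limit_modes i : {ae @lebesgue_measure R, forall t : R, ~ chi i (x t) -> U t 0 i = 0}.
Proof.
pose O : set R := [set t | ~ chi i (x t)].
have oO : open O.
  have -> : O = x @^-1` (~` chi i) by [].
  apply: open_comp; first by move=> t _; exact: limit_continuous.
  exact: closed_openC.
have mO := open_measurable oO.
have bO : bm (\1_O : R -> R) by exact: bm_indic.
have : {ae @lebesgue_measure R, forall t : R, U t 0 i * \1_O t = 0}.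
  apply: IR_zero_ae; first exact: bmM.
  move=> a b ab; have L := @limit_weak i _ a b bO; apply: (cvg_unique (@Rhausdorff R) L).
  have : IR (fun t => w k i t * \1_O t) a b @[k --> \oo] --> IR (fun=> 0 : R) a b.
    apply: (@IR_cvg _ _ _ 1).
    - by move=> k; case: (bmM (bw k i) bO).
    - exact: measurable_cst.
    - move=> k t; rewrite normrM mulr_ile1//.
        by have /andP[h1 h2] := w01 k i t; rewrite ger0_norm.
      by rewrite indicE; case: (_ \in _); rewrite ?normr1 ?normr0.
    apply: aeW => t _; rewrite indicE.
    have [tO|tO] := boolP (t \in O); last by under eq_fun do rewrite mulr0; exact: cvg_cst.
    have Ot : ~ chi i (x t) by move: tO; rewrite inE.
    have nchi : \forall k \near \oo, ~ chi i (y k t).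
      have : nbhs (x t) (~` chi i).
        by apply: open_nbhs_nbhs; split => //; exact: closed_openC.
      by move=> /(yx t).
    apply: cvg_near_cst; apply: filterS2 nchi (window_eventually t t) => k k1 [ka kb].
    rewrite mulr1 /w; case: eqP => // sE; exfalso; apply: k1.
    by rewrite -sE; apply: (y_chi W); rewrite ka.
  by rewrite IR_cst// mul0r.
apply: ae_mono => t + nchi; rewrite indicE mem_set//= mulr1.
by [].
Qed.

End limits.

(** The window of index p k contains [-k, k], and 1 / (p k + 1) <= 1 / (k + 1). *)
Lemma vanishing_windows_subseq gam s_ y D E (p : nat -> nat) : (forall k, (k <= p k)%N) ->
  vanishing_windows gam s_ y D E ->
  vanishing_windows (gam \o p) (s_ \o p) (y \o p) (D \o p) (E \o p).
Proof.
move=> pk W.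
have pkR k : (k%:R : R) <= (p k)%:R by rewrite ler_nat.
have sub k (t : R) : - k%:R <= t <= k%:R -> - (p k)%:R <= t <= (p k)%:R.
  move=> /andP[t1 t2]; rewrite (le_trans t2 (pkR k)) andbT; apply: le_trans t1.
  by rewrite lerN2.
split.
- by move=> k; apply: le_trans (gam_ge W (p k)); exact: pkR.
- by move=> k; exact: (s_right W).
- by move=> k; exact: (yK W).
- by move=> k; exact: (ye W).
- by move=> k; exact: (yL W).
- by move=> k; exact: (bD W).
- by move=> k; exact: (D_le W).
- by move=> k j; apply: ae_mono (D_ae W (p k) j) => t h1 /sub/h1.
- move=> k j a b ka ab kb; apply: (y_IR W) => //.
    by apply: le_trans ka; rewrite lerN2.
  exact: le_trans kb (pkR k).
- by move=> k; exact: (bE W).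
- by move=> k; exact: (E_ge0 W).
- by move=> k; apply: ae_mono (E_ae W (p k)) => t h1 /sub/h1.
- move=> k; have E0 := E_ge0 W (p k); have bEk := bE W (p k).
  have k0 : (- k%:R : R) <= k%:R by rewrite ge0_cp.
  have k1 : (- (p k)%:R : R) <= - k%:R by rewrite lerN2.
  apply: (@le_trans _ _ (IR (E (p k)) (- (p k)%:R) (p k)%:R)).
    rewrite (IR_split k1 (le_trans k0 (pkR k)) bEk) (IR_split k0 (pkR k) bEk).
    by rewrite ler_wpDl ?(IR_ge0 _ _ E0)// lerDl (IR_ge0 _ _ E0).
  by apply: le_trans (E_IR W (p k)) _; rewrite lef_pV2 ?posrE// ler_nat ltnS.
- by move=> k t /sub; exact: (y_chi W).
Qed.

(** The coordinates of the states and the primitives of the mode indicators form one equi-Lipschitz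
    family, with constant M + 1; [ndlip_density] turns the limits of the primitives into U. *)
Lemma extract_limit gam s_ y D E : vanishing_windows gam s_ y D E ->
  exists2 p : nat -> nat, increasing_seq p &
  exists (x : R -> 'rV[R]_n) (U : R -> 'rV[R]_N),
  [/\ forall t, y (p k) t @[k --> \oo] --> x t,
      forall i, bm (fun t => U t 0 i), forall t i, 0 <= U t 0 i,
      forall t, \sum_(i < N) U t 0 i = 1 &
      forall i a b, a <= b ->
        IR (fun t => (s_ (p k) t == i)%:R) a b @[k --> \oo] --> IR (fun t => U t 0 i) a b].
Proof.
move=> W.
pose w k i (t : R) : R := (s_ k t == i)%:R.
have bw k i : bm (w k i) by exact: bm_signal (s_right W k).
have w01 k i t : 0 <= w k i t <= 1 by rewrite /w; case: (_ == _); rewrite /= ?lexx ?ler01.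
pose G k (c : 'I_n + 'I_N) (t : R) : R :=
  match c with inl j => y k t 0 j | inr i => primitive (w k i) t end.
have [B yB] : exists B : R, forall k t, `|y k t| <= B.
  have [B [_ BP]] := compact_bounded cK.
  by exists (B + 1) => k t; apply: (BP (B + 1)); [rewrite ltrDl|exact: (yK W)].
have B0 : 0 <= B by rewrite (le_trans (normr_ge0 _) (yB 0%N 0)).
have [|k [j|i]|p pinc [Ginf GP]] := @lip_subseq R _ G (M + 1) B.
- move=> k [j|i] s t /=.
    have := coord_le_mxnorm (y k s - y k t) j; rewrite !mxE => /le_trans; apply.
    by rewrite (le_trans (yL W k s t))// ler_wpM2r// lerDl.
  apply: le_trans (primitive_lip _ _ (bw k i) (M := 1) _) _.
    by move=> r; have /andP[w0 w1] := w01 k i r; rewrite ger0_norm.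
  by rewrite ler_wpM2r// lerDr.
- exact: le_trans (coord_le_mxnorm _ _) (yB k 0).
- by rewrite /= /primitive !IR_pt subrr normr0.
exists p => //.
have w_lim i a b : a <= b ->
    IR (w (p k) i) a b @[k --> \oo] --> Ginf (inr i) b - Ginf (inr i) a.
  move=> ab; under eq_fun do rewrite -(primitiveB (bw _ _) ab).
  by apply: cvgB; [exact: (GP (inr i) b)|exact: (GP (inr i) a)].
have /choice[u uP] : forall i, exists u : R -> R, [/\ bm u, forall t, 0 <= u t <= 1 &
    forall a b, a <= b -> Ginf (inr i) b - Ginf (inr i) a = IR u a b].
  move=> i; apply: ndlip_density => s t st.
  have l0 := w_lim i s t st; apply/andP; split.
    apply: cvg_le_near (cvg_cst 0) l0 _; apply: nearW => k; apply: IR_ge0 => r.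
    by case/andP : (w01 (p k) i r).
  apply: cvg_le_near l0 (cvg_cst (t - s)) _; apply: nearW => k.
  rewrite -[leRHS]mul1r -IR_cst//; apply: IR_le => //; first exact: bm_cst.
  by move=> r _; case/andP : (w01 (p k) i r).
have u_lim i a b : a <= b -> IR (w (p k) i) a b @[k --> \oo] --> IR (u i) a b.
  by move=> ab; have [_ _ <-//] := uP i; exact: w_lim.
have bu i : bm (u i) by case: (uP i).
pose S t := \sum_(i < N) u i t.
have bS : bm S by apply: bm_sum.
have S1 : {ae @lebesgue_measure R, forall t : R, S t = 1}.
  have : {ae @lebesgue_measure R, forall t : R, S t - 1 = 0}.
    apply: IR_zero_ae; first by apply: bmB => //; exact: bm_cst.
    move=> a b ab; rewrite IRB//; last exact: bm_cst.
    rewrite IR_sum// IR_cst// mul1r; apply/eqP; rewrite subr_eq0; apply/eqP.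
    have SL : \sum_(i < N) IR (w (p k) i) a b @[k --> \oo] --> \sum_(i < N) IR (u i) a b.
      by apply: cvg_big => [|i _]; [exact: add_continuous|exact: u_lim].
    apply: (cvg_unique (@Rhausdorff R) SL).
    apply: cvg_near_cst; apply: nearW => k.
    rewrite -IR_sum// -[RHS]mul1r -IR_cst//; congr (IR _ a b); apply/funext => t.
    by rewrite -(sum_signal (s_ (p k) t) (fun=> 1)); apply: eq_bigr => i _; rewrite mulr1.
  by apply: ae_mono => t /eqP; rewrite subr_eq0 => /eqP.
pose i0 := s_ 0%N 0.
pose x (t : R) : 'rV[R]_n := \row_j Ginf (inl j) t.
pose U (t : R) : 'rV[R]_N := \row_i (if S t == 1 then u i t else (i == i0)%:R).
have bU i : bm (fun t => U t 0 i).
  pose A := S @^-1` [set 1].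
  have mA : measurable A.
    by rewrite -[A]setTI; case: bS => mS _; exact: mS.
  rewrite (_ : (fun t => _) = fun t => \1_A t * u i t + (1 - \1_A t) * (i == i0)%:R).
    apply: bmD; first by apply: bmM => //; exact: bm_indic.
    apply: bmM; last exact: bm_cst.
    by apply: bmB; [exact: bm_cst|exact: bm_indic].
  apply/funext => t; rewrite mxE indicE; case: eqVneq => [St|/eqP St].
    by rewrite mem_set//= mul1r subrr mul0r addr0.
  by rewrite memNset//= mul0r subr0 mul1r add0r.
exists x, U; split => //.
- move=> t; apply: rV_cvg => j; rewrite mxE; exact: (GP (inl j) t).
- move=> t i; rewrite mxE; case: ifP => // _.
  by have [_ /(_ t)/andP[]] := uP i.
- move=> t; under eq_bigr do rewrite mxE.
  case: (eqVneq (S t) 1) => [//|_].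
  by rewrite (bigD1 i0)//= eqxx big1 ?addr0// => i /negbTE ->; rewrite mulr0n.
move=> i a b ab; rewrite (_ : IR (fun t => U t 0 i) a b = IR (u i) a b).
  exact: u_lim.
apply: IR_eq_ae => //; apply: ae_mono S1 => t St _.
by rewrite mxE St eqxx.
Qed.

Lemma WZSD_no_vanishing_windows (T : set (trajectory R n N)) (sig : nat -> R -> 'I_N)
    gam s_ y D E :
  (forall i, precompact_fun X (fhat i)) -> (forall i, precompact_fun X (h i)) ->
  limiting_systems_WZSD X chi T fhat h -> (forall k, signals_of T (sig k)) ->
  (forall k t, s_ k t = sig k (gam k + t)) -> vanishing_windows gam s_ y D E -> False.
Proof.
move=> fp hp WZ sT sE W0.
have g0 k : 0 <= gam k by exact: le_trans (gam_ge W0 k).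
have gi : gam k @[k --> \oo] --> +oo.
  apply/cvgryPge => A; apply: filterS (nbhs_infty_ger A) => k Ak.
  exact: le_trans Ak (gam_ge W0 k).
have [p pinc L1] := precompact_Lambda fp hp g0 gi.
have W1 := vanishing_windows_subseq (increasing_ge pinc) W0.
have [q qinc [x [U [yx bU U0 U1 UIR]]]] := extract_limit W1.
have W := vanishing_windows_subseq (increasing_ge qinc) W1.
have L := Lambda_subseq (increasing_ge qinc) L1.
have /choice[f_gam f_lim] : forall i, exists g, limiting_function X (fhat i) ((gam \o p) \o q) g.
  by move=> i; have [[_ _]] := L i.
have /choice[h_gam h_lim] : forall i, exists g, limiting_function X (h i) ((gam \o p) \o q) g.
  by move=> i; have [_ [_ _]] := L i.
have xK := limit_K W yx.
have xL := limit_lip W yx.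
have xc := limit_continuous W yx.
have gi2 : (gam \o p \o q) k @[k --> \oo] --> +oo.
  have pq := increasing_ge (increasing_comp pinc qinc).
  exact: (pinfty_subseq pq gi).
(* F and, below, H are bounded Borel versions of the limiting functions along x, so that they can be
   integrated against U. *)
have /choice[F FP] : forall ij : 'I_N * 'I_n, exists b : R -> R,
    [/\ bm b, forall t, `|b t| <= M & {ae @lebesgue_measure R, forall t : R, setT t ->
      f_gam ij.1 t (x t) 0 ij.2 = b t}].
  move=> [i j] /=; apply: (@comp_bm_version R n n K setT (f_gam i) M x j M0) => //.
  - by move=> xi Kxi; exact: (limiting_version (fhat_meas i) gi2 (f_lim i) j (KX Kxi)).
  - exact: (limiting_continuous KX (wf_K i) (fhat_cont i) gi2 (f_lim i)).
  - exact: (limiting_le KX (fhat_le i) gi2 (f_lim i)).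
have /choice[H HP] : forall i : 'I_N, exists b : R -> R,
    [/\ bm b, forall t, `|b t| <= M & {ae @lebesgue_measure R, forall t : R, setT t ->
      h_gam i t (x t) 0 0 = b t}].
  move=> i; apply: (@comp_bm_version R n 1 K setT (h_gam i) M x 0 M0) => //.
  - by move=> xi Kxi; exact: (limiting_version (h_meas i) gi2 (h_lim i) 0 (KX Kxi)).
  - exact: (limiting_continuous KX (wh_K i) (h_cont i) gi2 (h_lim i)).
  - exact: (limiting_le KX (h_le i) gi2 (h_lim i)).
have bF i j : bm (F (i, j)) by case: (FP (i, j)).
have U_le i t : U t 0 i <= 1 by exact: U_le1.
have dyn j : {ae @lebesgue_measure R, forall t : R,
    has_deriv (fun s => x s 0 j) t (\sum_(i < N) U t 0 i * F (i, j) t)}.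
  apply: ae_has_deriv_IR.
    by apply: bm_locally_integrable; apply: bm_sum => i; exact: bmM.
  apply: (limit_dynamics W f_lim yx bU U0 U1 UIR) => //.
    by move=> i t; case: (FP (i, j)).
  by move=> i; have [_ _] := FP (i, j); apply: ae_mono => t /(_ Logic.I).
have out : {ae @lebesgue_measure R, forall t : R, \sum_(i < N) U t 0 i * `|H i t| = 0}.
  apply: (limit_output W h_lim yx bU U0 U1 UIR).
  - by move=> i; apply: bm_norm; case: (HP i).
  - by move=> i t; rewrite normr_ge0/=; have [_ -> _] := HP i.
  - by move=> i; have [_ _] := HP i; apply: ae_mono => t /(_ Logic.I) <-; rewrite enorm_row1.
have modesU := ae_all (limit_modes W yx bU U0 U1 UIR).
have CT : complete_trajectory X chi T f_gam h_gam x U.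
  split.
  - by move=> t; apply: KX; exact: xK.
  - by move=> a b ab _; exact: lip_absolutely_continuous xL.
  - split.
      split; last by move=> t; split => // i; exact: U0.
      by move=> i; apply: borel_completed_measurable_fun; case: (bU i).
    exists ((gam \o p) \o q), ((sig \o p) \o q); split => //.
      by move=> k; exact: sT.
    have evecE k t i : @evec R N (((sig \o p) \o q) k (((gam \o p) \o q) k + t)) 0 i =
        (((s_ \o p) \o q) k t == i)%:R.
      by rewrite /evec mxE eqxx/= sE eq_sym.
    apply: weak_cvg_of_IR => //.
    + move=> k i; under eq_fun do rewrite evecE.
      exact: bm_signal (s_right W k).
    + by move=> k i t; rewrite evecE; case: (_ == _); rewrite ?normr1 ?normr0.
    + by move=> i t; rewrite ger0_norm.
    + move=> i a b ab; under eq_fun do under [fun t => _]eq_fun do rewrite evecE.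
      exact: UIR.
  have dyn' := ae_all dyn; have FE := ae_all (fun ij => let: And3 _ _ h := FP ij in h).
  have HE := ae_all (fun i => let: And3 _ _ h := HP i in h).
  apply: ae_mono (ae_and (ae_and dyn' FE) (ae_and (ae_and out HE) modesU))
    => t [[t1 t2] [[t3 t4] t5]]; split.
  - by apply: simplex_convex_hull => //; split => // i; exact: U0.
  - apply/is_derive_has_deriv; apply: has_deriv_rV => j.
    rewrite summxE (_ : \sum_i _ = \sum_(i < N) U t 0 i * F (i, j) t)//.
    by apply: eq_bigr => i _; rewrite mxE (t2 (i, j)).
  - rewrite -[RHS]t3; apply: eq_bigr => i _.
    by rewrite enorm_row1 t4// mulrC.
have := WZ _ L _ _ f_lim h_lim x U CT.
have KK : exists K : set 'rV[R]_n, [/\ compact K, K `<=` X & forall t, K (x t)] by exists K.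
move=> /(_ KK) inf0.
have : e <= inf (range (fun t => enorm (x t))).
  apply: lb_le_inf; first by exists (enorm (x 0)); exists 0.
  move=> _ [t _ <-].
  have ex : enorm (y (p (q k)) t) @[k --> \oo] --> enorm (x t).
    exact: (cvg_comp _ _ (yx t) (@enorm_continuous R n (x t))).
  by apply: cvg_le_near (cvg_cst e) ex _; apply: nearW => k; exact: (ye W).
by rewrite inf0 leNgt e0.
Qed.

End limit.

(** * Trajectories of the switched system *)

(** Pigeonhole: m consecutive pieces with integrals above r would give a total above B. *)
Lemma small_piece (R : realType) (g : R -> R) (a b d B r : R) (m : nat) :
  bm g -> (forall t, 0 <= g t) -> 0 <= d -> a + d * m%:R <= b -> IR g a b <= B ->
  B < r * m%:R ->
  exists2 l : nat, (l < m)%N & IR g (a + d * l%:R) (a + d * l.+1%:R) <= r.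
Proof.
move=> bg g0 d0 mb gB Bm; apply: contrapT => nl.
have step l : d * l%:R <= d * l.+1%:R by rewrite ler_wpM2l// ler_nat.
have pos l : 0 <= d * l%:R by rewrite mulr_ge0.
have : forall l, (l <= m)%N -> r * l%:R <= IR g a (a + d * l%:R).
  elim=> [_|l IH lm]; first by rewrite !mulr0 addr0 IR_pt.
  have al : a <= a + d * l%:R by rewrite lerDl.
  have ll : a + d * l%:R <= a + d * l.+1%:R by rewrite lerD2l.
  rewrite (IR_split al ll bg) -[in leLHS]natr1 mulrDr mulr1 lerD ?IH ?(ltnW lm)//.
  by rewrite leNgt; apply/negP => /ltW lr; apply: nl; exists l.
move=> /(_ m (leqnn m)); apply/negP; rewrite -ltNge; apply: le_lt_trans Bm.
have am : a <= a + d * m%:R by rewrite lerDl.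
by apply: le_trans gB; rewrite (IR_split am mb bg) lerDl IR_ge0.
Qed.

Section trajectories.
Context (R : realType) (n N : nat) (X : set 'rV[R]_n)
    (f : 'I_N -> R -> 'rV[R]_n -> 'rV[R]_n)
    (T : set (trajectory R n N)) (chi : 'I_N -> set 'rV[R]_n)
    (V Vt : 'I_N -> R -> 'rV[R]_n -> R) (Vx : 'I_N -> R -> 'rV[R]_n -> 'rV[R]_n)
    (phi1 phi2 : R -> R)
    (eta : 'I_N -> R -> 'rV[R]_n -> R) (hout : 'I_N -> R -> 'rV[R]_n -> 'rV[R]_1).
Context (f_car : forall i, caratheodory_conditions X (f i)).
Context (T_traj : forall tau, T tau -> is_trajectory X f tau).
Context (T_inv : invariant_family T chi).
Context (phi1_K : classK phi1) (phi2_K : classK phi2).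
Context (V_bounds : forall i t xi, 0 <= t -> chi i xi -> X xi ->
  phi1 (enorm xi) <= V i t xi /\ V i t xi <= phi2 (enorm xi)).
Context (V_C1 : forall i, continuously_differentiable X (V i) (Vt i) (Vx i)).
Context (eta_ge0 : forall i t xi, 0 <= t -> X xi -> 0 <= eta i t xi).
Context (hE : forall i t xi, hout i t xi = const_mx (eta i t xi)).
Context (h_meas : forall i, measurable_in_t (@nonneg_reals R) X (hout i)).
Context (h_cont : forall i, continuous_in_xi (@nonneg_reals R) X (hout i)).
Context (V_decr : forall i t xi, 0 <= t -> chi i xi -> X xi ->
  Vt i t xi + dotv (Vx i t xi) (f i t xi) <= - eta i t xi).
Context (V_switch : forall tau, T tau -> forall i t s,
  t0 tau <= t -> t < s -> (s%:E < tf tau)%E ->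
  signal tau t = i -> signal tau s = i ->
  V i s (state tau s) <= V i t (state tau t)).

Definition window (tau : trajectory R n N) (a b : R) : Prop :=
  [/\ T tau, t0 tau <= a, a <= b & (b%:E < tf tau)%E].

Lemma window_dom tau a b t : window tau a b -> a <= t <= b -> traj_dom tau t.
Proof.
move=> [_ ta _ btf] /andP[at_ tb]; split; first exact: le_trans at_.
by apply: le_lt_trans btf; rewrite lee_fin.
Qed.

Lemma sub_window tau a b c d : a <= c -> c <= d -> d <= b ->
  window tau a b -> window tau c d.
Proof.
move=> ac cd db [Ttau ta ab btf]; split => //; first exact: le_trans ac.
by apply: le_lt_trans btf; rewrite lee_fin.
Qed.

Lemma window_ge0 tau a b : window tau a b -> 0 <= a.
Proof. by move=> [/T_traj[_ [t00 _ _ _ _] _] ta _ _]; exact: le_trans ta. Qed.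

Lemma window_time_ge0 tau a b t : window tau a b -> a <= t <= b -> 0 <= t.
Proof. by move=> w /andP[at_ _]; exact: le_trans (window_ge0 w) at_. Qed.

Lemma window_ac tau a b : window tau a b ->
  absolutely_continuous_on a b (state tau).
Proof.
move=> w; have [/T_traj[_ [_ _ _ xac _] _] _ ab _] := w.
by apply: xac => // t /=; rewrite in_itv/= => tab; exact: window_dom tab.
Qed.

Lemma window_X tau a b t : window tau a b -> a <= t <= b -> X (state tau t).
Proof.
move=> w tab; have [/T_traj[_ [_ _ xX _ _] _] _ _ _] := w.
by apply: xX; exact: window_dom tab.
Qed.

Lemma window_chi tau a b t : window tau a b -> a <= t <= b ->
  chi (signal tau t) (state tau t).
Proof. by move=> w tab; case: (w) => Tt _ _ _; apply: T_inv => //; exact: window_dom tab. Qed.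

Lemma classK_le (phi : R -> R) (r s : R) : classK phi -> 0 <= r -> r <= s -> phi r <= phi s.
Proof. by move=> [_ inc _] r0; rewrite le_eqVlt => /predU1P[->//|/(inc _ _ r0)/ltW]. Qed.

Definition modes (sigma : R -> 'I_N) (s t : R) : {set 'I_N} :=
  [set i : 'I_N | `[< exists q, s <= q <= t /\ sigma q = i >]].

(* Between two times in the same mode V decreases, so the bound r_j is only
   degraded to r_(j+1) when a mode is entered for the first time. *)
Lemma stability_chain (r : nat -> R) tau s t : window tau s t -> 0 <= r 0%N ->
  (forall j, r j <= r j.+1) -> (forall j, (j < N)%N -> phi2 (r j) < phi1 (r j.+1)) ->
  enorm (state tau s) <= r 0%N -> enorm (state tau t) <= r N.
Proof.
move=> w r0 rS rphi xs.
have rge j : 0 <= r j by elim: j => // j; move=> /le_trans; apply.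
have r0le j : r 0%N <= r j by elim: j => // j; move=> /le_trans; apply.
suff main : forall j, (j <= N)%N -> forall q, s <= q <= t ->
    (#|modes (signal tau) s q| <= j)%N -> enorm (state tau q) <= r j.
  apply: main => //; last by rewrite (leq_trans (max_card _))// card_ord.
  by case: w => _ _ -> _; rewrite lexx.
elim=> [_ q /andP[sq qt]|j ih jN q /andP[sq qt] cardq].
  rewrite leqn0 cards_eq0 => /eqP/setP/(_ (signal tau q)).
  by rewrite !inE => /asboolP[]; exists q; rewrite sq lexx.
have step p : s <= p <= q -> signal tau p = signal tau q ->
    enorm (state tau p) <= r j -> enorm (state tau q) <= r j.+1.
  move=> /andP[sp]; rewrite le_eqVlt => /predU1P[->|pq] Ep xp.
    exact: le_trans (rS j).
  have [Tt ts _ _] := w.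
  have tabq : s <= q <= t by rewrite sq.
  have tabp : s <= p <= t by rewrite sp (le_trans (ltW pq)).
  have [_ qtf] := window_dom w tabq.
  have := V_switch Tt (le_trans ts sp) pq qtf Ep erefl.
  have p0 : 0 <= p := le_trans (window_ge0 w) sp.
  have q0 : 0 <= q := le_trans (window_ge0 w) sq.
  have [+ _] := V_bounds q0 (window_chi w tabq) (window_X w tabq).
  have chip : chi (signal tau q) (state tau p) by rewrite -Ep; exact: window_chi tabp.
  have [_] := V_bounds p0 chip (window_X w tabp).
  have h := classK_le phi2_K (enorm_ge0 _) xp.
  have h2 := rphi j jN.
  rewrite leNgt => h3 h4 h5; rewrite leNgt; apply/negP => /ltW.
  move=> /(classK_le phi1_K (rge _)) h6; lra.
(* p = inf A is the first time the mode of q is active; right-continuity of the signal puts p in A.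
   Before p one mode fewer has been visited, so the bound r_j holds there, and continuity of the
   state carries it to p. *)
pose A : set R := [set p : R | s <= p <= q /\ signal tau p = signal tau q].
have Aq : A q by split => //; rewrite sq lexx.
have Alb : lbound A s by move=> p [/andP[]].
have infA : has_inf A by split; [exists q|exists s].
have [p pE] : exists p : R, p = inf A by exists (inf A).
have sp : s <= p by rewrite pE; apply: lb_le_inf => //; exists q.
have pq : p <= q by rewrite pE; apply: ge_inf => //; exists s.
have Ep : signal tau p = signal tau q.
  have [/T_traj[[_ sr] _ _] _ _ _] := w.
  have /nbhs_ballP[d /= d0 Bd] := sr p.
  have [p' Ap' p'd] : exists2 p' : R, A p' & p' < p + d.
    by rewrite pE; exact: inf_adherent.
  have pp' : p <= p' by rewrite pE; apply: ge_inf => //; exists s.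
  have [_ <-] := Ap'.
  move: pp'; rewrite le_eqVlt => /predU1P[->//|pp'].
  by apply/esym/Bd => //; rewrite /ball/= ltr_distlC; apply/andP; split; lra.
apply: (step p) => //; first by rewrite sp.
move: sp; rewrite le_eqVlt => /predU1P[<-|sp]; first exact: le_trans (r0le j).
have before p' : s <= p' -> p' < p -> enorm (state tau p') <= r j.
  move=> sp' p'p; apply: ih; first exact: ltnW.
    by rewrite sp' (le_trans (ltW p'p))// (le_trans pq).
  rewrite -ltnS (leq_trans _ cardq)//; apply: proper_card; apply/properP; split.
    apply/fintype.subsetP => i; rewrite !inE => -[c [/andP[sc cp'] <-]].
    exists c; split => //.
    by rewrite sc (le_trans cp')// (le_trans (ltW p'p)).
  exists (signal tau q); first by rewrite inE; apply/asboolP; exists q; rewrite sq lexx.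
  rewrite inE; apply/asboolP => -[c [/andP[sc cp'] Ec]].
  have : p <= c.
    rewrite pE; apply: ge_inf; first by exists s.
    by split => //; rewrite sc (le_trans cp')// (le_trans (ltW p'p)).
  by lra.
have wsq := sub_window (lexx s) sq qt w.
have xc := ac_clamp_continuous sq (window_ac wsq).
rewrite leNgt; apply/negP => h.
have : \forall p' \near p, r j < enorm ((state tau \o clamp s q) p').
  apply: (@cvgr_gt _ _ (nbhs p) _ (fun p' => enorm ((state tau \o clamp s q) p'))
    (enorm ((state tau \o clamp s q) p))).
    by apply: continuous_comp; [exact: xc|exact: enorm_continuous].
  by rewrite /= clampE// (ltW sp).
move=> /nbhs_ballP[d /= d0 Bd].
pose p' := Num.max s (p - d / 2).
have [sp' p'p p'd] : [/\ s <= p', p' < p & p - d < p'].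
  by rewrite /p'; case: (leP s (p - d / 2)) => h1; split; lra.
have := Bd p'; rewrite /= clampE; last by rewrite sp' (le_trans (ltW p'p)).
move=> /(_ _); have := before _ sp' p'p.
move=> h1 h2; have := h2 (ltac:(by rewrite /ball/= ltr_distlC; apply/andP; split; lra)).
by rewrite ltNge h1.
Qed.

Lemma window_deriv tau a b : window tau a b ->
  {ae @lebesgue_measure R, forall t : R, a < t < b ->
    has_deriv (state tau \o clamp a b) t (f (signal tau t) t (state tau t))}.
Proof.
move=> w; have [/T_traj[_ [_ _ _ _ dx] _] _ ab _] := w.
apply: ae_mono dx => t dx tab.
have tab' : a <= t <= b by move/andP : tab => [h1 h2]; rewrite !ltW.
have /is_derive_has_deriv dxt := dx (window_dom w tab').
have near_ab : \forall s \near t, s \in `]a, b[ by apply: near_in_itvoo; rewrite in_itv.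
move=> e e0; apply: filterS2 near_ab (dxt e e0) => s; rewrite in_itv/= => /andP[s1 s2].
by rewrite !clampE// !ltW.
Qed.

Context (K : set 'rV[R]_n) (M : R).
Context (KX : K `<=` X) (M0 : 0 <= M).
Context (f_le : forall i, {ae @lebesgue_measure R, forall t : R, 0 <= t ->
  forall xi, K xi -> enorm (f i t xi) <= M}).

Lemma window_lip tau a b : window tau a b ->
  (forall t, a <= t <= b -> K (state tau t)) ->
  forall s t, `|(state tau \o clamp a b) s - (state tau \o clamp a b) t| <= M * `|s - t|.
Proof.
move=> w wK s t; have [_ _ ab _] := w.
have fM := ae_all f_le.
have key s' t' : a <= s' -> s' <= t' -> t' <= b ->
    `|state tau t' - state tau s'| <= M * (t' - s').
  move=> as_ st tb; apply: mxnorm_le; first by rewrite mulr_ge0// subr_ge0.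
  move=> j; rewrite !mxE.
  have w' := sub_window as_ st tb w.
  apply: (@absc_lip _ s' t' M (fun t => state tau t 0 j)) => //.
    exact: (ac_absc j (window_ac w')).
  apply: ae_mono (ae_and (window_deriv w') fM) => r [h1 h2] rst.
  have rab' : a <= r <= b.
    by move/andP : rst => [/ltW h3 /ltW h4]; rewrite (le_trans as_ h3) (le_trans h4 tb).
  have r0 : 0 <= r by rewrite (le_trans (window_ge0 w))//; case/andP : rab'.
  exists (f (signal tau r) r (state tau r) 0 j).
    by rewrite (le_trans (coord_le_enorm _ _))// h2//; exact: wK.
  have near_st : \forall s \near r, s \in `]s', t'[ by apply: near_in_itvoo; rewrite in_itv.
  move=> e e0; apply: filterS2 near_st (h1 rst e e0) => q; rewrite in_itv/= => /andP[q1 q2].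
  move/andP : rst => [r1 r2].
  have cq : clamp s' t' q = q by rewrite clampE// !ltW.
  have cr : clamp s' t' r = r by rewrite clampE// !ltW.
  rewrite /= cq cr => hq; apply: le_trans hq.
  by have := coord_le_mxnorm (state tau q - state tau r -
    (q - r) *: f (signal tau r) r (state tau r)) j; rewrite !mxE.
have c1 := clamp_itv s ab; have c2 := clamp_itv t ab.
have [/andP[s1 s2] /andP[t1 t2]] := (c1, c2).
apply: le_trans (_ : _ <= M * `|clamp a b s - clamp a b t|) _; last first.
  by rewrite ler_wpM2l// clamp_dist.
have [h|/ltW h] := leP (clamp a b t) (clamp a b s).
  by rewrite (ger0_norm (_ : 0 <= clamp a b s - clamp a b t)) ?subr_ge0//; exact: key.
rewrite distrC (distrC (clamp a b s)).
by rewrite (ger0_norm (_ : 0 <= clamp a b t - clamp a b s)) ?subr_ge0//; exact: key.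
Qed.

(** Along the clamped curve V i is Lipschitz and has derivative at most - eta almost everywhere, so
    [absc_le_IR] applies. The signal may already have left mode i at q. *)
Lemma mode_decrease tau p q i (g : R -> R) : window tau p q ->
  (forall t, p <= t <= q -> K (state tau t)) ->
  (forall t, p <= t < q -> signal tau t = i) -> bm g ->
  {ae @lebesgue_measure R, forall t : R, p <= t <= q -> g t = eta i t (state tau t)} ->
  V i q (state tau q) - V i p (state tau p) <= - IR g p q.
Proof.
move=> w wK sig bg gE; have [_ _ pq _] := w.
pose y := state tau \o clamp p q.
have yc : continuous y := ac_clamp_continuous pq (window_ac w).
have yX s : X (y s) by exact: (window_X w (clamp_itv s pq)).
have yL := window_lip w wK.
have p0 := window_ge0 w.
have cl0 s : 0 <= clamp p q s by rewrite (le_trans p0)//; case/andP : (clamp_itv s pq).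
have cc := clamp_continuous pq.
pose Phi (s : R) := V i (clamp p q s) (y s).
have cq : clamp p q q = q by rewrite clampE// pq lexx.
have cp : clamp p q p = p by rewrite clampE// pq lexx.
have -> : V i q (state tau q) - V i p (state tau p) = Phi q - Phi p.
  by rewrite /Phi /y/= cq cp.
have [_ Vtc Vxc] := V_C1 i.
pose c (s : R) : R * 'rV[R]_n := (clamp p q s, y s).
have cc' : continuous c by move=> s; exact: (cvg_pair (cc s) (yc s)).
have Dc s : (@nonneg_reals R `*` X) (c s) by split; [exact: cl0|exact: yX].
have vt : continuous (fun s => Vt i (clamp p q s) (y s)) :=
  continuous_within_curve Vtc cc' Dc.
have vx : continuous (fun s => Vx i (clamp p q s) (y s)) :=
  continuous_within_curve Vxc cc' Dc.
have nvx : continuous (fun s => `|Vx i (clamp p q s) (y s)|).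
  by move=> s; apply: (cvg_norm (vx s)).
have [A A0 vtA] := continuous_bounded_itv pq vt.
have [B B0 vxB] := continuous_bounded_itv pq nvx.
pose C : R := A + n%:R * B * M + 1 + n%:R * M.
have Phi_lip s t : p <= s -> s <= t -> t <= q -> `|Phi t - Phi s| <= C * (t - s).
  move=> ps st tq; apply: lip_of_local => // r /andP[sr rt].
  have h := C1_curve_lip r (V_C1 i) cc yc cl0 yX M0 (fun s r => clamp_dist s r pq) yL.
  apply: filterS h => r' h' _; apply: le_trans h' _; rewrite ler_wpM2r// /C.
  have rpq : p <= r <= q by rewrite (le_trans ps sr) (le_trans rt tq).
  rewrite !lerD//; first exact: vtA.
  rewrite ler_wpM2r// ler_wpM2l//.
  by have := vxB r rpq; rewrite normr_id.
suff : Phi q - Phi p <= IR (fun t => - 1 * g t) p q by rewrite IRZ// mulN1r.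
apply: absc_le_IR => //; first exact: lip_absc Phi_lip.
  by apply: bmM => //; exact: bm_cst.
apply: ae_mono (ae_and (window_deriv w) gE) => t [h1 h2] tpq.
have [t1 t2] := andP tpq.
have tpq' : p <= t <= q by rewrite !ltW.
have thid : \forall s \near t, clamp p q s = s.
  have : \forall s \near t, s \in `]p, q[ by apply: near_in_itvoo; rewrite in_itv.
  by apply: filterS => s; rewrite in_itv/= => /andP[s1 s2]; rewrite clampE// !ltW.
have := C1_curve_deriv (V_C1 i) cc yc cl0 yX M0 yL thid (h1 tpq).
apply: has_deriv_upper; rewrite mulN1r h2// /y/= clampE//.
have st : signal tau t = i by apply: sig; rewrite (ltW t1).
rewrite st; apply: V_decr.
- exact: le_trans (ltW t1).
- by rewrite -st; exact: (window_chi w tpq').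
- exact: (window_X w tpq').
Qed.

(* The jumps of V i between two visits of mode i only help. *)
Lemma mode_integral tau a b i (g : R -> R) (B : R) : window tau a b ->
  (forall t, a <= t <= b -> K (state tau t)) -> bm g -> (forall t, 0 <= g t) ->
  {ae @lebesgue_measure R, forall t : R, a <= t <= b -> g t = eta i t (state tau t)} ->
  (forall t, a <= t <= b -> signal tau t = i -> 0 <= V i t (state tau t) <= B) -> 0 <= B ->
  IR (fun t => (signal tau t == i)%:R * g t) a b <= B.
Proof.
move=> w wK bg g0 gE VB B0; have [Ttau ta ab btf] := w.
have [[_ sright] _ _] := T_traj Ttau.
have bw : bm (fun t => (signal tau t == i)%:R * g t) by apply: bmM => //; exact: bm_signal.
(* The range [b', B'] is quantified inside Q so that it can be split: if m is the infimum of V i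
   over the visits of mode i before s, then V i lies in [m, B'] before s and, by [V_switch], in
   [b', m] after it. *)
pose Q (r s : R) := forall B' b', b' <= B' ->
  (forall q, r <= q < s -> signal tau q = i -> b' <= V i q (state tau q) <= B') ->
  IR (fun t => (signal tau t == i)%:R * g t) r s <= B' - b'.
suff /(_ B 0 B0) : Q a b.
  rewrite subr0; apply => q /andP[aq qb]; apply: VB; by rewrite aq ltW.
have Qadd r s t : a <= r -> r <= s -> s <= t -> t <= b -> Q r s -> Q s t -> Q r t.
  move=> ar rs st tb Qrs Qst B' b' bB h; rewrite (IR_split rs st bw).
  pose A : set R := [set V i q (state tau q) | q in [set q : R | r <= q < s /\ signal tau q = i]].
  have [A0|Ane] := pselect (A = set0).
    have h1 : IR (fun t => (signal tau t == i)%:R * g t) r s <= 0 - 0.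
      apply: Qrs => // q rqs sq; exfalso.
      have : A (V i q (state tau q)) by exists q.
      by rewrite A0.
    have h2 : IR (fun t => (signal tau t == i)%:R * g t) s t <= B' - b'.
      by apply: Qst => // q /andP[sq qt]; apply: h; rewrite (le_trans rs sq).
    lra.
  have {Ane} Ane : A !=set0 by apply/set0P/eqP.
  have Alb : has_lbound A.
    exists b' => _ [q [/andP[rq qs] sq] <-].
    by have /andP[] := h q (ltac:(by rewrite rq (lt_le_trans qs st))) sq.
  have [m mE] : exists m : R, m = inf A by exists (inf A).
  have bm' : b' <= m.
    rewrite mE; apply: lb_le_inf => // _ [q [/andP[rq qs] sq] <-].
    by have /andP[] := h q (ltac:(by rewrite rq (lt_le_trans qs st))) sq.
  have mA q : r <= q < s -> signal tau q = i -> m <= V i q (state tau q).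
    by move=> rqs sq; rewrite mE; apply: ge_inf => //; exists q.
  have mB : m <= B'.
    have [_ [q [/andP[rq qs] sq] _]] := Ane.
    apply: le_trans (mA q _ sq) _; first by rewrite rq.
    by have /andP[] := h q (ltac:(by rewrite rq (lt_le_trans qs st))) sq.
  have h1 : IR (fun t => (signal tau t == i)%:R * g t) r s <= B' - m.
    apply: Qrs => // q /andP[rq qs] sq; rewrite mA ?rq//=.
    by have /andP[] := h q (ltac:(by rewrite rq (lt_le_trans qs st))) sq.
  have h2 : IR (fun t => (signal tau t == i)%:R * g t) s t <= m - b'.
    apply: Qst => // q /andP[sq qt] sigq.
    have /andP[-> _] /= := h q (ltac:(by rewrite (le_trans rs sq) qt)) sigq.
    rewrite mE; apply: lb_le_inf => // _ [q' [/andP[rq' q's] sq'] <-].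
    apply: V_switch => //.
    - by rewrite (le_trans ta)// (le_trans ar).
    - exact: lt_le_trans sq.
    - by apply: le_lt_trans btf; rewrite lee_fin (le_trans (ltW qt)).
  lra.
have [_ [Mg gM]] := bg.
have Qcst r s k : a <= r -> r <= s -> s <= b ->
    (forall q, r <= q < s -> signal tau q = k) -> Q r s.
  move=> ar rs sb sigk B' b' bB h.
  have ns : {ae @lebesgue_measure R, forall t : R, t != s}.
    by exists [set s]; split => //; [exact: lebesgue_measure_set1|move=> t /= /negP; rewrite negbK => /eqP].
  have [ki|kNi] := eqVneq k i; last first.
    rewrite (@IR_eq_ae _ _ (fun=> 0))//; [|exact: bm_cst|].
      by rewrite IR_cst// mul0r subr_ge0.
    apply: ae_mono ns => t ts /andP[rt ts'].
    by rewrite (sigk t) ?(negbTE kNi) ?mul0r// rt lt_neqAle ts.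
  have EI q : r <= q -> q <= s ->
      IR (fun t => (signal tau t == i)%:R * g t) r q = IR g r q.
    move=> rq qs; apply: IR_eq_ae => //; apply: ae_mono ns => t ts /andP[rt tq].
    by rewrite (sigk t) ?ki ?eqxx ?mul1r// rt lt_neqAle ts (le_trans tq).
  rewrite (EI _ rs (lexx _)).
  move: (rs); rewrite le_eqVlt => /predU1P[<-|rs']; first by rewrite IR_pt subr_ge0.
  have Mg0 : 0 <= Mg by rewrite (le_trans _ (gM 0)).
  apply/ler_addgt0Pr => e e0.
  have Mg1 : 0 < Mg + 1 by lra.
  have eM : 0 < e / (Mg + 1) by rewrite divr_gt0.
  pose q := Num.max r (s - e / (Mg + 1)).
  have [rq qs sq] : [/\ r <= q, q < s & s - q <= e / (Mg + 1)].
    by rewrite /q; case: (leP r (s - e / (Mg + 1))) => h1; split; lra.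
  rewrite (IR_split rq (ltW qs) bg); apply: lerD.
    have aq := le_trans ar rq; have qb := le_trans (ltW qs) sb.
    have w' := sub_window ar rq qb w.
    have := @mode_decrease tau r q i g w'.
    have h1 := h r (ltac:(by rewrite lexx)) (ltac:(by rewrite sigk// lexx)).
    have h2 := h q (ltac:(by rewrite rq)) (ltac:(by rewrite sigk// rq)).
    move=> /(_ _ _ bg) h3.
    have : V i q (state tau q) - V i r (state tau r) <= - IR g r q.
      apply: h3.
      - by move=> t /andP[rt tq]; apply: wK; rewrite (le_trans ar rt) (le_trans tq qb).
      - by move=> t /andP[rt tq]; rewrite sigk// rt (lt_trans tq).
      - apply: ae_mono gE => t h4 /andP[rt tq]; apply: h4.
        by rewrite (le_trans ar rt) (le_trans tq qb).
    by move/andP : h1 => [_ ?]; move/andP : h2 => [? _]; lra.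
  apply: le_trans (ler_norm _) _.
  apply: le_trans (IR_bound (ltW qs) bg (fun t _ => gM t)) _.
  move: sq; rewrite ler_pdivlMr//; have : 0 <= s - q by rewrite subr_ge0 ltW.
  by nra.
apply: cousin => // p ap pb.
have [sw _ _] := T_traj Ttau.
have [d1 d10 left] := signal_left p sw.
have /nbhs_ballP[d2 /= d20 right] := sright p.
exists (Num.min d1 d2); first by rewrite lt_min d10.
move=> r s ar rp ps sb; rewrite lt_min => /andP[sr1 sr2].
apply: (Qadd r p s) => //.
  apply: (Qcst _ _ (signal tau r)) => //.
  by move=> q /andP[rq qp]; apply/esym; apply: left => //; lra.
apply: (Qcst _ _ (signal tau p)) => //.
move=> q /andP[]; rewrite le_eqVlt => /predU1P[->//|pq] qs.
by apply: right => //; rewrite /ball/= ltr_distlC; apply/andP; split; lra.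
Qed.

Context (e C : R) (C0 : 0 <= C).
Context (h_le : forall i, {ae @lebesgue_measure R, forall t : R, 0 <= t ->
  forall xi, K xi -> enorm (hout i t xi) <= M}).
Context (V_le : forall i t xi, 0 <= t -> chi i xi -> K xi -> 0 <= V i t xi <= C).

Lemma window_version (m : nat) (g : 'I_N -> R -> 'rV[R]_n -> 'rV[R]_m) j tau a b :
  (forall i, measurable_in_t (@nonneg_reals R) X (g i)) ->
  (forall i, continuous_in_xi (@nonneg_reals R) X (g i)) ->
  (forall i, {ae @lebesgue_measure R, forall t : R, 0 <= t ->
    forall xi, K xi -> enorm (g i t xi) <= M}) ->
  window tau a b -> (forall t, a <= t <= b -> K (state tau t)) ->
  exists d : R -> R, [/\ bm d, forall t, `|d t| <= M &
    {ae @lebesgue_measure R, forall t : R, a <= t <= b ->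
      d t = g (signal tau t) t (state tau t) 0 j}].
Proof.
move=> g_meas g_cont g_le w wK; have [Ttau ta ab btf] := w.
have [[_ sright] _ _] := T_traj Ttau.
pose y := state tau \o clamp a b.
have yK s : K (y s) by apply: wK; exact: clamp_itv.
have yc : continuous y := ac_clamp_continuous ab (window_ac w).
have /choice[c cP] : forall i, exists c : R -> R, [/\ bm c, forall t, `|c t| <= M &
    {ae @lebesgue_measure R, forall t : R, nonneg_reals t -> g i t (y t) 0 j = c t}].
  move=> i; apply: (@comp_bm_version R n m K (@nonneg_reals R) (g i) M y j M0) => //.
  - move=> xi Kxi.
    exact: (lebesgue_measurable_version j (@measurable_nonneg_reals R) (g_meas i xi (KX Kxi))).
  - by apply: ae_mono (g_cont i) => t gt /gt; exact: continuous_subspaceW.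
exists (fun t => c (signal tau t) t); split.
- by apply: bm_switch => // i; case: (cP i).
- by move=> t; case: (cP (signal tau t)).
apply: ae_mono (ae_all (fun i => let: And3 _ _ q := cP i in q)) => t cE tab.
rewrite -cE; first by rewrite /y/= clampE.
exact: window_time_ge0 w tab.
Qed.

(** The map p covers both the output in the active mode (p = id) and that of a fixed mode (p
    constant). *)
Lemma output_version (p : 'I_N -> 'I_N) tau a b :
  window tau a b -> (forall t, a <= t <= b -> K (state tau t)) ->
  exists g : R -> R, [/\ bm g, forall t, 0 <= g t &
    {ae @lebesgue_measure R, forall t : R, a <= t <= b ->
      g t = eta (p (signal tau t)) t (state tau t)}].
Proof.
move=> w wK.
have [d [bd _ dE]] := window_version 0 (fun i => h_meas (p i)) (fun i => h_cont (p i))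
  (fun i => h_le (p i)) w wK.
exists (fun t => `|d t|); split; [exact: bm_norm|by []|].
apply: ae_mono dE => t dE tab; rewrite (dE tab) hE mxE ger0_norm//.
by apply: eta_ge0; [exact: window_time_ge0 w tab|exact: window_X w tab].
Qed.

Lemma output_integral tau a b (g : R -> R) : window tau a b ->
  (forall t, a <= t <= b -> K (state tau t)) -> bm g -> (forall t, 0 <= g t) ->
  {ae @lebesgue_measure R, forall t : R, a <= t <= b ->
    g t = eta (signal tau t) t (state tau t)} ->
  IR g a b <= N%:R * C.
Proof.
move=> w wK bg g0 gE; have [Ttau ta ab btf] := w.
have [[_ sright] _ _] := T_traj Ttau.
have bw i : bm (fun t => (signal tau t == i)%:R * g t).
  by apply: bmM => //; exact: bm_signal.
have -> : IR g a b = \sum_(i < N) IR (fun t => (signal tau t == i)%:R * g t) a b.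
  rewrite -IR_sum//; congr (IR _ a b); apply/funext => t.
  by rewrite (sum_signal (signal tau t) (fun=> g t)).
apply: (@le_trans _ _ (\sum_(i < N) C)); last first.
  by rewrite sumr_const card_ord mulr_natl.
apply: ler_sum => i _.
have wVi t : a <= t <= b -> signal tau t = i -> 0 <= V i t (state tau t) <= C.
  move=> tab sE; apply: V_le; last exact: wK.
    exact: window_time_ge0 w tab.
  by rewrite -sE; exact: (window_chi w).
(* [mode_integral] expects a version of eta i at all times, while g follows the active mode; the two
   agree while mode i is active. *)
have [d [bd d0 dE]] := output_version (fun=> i) w wK.
rewrite (_ : IR _ a b = IR (fun t => (signal tau t == i)%:R * d t) a b).
  exact: (mode_integral w wK).
apply: IR_eq_ae => //; first by apply: bmM bd; exact: bm_signal.
apply: ae_mono (ae_and gE dE) => t [gE' dE'] tab; rewrite (gE' tab) (dE' tab).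
by have [->|_] := eqVneq (signal tau t) i; last by rewrite !mul0r.
Qed.

(** Among m pieces of length 2 * k, with m > N * C * (k + 1), one has integral at most 1 / (k + 1).
    The bound is stated for every version g, so that c can be chosen before a version is fixed. *)
Lemma small_window (k m : nat) tau a b : window tau a b ->
  (forall t, a <= t <= b -> K (state tau t)) ->
  N%:R * C * k.+1%:R < m%:R -> k%:R *+ 2 * m%:R <= b - a ->
  exists c : R, [/\ a <= c - k%:R, c + k%:R <= b & forall g : R -> R,
    bm g -> (forall t, 0 <= g t) ->
    {ae @lebesgue_measure R, forall t : R, c - k%:R <= t <= c + k%:R ->
      g t = eta (signal tau t) t (state tau t)} ->
    IR g (c - k%:R) (c + k%:R) <= k.+1%:R^-1].
Proof.
move=> w wK NCm mab.
have [d [bd d0 d_eta]] := output_version id w wK.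
have k0 : (0 : R) <= k%:R *+ 2 by rewrite mulrn_wge0.
have mab' : a + k%:R *+ 2 * m%:R <= b by rewrite -lerBrDl.
have NCm' : N%:R * C < k.+1%:R^-1 * m%:R by rewrite [ltRHS]mulrC ltr_pdivlMr.
have [l lm IRl] := small_piece bd d0 k0 mab' (output_integral w wK bd d0 d_eta) NCm'.
have E1 : a + k%:R *+ 2 * l%:R + k%:R - k%:R = a + k%:R *+ 2 * l%:R by rewrite addrK.
have E2 : a + k%:R *+ 2 * l%:R + k%:R + k%:R = a + k%:R *+ 2 * l.+1%:R.
  by rewrite -[l.+1%:R]natr1 mulrDr mulr1 mulr2n !addrA.
have al : a <= a + k%:R *+ 2 * l%:R by rewrite lerDl mulr_ge0.
have lb : a + k%:R *+ 2 * l.+1%:R <= b.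
  by apply: le_trans mab'; rewrite lerD2l ler_wpM2l// ler_nat.
exists (a + k%:R *+ 2 * l%:R + k%:R); rewrite E1 E2; split => // g bg g0 gE.
rewrite (_ : IR g _ _ = IR d (a + k%:R *+ 2 * l%:R) (a + k%:R *+ 2 * l.+1%:R))//.
apply: IR_eq_ae => //; apply: ae_mono (ae_and gE d_eta) => t [h1 h2] tl.
rewrite (h1 tl) h2//; case/andP : tl => t1 t2.
by rewrite (le_trans al t1) (le_trans t2 lb).
Qed.

Context (fhat Df : 'I_N -> R -> 'rV[R]_n -> 'rV[R]_n) (wf wh : 'I_N -> R -> R).
Context (cK : compact K) (e0 : 0 < e) (chi_closed : forall i, closed (chi i)).
Context (f_dec : forall i t xi, 0 <= t -> X xi -> f i t xi = fhat i t xi + Df i t xi).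
Context (h_zeroing : forall i, zeroing_pair X (hout i) (Df i)).
Context (fhat_meas : forall i, measurable_in_t (@nonneg_reals R) X (fhat i)).
Context (fhat_le : forall i, {ae @lebesgue_measure R, forall t : R, 0 <= t ->
  forall xi, K xi -> enorm (fhat i t xi) <= M}).
Context (wf_K : forall i, classK (wf i)) (wh_K : forall i, classK (wh i)).
Context (fhat_mod : forall i, {ae @lebesgue_measure R, forall t : R, 0 <= t ->
  forall xi zeta, K xi -> K zeta ->
  enorm (fhat i t xi - fhat i t zeta) <= wf i (enorm (xi - zeta))}).
Context (h_mod : forall i, {ae @lebesgue_measure R, forall t : R, 0 <= t ->
  forall xi zeta, K xi -> K zeta ->
  enorm (hout i t xi - hout i t zeta) <= wh i (enorm (xi - zeta))}).
Context (fhat_pre : forall i, precompact_fun X (fhat i)).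
Context (h_pre : forall i, precompact_fun X (hout i)).
Context (Sigma_WZSD : limiting_systems_WZSD X chi T fhat hout).

Lemma annulus_exit : exists T0 : R, forall tau a b, window tau a b ->
  (forall t, a <= t <= b -> K (state tau t) /\ e <= enorm (state tau t)) -> b - a <= T0.
Proof.
apply: contrapT => nT0.
have /choice[tc tcP] : forall k : nat, exists tc : trajectory R n N * R,
    [/\ window tc.1 (tc.2 - k%:R) (tc.2 + k%:R),
      forall t, tc.2 - k%:R <= t <= tc.2 + k%:R ->
        K (state tc.1 t) /\ e <= enorm (state tc.1 t) &
      forall g : R -> R, bm g -> (forall t, 0 <= g t) ->
        {ae @lebesgue_measure R, forall t : R, tc.2 - k%:R <= t <= tc.2 + k%:R ->
          g t = eta (signal tc.1 t) t (state tc.1 t)} ->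
        IR g (tc.2 - k%:R) (tc.2 + k%:R) <= k.+1%:R^-1].
  move=> k; apply: contrapT => nk; apply: nT0.
  (* If no suitable window existed for this k, the length required by [small_window] would be an
     exit time. *)
  exists (k%:R *+ 2 * (Num.bound (N%:R * C * k.+1%:R))%:R) => tau a b w wK.
  rewrite leNgt; apply/negP => /ltW mab; apply: nk.
  have NCm : N%:R * C * k.+1%:R < (Num.bound (N%:R * C * k.+1%:R))%:R :> R.
    by apply: archi_boundP; rewrite !mulr_ge0.
  have [c [ac cb cP]] := small_window w (fun t tab => (wK t tab).1) NCm mab.
  exists (tau, c); split => //=.
    by apply: (sub_window ac _ cb w); rewrite lerD2l ge0_cp.
  move=> t /andP[t1 t2]; apply: wK.
  by rewrite (le_trans ac t1) (le_trans t2 cb).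
pose tau k := (tc k).1; pose c k := (tc k).2.
have w k : window (tau k) (c k - k%:R) (c k + k%:R) by case: (tcP k).
have wK k t : c k - k%:R <= t <= c k + k%:R -> K (state (tau k) t).
  by move=> tk; have [_ /(_ t tk)[]] := tcP k.
have we k t : c k - k%:R <= t <= c k + k%:R -> e <= enorm (state (tau k) t).
  by move=> tk; have [_ /(_ t tk)[]] := tcP k.
have ck k : c k - k%:R <= c k + k%:R by have [] := w k.
have sr k t : \forall s \near t^'+, signal (tau k) s = signal (tau k) t.
  by have [/T_traj[[_ ]]] := w k.
have /choice[D DP] : forall kj : nat * 'I_n, exists d : R -> R,
    [/\ bm d, forall t, `|d t| <= M & {ae @lebesgue_measure R, forall t : R,
      c kj.1 - kj.1%:R <= t <= c kj.1 + kj.1%:R ->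
      d t = f (signal (tau kj.1) t) t (state (tau kj.1) t) 0 kj.2}].
  move=> [k j] /=; apply: window_version => //; last exact: wK.
    by move=> i; case: (f_car i).
  by move=> i; case: (f_car i).
have /choice[E EP] : forall k, exists g : R -> R, [/\ bm g, forall t, 0 <= g t &
    {ae @lebesgue_measure R, forall t : R, c k - k%:R <= t <= c k + k%:R ->
      g t = eta (signal (tau k) t) t (state (tau k) t)}].
  by move=> k; apply: (output_version id) => //; exact: wK.
have shift k (t : R) : - k%:R <= t <= k%:R -> c k - k%:R <= c k + t <= c k + k%:R.
  by rewrite !lerD2l.
pose s_ k t := signal (tau k) (c k + t).
pose y k t := state (tau k) (clamp (c k - k%:R) (c k + k%:R) (c k + t)).
have yE k t : - k%:R <= t <= k%:R -> y k t = state (tau k) (c k + t).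
  by move=> tk; rewrite /y clampE// shift.
apply: (WZSD_no_vanishing_windows cK KX e0 M0 f_dec hE eta_ge0 h_zeroing chi_closed
  f_le fhat_meas fhat_le wf_K fhat_mod h_meas h_le wh_K h_mod fhat_pre h_pre Sigma_WZSD
  (sig := fun k => signal (tau k)) (gam := c) (s_ := s_) (y := y)
  (D := fun k j t => D (k, j) (c k + t)) (E := fun k t => E k (c k + t))) => //.
  by move=> k; exists (tau k) => //; case: (w k).
split.
(* The window starts at c k - k, a time of a trajectory and hence nonnegative. *)
- move=> k; rewrite -subr_ge0. exact: (window_ge0 (w k)).
- move=> k t.
  have /nbhs_ballP[d /= d0 dP] := sr k (c k + t).
  apply/nbhs_ballP; exists d => // s /=; rewrite -ball_normE/= => ts lt_ts.
  by apply: dP; rewrite ?ltrD2l// -ball_normE/= opprD addrACA subrr add0r.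
- by move=> k t; apply: wK; exact: clamp_itv.
- by move=> k t; apply: we; exact: clamp_itv.
- move=> k s t; apply: le_trans (window_lip (w k) (@wK k) (c k + s) (c k + t)) _.
  by rewrite opprD addrACA subrr add0r.
- by move=> k j; apply: bm_shift; case: (DP (k, j)).
- by move=> k j t; case: (DP (k, j)).
- move=> k j; have [_ _ dE] := DP (k, j).
  by apply: ae_mono (ae_shift (c k) dE) => t h1 tk; rewrite yE// h1// shift.
- move=> k j a b ka ab kb; have [bd _ dE] := DP (k, j).
  have ka' : c k - k%:R <= c k + a by rewrite lerD2l.
  have ab' : c k + a <= c k + b by rewrite lerD2l.
  have kb' : c k + b <= c k + k%:R by rewrite lerD2l.
  rewrite (IR_shift (c k) ab bd).
  apply: (absc_eq_IR (phi := fun t => state (tau k) (clamp (c k - k%:R) (c k + k%:R) t) 0 j)) => //.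
    apply: (@lip_absc _ _ _ M) => s t _ st _.
    have := window_lip (w k) (@wK k) t s.
    have := coord_le_mxnorm (state (tau k) (clamp (c k - k%:R) (c k + k%:R) t) -
       state (tau k) (clamp (c k - k%:R) (c k + k%:R) s)) j.
    rewrite !mxE => h1 h2; apply: le_trans h1 (le_trans h2 _).
    by rewrite ger0_norm// subr_ge0.
  apply: ae_mono (ae_and dE (window_deriv (w k))) => t [h1 h2] /andP[t1 t2].
  have tl : c k - k%:R < t by exact: le_lt_trans ka' t1.
  have tr : t < c k + k%:R by exact: lt_le_trans t2 kb'.
  rewrite h1 ?(ltW tl) ?(ltW tr)//; apply: has_deriv_coord; apply: h2.
  by rewrite tl tr.
- by move=> k; have [bE _ _] := EP k; exact: bm_shift.
- by move=> k t; case: (EP k).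
- move=> k; have [_ _ EE] := EP k.
  by apply: ae_mono (ae_shift (c k) EE) => t h1 tk; rewrite yE// h1// shift.
- move=> k; have [bE E0 EE] := EP k; have k0 : (- k%:R : R) <= k%:R by rewrite ge0_cp.
  by rewrite IR_shift//; have [_ _ IRk] := tcP k; exact: IRk.
- by move=> k t tk; rewrite yE//; exact: (window_chi (w k) (shift _ _ tk)).
Qed.

End trajectories.

(** * Stability chains *)

Lemma enorm_ball_compact (R : realType) (n : nat) (r : R) :
  compact [set xi : 'rV[R]_n | enorm xi <= r].
Proof.
apply: bounded_closed_compact.
  exists r; split; first exact: num_real.
  move=> M rM xi /= xir; exact: le_trans (mxnorm_le_enorm xi) (le_trans xir (ltW rM)).
apply: (@closed_comp _ _ (@enorm R n) [set x : R | x <= r]); last exact: closed_le.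
by move=> xi _; exact: enorm_continuous.
Qed.

Lemma uniformly_bounded_family (R : realType) (n m : nat) (I : finType) (J : set R)
    (X K : set 'rV[R]_n) (g : I -> R -> 'rV[R]_n -> 'rV[R]_m) :
  (forall i, uniformly_bounded J X (g i)) -> compact K -> K `<=` X ->
  exists2 M : R, 0 <= M & forall i, {ae @lebesgue_measure R, forall t : R, J t ->
    forall xi, K xi -> enorm (g i t xi) <= M}.
Proof.
move=> gb cK KX.
have /choice[M MP] := fun i => uniformly_bounded_ae (gb i) cK KX.
exists (\sum_i M i); first by apply: sumr_ge0 => i _; case: (MP i).
move=> i; apply: ae_mono (MP i).2 => t H Jt xi Kxi; apply: le_trans (H Jt xi Kxi) _.
by rewrite (bigD1 i)//= lerDl sumr_ge0// => i' _; case: (MP i').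
Qed.

Lemma uniform_modulus_ae (R : realType) (n m : nat) (J : set R) (X K : set 'rV[R]_n)
    (g : R -> 'rV[R]_n -> 'rV[R]_m) :
  continuous_in_xi_uniformly_in_t J X g -> compact K -> K `<=` X ->
  exists w : R -> R, classK w /\ {ae @lebesgue_measure R, forall t : R, J t ->
    forall xi zeta, K xi -> K zeta -> enorm (g t xi - g t zeta) <= w (enorm (xi - zeta))}.
Proof.
move=> [J' [_ nJ gw]] cK KX; have [w wK gwK] := gw K cK KX.
exists w; split => //; apply: negligibleS nJ => t /= /not_implyP[Jt nb]; split => // J't.
by apply: nb => xi zeta; exact: gwK.
Qed.

Lemma classK_ge0 (R : realType) (phi : R -> R) (r : R) : classK phi -> 0 <= r -> 0 <= phi r.
Proof. by move=> phiK r0; have [_ _ phi0] := phiK; rewrite -phi0; exact: classK_le. Qed.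

Lemma classK_gt0 (R : realType) (phi : R -> R) (r : R) : classK phi -> 0 < r -> 0 < phi r.
Proof. by move=> [_ phi_lt phi0] r0; rewrite -phi0; exact: phi_lt. Qed.

(** Built backwards from r N = e: continuity of phi2 at 0 gives a predecessor to every positive
    radius. *)
Lemma chain_down (R : realType) (phi1 phi2 : R -> R) (N : nat) (e : R) :
  classK phi1 -> classK phi2 -> 0 < e ->
  exists r : nat -> R, [/\ 0 < r 0%N, forall j, r j <= r j.+1,
    forall j, (j < N)%N -> phi2 (r j) < phi1 (r j.+1) & r N = e].
Proof.
move=> phi1_K phi2_K e0.
have /choice[G GP] : forall s : R, exists d : R,
    0 < s -> [/\ 0 < d, d <= s & phi2 d < phi1 s].
  move=> s; have [s0|s0] := ltP 0 s; last first.
    by exists 0 => //.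
  have p0 : 0 < phi1 s / 2 by rewrite divr_gt0// classK_gt0.
  have [d d0 dP] := classK_small phi2_K p0.
  exists (Num.min s (d / 2)) => _.
  have m0 : 0 < Num.min s (d / 2) by rewrite lt_min s0 divr_gt0.
  split => //; first by rewrite ge_min lexx.
  have md : Num.min s (d / 2) < d by rewrite gt_min; apply/orP; right; lra.
  have := dP _ (ltW m0) md; rewrite ler_norml => /andP[_]; lra.
pose a (m : nat) : R := iter m G e.
have a0 m : 0 < a m by elim: m => [//|m IH] /=; have [] := GP _ IH.
exists (fun j => a (N - j)%N); split.
- exact: a0.
- move=> j; have [jN|Nj] := ltnP j N.
    by rewrite -(subnSK jN)/=; have [] := GP _ (a0 (N - j.+1)%N).
  by rewrite (eqP Nj) (eqP (leqW Nj)).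
- by move=> j jN; rewrite -(subnSK jN) /=; have [] := GP _ (a0 (N - j.+1)%N).
- by rewrite subnn.
Qed.

(** Built forwards from r0: unboundedness of phi1 gives a successor to every radius. *)
Lemma chain_up (R : realType) (phi1 phi2 : R -> R) (N : nat) (r0 : R) :
  classKinf phi1 -> classK phi2 -> 0 <= r0 ->
  exists r : nat -> R, [/\ r 0%N = r0, forall j, r j <= r j.+1 &
    forall j, (j < N)%N -> phi2 (r j) < phi1 (r j.+1)].
Proof.
move=> [phi1_K phi1_unb] phi2_K r00.
have /choice[G GP] : forall s : R, exists d : R, s <= d /\ phi2 s < phi1 d.
  move=> s; have [d d0 sd] := phi1_unb (phi2 s).
  exists (Num.max s d); split; first by rewrite le_max lexx.
  by apply: lt_le_trans sd _; apply: classK_le => //; rewrite le_max lexx orbT.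
exists (fun j => iter j G r0); split => //.
- by move=> j /=; have [] := GP (iter j G r0).
- by move=> j _ /=; have [] := GP (iter j G r0).
Qed.

(** * Uniform asymptotic stability, local and global *)

Theorem theoremV1 (R : realType) (n N : nat) (X : set 'rV[R]_n)
    (f : 'I_N -> R -> 'rV[R]_n -> 'rV[R]_n)
    (T : set (trajectory R n N)) (chi : 'I_N -> set 'rV[R]_n)
    (V : 'I_N -> R -> 'rV[R]_n -> R)
    (Vt : 'I_N -> R -> 'rV[R]_n -> R) (Vx : 'I_N -> R -> 'rV[R]_n -> 'rV[R]_n)
    (phi1 phi2 : R -> R)
    (eta : 'I_N -> R -> 'rV[R]_n -> R)
    (h : 'I_N -> R -> 'rV[R]_n -> 'rV[R]_1)
    (fhat Deltaf : 'I_N -> R -> 'rV[R]_n -> 'rV[R]_n)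
    (X_open : open X) (X_0 : X 0)
    (f_car : forall i, caratheodory_conditions X (f i))
    (T_traj : forall tau, T tau -> is_trajectory X f tau)
    (chi_cov : closed_covering chi)
    (T_inv : invariant_family T chi)
    (V_ge0 : forall i t xi, 0 <= t -> X xi -> 0 <= V i t xi)
    (phi1_K : classK phi1) (phi2_K : classK phi2)
    (V_bounds : forall i t xi, 0 <= t -> chi i xi -> X xi ->
      phi1 (enorm xi) <= V i t xi /\ V i t xi <= phi2 (enorm xi))
    (V_C1 : forall i, continuously_differentiable X (V i) (Vt i) (Vx i))
    (eta_ge0 : forall i t xi, 0 <= t -> X xi -> 0 <= eta i t xi)
    (h_def : h = fun i t xi => const_mx (eta i t xi))
    (eta_meas : forall i, measurable_in_t (@nonneg_reals R) X (h i))
    (eta_cont : forall i, continuous_in_xi (@nonneg_reals R) X (h i))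
    (V_decr : forall i t xi, 0 <= t -> chi i xi -> X xi ->
      Vt i t xi + dotv (Vx i t xi) (f i t xi) <= - eta i t xi)
    (V_switch : forall tau, T tau -> forall i t s,
      t0 tau <= t -> t < s -> (s%:E < tf tau)%E ->
      signal tau t = i -> signal tau s = i ->
      V i s (state tau s) <= V i t (state tau t))
    (f_bnd : forall i, uniformly_bounded (@nonneg_reals R) X (f i))
    (h_reg : forall i, [/\ uniformly_bounded (@nonneg_reals R) X (h i),
      measurable_in_t (@nonneg_reals R) X (h i),
      continuous_in_xi_uniformly_in_t (@nonneg_reals R) X (h i) &
      precompact_fun X (h i)])
    (f_dec : forall i t xi, 0 <= t -> X xi ->
      f i t xi = fhat i t xi + Deltaf i t xi)
    (fhat_reg : forall i, [/\ uniformly_bounded (@nonneg_reals R) X (fhat i),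
      measurable_in_t (@nonneg_reals R) X (fhat i),
      continuous_in_xi_uniformly_in_t (@nonneg_reals R) X (fhat i) &
      precompact_fun X (fhat i)])
    (h_zeroing : forall i, zeroing_pair X (h i) (Deltaf i))
    (Sigma_WZSD : limiting_systems_WZSD X chi T fhat h) :
  UAS T /\
  (X = setT -> classKinf phi1 -> classKinf phi2 -> GUAS X T).
Proof.
have [chi_closed _] := chi_cov.
have hE i t xi : h i t xi = const_mx (eta i t xi) by rewrite h_def.
have [h_bnd h_unif h_pre] : [/\ forall i, uniformly_bounded (@nonneg_reals R) X (h i),
    forall i, continuous_in_xi_uniformly_in_t (@nonneg_reals R) X (h i) &
    forall i, precompact_fun X (h i)].
  by split=> i; case: (h_reg i).
have [fhat_bnd fhat_meas [fhat_unif fhat_pre]] :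
    [/\ forall i, uniformly_bounded (@nonneg_reals R) X (fhat i),
    forall i, measurable_in_t (@nonneg_reals R) X (fhat i) &
    (forall i, continuous_in_xi_uniformly_in_t (@nonneg_reals R) X (fhat i)) /\
    forall i, precompact_fun X (fhat i)].
  by split; [| |split] => i; case: (fhat_reg i).
have chain := stability_chain T_traj T_inv phi1_K phi2_K V_bounds V_switch.
have exit (K : set 'rV[R]_n) (e : R) : compact K -> K `<=` X -> 0 < e ->
    exists T0 : R, forall tau a b, window T tau a b ->
    (forall t, a <= t <= b -> K (state tau t) /\ e <= enorm (state tau t)) -> b - a <= T0.
  move=> cK KX e0.
  have [M1 M10 f_le] := uniformly_bounded_family f_bnd cK KX.
  have [M2 M20 h_le] := uniformly_bounded_family h_bnd cK KX.
  have [M3 M30 fhat_le] := uniformly_bounded_family fhat_bnd cK KX.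
  have /choice[wf wfP] := fun i => uniform_modulus_ae (fhat_unif i) cK KX.
  have /choice[wh whP] := fun i => uniform_modulus_ae (h_unif i) cK KX.
  have [B [_ /(_ (`|B| + 1))BP]] := compact_bounded cK.
  have B0 : 0 <= n%:R * (`|B| + 1) by rewrite mulr_ge0// addr_ge0.
  (* On K the max norm is at most |B| + 1, hence the Euclidean norm is at most n * (|B| + 1); phi2
     of this is the bound C on V. *)
  have V_le i t xi : 0 <= t -> chi i xi -> K xi ->
      0 <= V i t xi <= phi2 (n%:R * (`|B| + 1)).
    move=> t_ge0 cxi Kxi; rewrite V_ge0//=; last exact: KX.
    have [_ V2] := V_bounds _ _ _ t_ge0 cxi (KX _ Kxi); apply: le_trans V2 _.
    apply: classK_le => //; first exact: enorm_ge0.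
    apply: le_trans (enorm_le_mxnorm xi) _; rewrite ler_wpM2l//.
    by apply: BP Kxi; rewrite ltr_pwDr// ler_norm.
  have M0 : 0 <= M1 + M2 + M3 by rewrite !addr_ge0.
  apply: (annulus_exit f_car T_traj T_inv V_C1 eta_ge0 hE eta_meas eta_cont V_decr
    V_switch KX M0 _ (classK_ge0 phi2_K B0) _ V_le cK e0 chi_closed f_dec h_zeroing
    fhat_meas _ (fun i => (wfP i).1) (fun i => (whP i).1) (fun i => (wfP i).2)
    (fun i => (whP i).2) fhat_pre h_pre Sigma_WZSD) => i.
  - by apply: ae_mono (f_le i) => t H t_ge0 xi Kxi; have := H t_ge0 xi Kxi; lra.
  - by apply: ae_mono (h_le i) => t H t_ge0 xi Kxi; have := H t_ge0 xi Kxi; lra.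
  - by apply: ae_mono (fhat_le i) => t H t_ge0 xi Kxi; have := H t_ge0 xi Kxi; lra.
have attract (K : set 'rV[R]_n) (e : R) : compact K -> K `<=` X -> 0 < e ->
    exists T0 : R, forall tau s t, window T tau s t ->
    (forall q, s <= q <= t -> K (state tau q)) -> T0 <= t - s -> enorm (state tau t) <= e.
  move=> cK KX e0; have [r [r0 r_le r_lt rN]] := chain_down N phi1_K phi2_K e0.
  have [T0 T0P] := exit K (r 0%N) cK KX r0.
  (* A piece longer than T0 inside K must meet the ball of radius r 0; from that time on the chain
     keeps the state below r N = e. The + 1 makes the contradiction strict. *)
  exists (T0 + 1) => tau s t w wK Tts.
  have [q [sq qt xq]] : exists q, [/\ s <= q, q <= t & enorm (state tau q) <= r 0%N].
    apply: contrapT => nq.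
    have : t - s <= T0.
      apply: T0P w _ => q sqt; split; first exact: wK.
      rewrite leNgt; apply/negP => /ltW xq; apply: nq; exists q.
      by case/andP : sqt.
    lra.
  by rewrite -rN; exact: chain (sub_window sq qt (lexx t) w) (ltW r0) r_le r_lt xq.
(* [good] selects the initial radii: at most r 0 for the local statement, all of them for the global
   one. M bounds the trajectories and also gives a compact ball inside X to which [attract]
   applies. *)
have KL (good : R -> Prop) :
    (forall r0 : R, 0 <= r0 -> exists M : R, (forall xi : 'rV[R]_n, enorm xi <= M -> X xi) /\
      forall tau s t, window T tau s t -> good (enorm (state tau s)) ->
      enorm (state tau s) <= r0 -> enorm (state tau t) <= M) ->
    exists2 b : R -> R -> R, classKL b & forall tau s t, window T tau s t ->
      good (enorm (state tau s)) -> enorm (state tau t) <= b (enorm (state tau s)) (t - s).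
  move=> stay.
  pose A (a th y : R) := exists tau s t, [/\ window T tau s t, good (enorm (state tau s)),
    a = enorm (state tau s), th = t - s & y = enorm (state tau t)].
  suff [b bKL bP] : exists2 b : R -> R -> R, classKL b & forall a th y, A a th y -> y <= b a th.
    by exists b => // tau s t w gs; apply: bP; exists tau, s, t.
  apply: KL_bound.
  - move=> a th y [tau [s [t [[_ _ st _] _ -> -> ->]]]].
    by rewrite !enorm_ge0 subr_ge0.
  - move=> r0 r00; have [M [_ MP]] := stay r0 r00.
    by exists M => a th y [tau [s [t [w gs -> _ ->]]]]; exact: MP w gs.
  - move=> e e0; have [r [r_gt0 r_le r_lt rN]] := chain_down N phi1_K phi2_K e0.
    exists (r 0%N) => // a th y [tau [s [t [w _ -> _ ->]]]] xs.
    by rewrite -rN; exact: chain w (ltW r_gt0) r_le r_lt xs.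
  - move=> r0 e r00 e0; have [M [MX MP]] := stay r0 r00.
    have [T0 T0P] := attract _ e (@enorm_ball_compact R n M) MX e0.
    exists T0 => a th y [tau [s [t [w gs -> -> ->]]]] xs; apply: T0P => // q /andP[sq qt].
    exact: MP (sub_window (lexx s) sq qt w) gs xs.
split.
  (* The chain ends at a radius rho whose closed ball lies in X, so trajectories starting within r 0
     stay in a compact subset of X; r 0 serves as the threshold in [UAS]. *)
  have [rho rho0 rhoX] : exists2 rho : R, 0 < rho &
      forall xi : 'rV[R]_n, enorm xi <= rho -> X xi.
    have /nbhs_ballP[d /= d0 dX] : nbhs (0 : 'rV[R]_n) X by exact: open_nbhs_nbhs.
    exists (d / 2); first by rewrite divr_gt0.
    move=> xi xid; apply: dX; rewrite -ball_normE/= sub0r normrN.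
    by apply: le_lt_trans (mxnorm_le_enorm xi) _; lra.
  have [r [r_gt0 r_le r_lt rN]] := chain_down N phi1_K phi2_K rho0.
  have [|b bKL bP] := KL (fun a => a <= r 0%N).
    move=> r1 _; exists rho; split=> // tau s t w xs _.
    by rewrite -rN; exact: chain w (ltW r_gt0) r_le r_lt xs.
  exists b, (r 0%N); split => // tau Ttau s [ts sf] xs t st tf'.
  by apply: bP; [|exact: ltW].
move=> XT phi1_Kinf phi2_Kinf; split => //.
have [|b bKL bP] := KL (fun=> True).
  move=> r0 r00; have [r [rE r_le r_lt]] := chain_up N phi1_Kinf phi2_K r00.
  exists (r N); split=> [xi _|tau s t w _ xs]; first by rewrite XT.
  by apply: chain w _ r_le r_lt _; rewrite rE.
by exists b => // tau Ttau s [ts sf] t st tf'; apply: bP.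
Qed.
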